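(* Fix $0<p<\tfrac12$, let $q=1-p$, $m_p=\lfloor 1/\log_2(1/q)\rfloor$, and let $1\le t\le m_p$. Let $X_t$ be the number of components of $Q_p=Q_p^d$ with exactly $t$ vertices and $\mu_t=\mathbb{E}[X_t]$. Then as $d\to\infty$: (a) $\mu_t=(1+O(\tfrac1d))\,\frac{t^{t-2}}{t!}\left(\frac{p}{q^2}\right)^{t-1}d^{t-1}(2q^t)^d$, and $\mathrm{Var}(X_t)=(1+O(d^tq^{td}))\,\mu_t$; (b) for each $\varepsilon>0$, $|X_t-\mu_t|<\varepsilon\sqrt{d\mu_t}$ with very high probability, and also $|X_t-\mu_t|<\varepsilon\mu_t$ with very high probability; (c) $d_{TV}(X_t,\mathrm{Po}(\mu_t))=O(d^tq^{td})$, and $X_t^*=(X_t-\mu_t)/\sqrt{\mathrm{Var}(X_t)}$ converges in distribution to a standard normal random variable.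
   Context: $Q^d$ is the $d$-dimensional hypercube on $\{0,1\}^d$ (vertices adjacent iff they differ in exactly one coordinate). $Q_p=Q_p^d$ is the random spanning subgraph of $Q^d$ keeping each edge independently with probability $p$. ''With very high probability'' means with probability $1-e^{-\Omega(d)}$ as $d\to\infty$. For integer-valued random variables, $d_{TV}(Y,Y')=\frac12\sum_k|\mathbb{P}(Y=k)-\mathbb{P}(Y'=k)|$; $\mathrm{Po}(\mu)$ denotes a Poisson random variable with mean $\mu$. *)

(* Defs.v *)
From HB Require Import structures.
From mathcomp Require Import all_boot all_order all_algebra.
From mathcomp Require Import all_classical all_reals all_analysis.
Set Implicit Arguments.
Unset Strict Implicit.
Unset Printing Implicit Defensive.
Import Order.TTheory GRing.Theory Num.Theory.
Import numFieldNormedType.Exports.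
Local Open Scope classical_set_scope.
Local Open Scope ring_scope.

Notation vertex d := {ffun 'I_d -> bool}.

Definition cube_adj (d : nat) : rel (vertex d) :=
  fun x y => #|[set i : 'I_d | x i != y i]%SET| == 1%N.

Definition cube_edges (d : nat) : {set {set vertex d}} :=
  [set e : {set vertex d} |
    [exists x, exists y, cube_adj x y && (e == [set x; y]%SET)]]%SET.

Notation edge d := {e : {set vertex d} | e \in cube_edges d}.

(* A spanning subgraph of the cube is identified with its set of edges. *)
Definition sub_adj (d : nat) (G : {set edge d}) : rel (vertex d) :=
  fun x y => [exists e in G, val e == [set x; y]%SET].

Definition components (d : nat) (G : {set edge d}) : {set {set vertex d}} :=
  equivalence_partition (connect (sub_adj G)) [set: vertex d]%SET.

Definition comp_count (d t : nat) (G : {set edge d}) : nat :=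
  #|[set C in components G | #|C| == t]%SET|.

Definition Qp (R : realType) (p : R) (d : nat) (G : {set edge d}) : R :=
  \prod_(e : edge d) bernoulli_pmf p (e \in G).

(* P is the probability mass function of a finite sample space T. *)
Section finite_probability.
Variables (R : realType) (T : finType) (P : T -> R).

Definition prob (A : pred T) : R := \sum_(w | A w) P w.

Definition expectation (X : T -> R) : R := \sum_w P w * X w.

Definition variance (X : T -> R) : R :=
  expectation (fun w => (X w - expectation X) ^+ 2).

Definition nat_law (X : T -> nat) (k : nat) : R := prob [pred w | X w == k].

Definition distribution_fun (X : T -> R) (x : R) : R := prob [pred w | X w <= x].

End finite_probability.

Section asymptotics.
Variable R : realType.

(* f d = (1 + O(e d)) g d as d tends to infinity *)
Definition one_plus_bigO (f g e : nat -> R) : Prop :=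
  exists2 h : nat -> R, h =O_\oo e & \forall d \near \oo, f d = (1 + h d) * g d.

(* pr d is the probability of the d-th event: pr d = 1 - exp(- Omega(d)).
   Stated as a lower bound, because pr d = 1 is allowed. *)
Definition very_high_prob (pr : nat -> R) : Prop :=
  exists2 c : R, 0 < c & \forall d \near \oo, 1 - expR (- (c * d%:R)) <= pr d.

(* f and g are the laws of random variables with values in nat, so the terms
   with k < 0 of the sum over the integers vanish. *)
Definition dTV (f g : nat -> R) : R :=
  2^-1 * limn (series (fun k => `|f k - g k|)).

(* F d and G are distribution functions. *)
Definition cvg_in_distribution (F : nat -> R -> R) (G : R -> R) : Prop :=
  forall x : R, {for x, continuous G} -> F d x @[d --> \oo] --> G x.

Definition std_normal_fun (x : R) : R := fine (normal_prob (0 : R) 1 `]-oo, x]).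

Definition log2 (x : R) : R := ln x / ln 2.

Definition m_ (p : R) : int := Num.floor (1 / log2 (1 / (1 - p))).

End asymptotics.

Section component_counts.
Variables (R : realType) (p : R) (t : nat).

Definition X_ (d : nat) (G : {set edge d}) : R := (comp_count t G)%:R.

Definition mu_ (d : nat) : R := expectation (@Qp R p d) (@X_ d).

Definition Var_ (d : nat) : R := variance (@Qp R p d) (@X_ d).

Definition X_star (d : nat) (G : {set edge d}) : R :=
  (X_ G - mu_ d) / Num.sqrt (Var_ d).

End component_counts.

(* Main.v *)
(** Write [X_t] as the sum over the t-sets [A] of vertices of the indicators that
    [A] is a component; the indicator of [A] depends only on the edges that meet
    [A].

    A connected set of [n + 1] vertices varies in at most [n] coordinates.  The sets
    that vary in exactly [t - 1] coordinates induce trees with edges in distinct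
    directions, and [t^(t-2)] of them contain a given vertex and have a given set of
    [t - 1] directions: cutting such a tree at the edge in one direction gives the
    recursion solved by Abel's identity (this is Cayley's formula in disguise).  All
    other connected t-sets lie in subcubes of dimension at most [t - 2] and only
    contribute a factor [O(1/d)] to the mean.

    Each [A] interacts with [O(d^t)] sets, each of which is a component with
    probability [O(q^(td))].  This gives the variance, and the Chen-Stein method gives
    [d_TV(X_t, Po(mu_t)) = O(d^t q^(td))].  As [2 q^t >= 1] forces [mu_t] to be at
    least linear in [d] while the total variation bound is exponentially small,
    concentration follows from the Chernoff bound for [Po(mu_t)], and asymptotic
    normality from that of the Poisson distribution.  For the latter, the Poisson
    distribution function is the tail of a Gamma distribution in its mean, and
    dominated convergence applies to the rescaled Gamma density; its total mass 1
    fixes the normalisation, so Stirling's formula is not needed. *)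

Require Import Defs.
From HB Require Import structures.
From mathcomp Require Import all_boot all_order all_algebra.
From mathcomp Require Import all_classical all_reals all_analysis.
From mathcomp Require Import measurable_realfun zify ring lra.
From mathcomp Require Import fintype finset fingraph.
Set Implicit Arguments.
Unset Strict Implicit.
Unset Printing Implicit Defensive.
Import Order.TTheory GRing.Theory Num.Theory.
Import numFieldNormedType.Exports.

(** At deviation [eps * sqrt (d * mu)] the Chernoff exponent is [eps^2 * d / 8] whatever the size of
    [mu], so a total variation error that decays exponentially in [d] loses nothing in the first
    half of (b). The linear lower bound on [mu] has two uses there: it keeps the deviation in the
    range where the quadratic exponent is valid, and it gives [sqrt (c * d * mu) <= mu], which
    reduces the second half of (b) to the first.

    Dependence between components is mild for a geometric reason: two distinct components are
    disjoint, and a boundary edge of [B] that meets [A] joins [A] to [B], so there are at most [t^2]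
    of them. Knowing that [A] is a component therefore changes the bound for [B] by a constant
    factor only.

    For the normal limit the roles of count and mean are exchanged. The threshold [N], the floor of
    [mu + x * sqrt Var], is taken as the parameter and the mean is written as [N + sqrt N * y] with
    [y] tending to [- x]; the answer appears as an upper normal tail at [- x], and symmetry turns it
    into the distribution function at [x]. *)

Local Notation expectation := Defs.expectation.
Local Notation variance := Defs.variance.

(** * Connected sets of vertices *)

Section cut_connectivity.
Variables (V : finType).
Implicit Types (r : rel V) (A B : {set V}).

(* Connectedness is expressed by cuts rather than paths: splitting a set along a
   direction and contracting a direction then need no surgery on paths. *)
Definition cut_connected r A :=
  [forall B : {set V}, (B \subset A) && (B != set0) && (B != A) ==>
    [exists u in B, exists v in A :\: B, r u v]].

Lemma cut_connectedP r A :
  reflect (forall B, B \subset A -> B != set0 -> B != A ->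
             exists u v, [/\ u \in B, v \in A, v \notin B & r u v])
          (cut_connected r A).
Proof.
apply: (iffP forallP) => [h B sBA B0 BA|h B].
  have := h B; rewrite sBA B0 BA /= => /existsP[u /andP[uB /existsP[v]]].
  by rewrite inE => /andP[/andP[vB vA] ruv]; exists u, v.
apply/implyP => /andP[/andP[sBA B0] BA].
have [u [v [uB vA vB ruv]]] := h B sBA B0 BA.
by apply/existsP; exists u; rewrite uB; apply/existsP; exists v; rewrite inE vA vB.
Qed.

Lemma sub_cut_connected r r' A :
  (forall u v, u \in A -> v \in A -> r u v -> r' u v) ->
  cut_connected r A -> cut_connected r' A.
Proof.
move=> rr' /cut_connectedP h; apply/cut_connectedP => B sBA B0 BA.
have [u [v [uB vA vB ruv]]] := h B sBA B0 BA.
by exists u, v; split => //; apply: rr' => //; apply: (subsetP sBA).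
Qed.

(** A part of a class that no edge leaves is closed under [connect], hence is the whole class.
    Conversely, the class of a point of the closed set [A] stays in [A]; if it were smaller, an edge
    across this cut would enlarge it. *)
Lemma mem_components_cut r A : symmetric r ->
  (A \in equivalence_partition (connect r) [set: V]) =
  [&& A != set0, cut_connected r A & [forall u in A, forall v, r u v ==> (v \in A)]].
Proof.
move=> rsym; have csym := sym_connect_sym rsym.
apply/imsetP/and3P => [[x _ ->]|[/set0Pn[x xA] cA clA]].
  split.
  - by apply/set0Pn; exists x; rewrite !inE connect0.
  - apply/cut_connectedP => B sBA /set0Pn[u uB] BA.
    case: (pickP [pred e : V * V | [&& e.1 \in B, e.2 \notin B & r e.1 e.2]]) => [[w v]|no].
      move=> /and3P[/= wB vB rwv]; exists w, v; split => //.
      have := subsetP sBA _ wB; rewrite !inE /= => h.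
      by rewrite (connect_trans h)// connect1.
    have clB : closed r B.
      apply: intro_closed => // w v rwv wB; apply: contraT => vB.
      by have := no (w, v); rewrite /= wB vB rwv.
    have xB : x \in B.
      have := subsetP sBA _ uB; rewrite !inE /= => xu.
      by rewrite (closed_connect clB xu).
    case/negP: BA; rewrite eqEsubset sBA; apply/subsetP => v; rewrite !inE /= => xv.
    by rewrite -(closed_connect clB xv).
  - apply/forallP => u; apply/implyP; rewrite !inE /= => xu.
    apply/forallP => v; apply/implyP => ruv; rewrite !inE /=.
    by rewrite (connect_trans xu)// connect1.
exists x => //.
have clA' : closed r A.
  apply: intro_closed => // u v ruv uA.
  by move: clA => /forallP/(_ u); rewrite uA => /forallP/(_ v); rewrite ruv.
set C := [set y in [set: V] | connect r x y].
have sCA : C \subset A.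
  by apply/subsetP => y; rewrite !inE /= => xy; rewrite -(closed_connect clA' xy).
apply/eqP; rewrite eq_sym; apply: contraTT isT => nCA.
have C0 : C != set0 by apply/set0Pn; exists x; rewrite !inE connect0.
have [u [v []]] := cut_connectedP _ _ cA C sCA C0 nCA.
rewrite !inE /= => xu vA /negP xv ruv; case: xv.
by rewrite (connect_trans xu)// connect1.
Qed.

End cut_connectivity.

Lemma card_bigcup_leq (I T : finType) (P : {set I}) (F : I -> {set T}) m :
  (forall i, i \in P -> #|F i| <= m) -> #|\bigcup_(i in P) F i| <= #|P| * m.
Proof.
move=> h; apply: (@leq_trans (\sum_(i in P) m)); last by rewrite sum_nat_const.
apply: leq_trans (_ : \sum_(i in P) #|F i| <= _); last exact: leq_sum.
apply: (big_rec2 (fun (X : {set T}) n => #|X| <= n)) => [|i n X _ hn].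
  by rewrite cards0.
by rewrite (leq_trans (leq_card_setU _ _))// leq_add2l.
Qed.

(** * Spans, subcubes and tight sets in the cube *)

Section cube.
Variable d : nat.
Implicit Types (u v w : vertex d) (A B : {set vertex d}) (i x : 'I_d) (D : {set 'I_d}).

Definition flip v i : vertex d := [ffun j => v j (+) (j == i)].

Definition adj : rel (vertex d) := fun u v => [exists i, v == flip u i].

(** For non-empty [A], the free directions of the smallest subcube that contains [A]. *)
Definition span A : {set 'I_d} :=
  [set i | [exists u in A, exists v in A, u i != v i]].

Lemma flipK i : involutive (flip^~ i).
Proof. by move=> v; apply/ffunP => j; rewrite !ffunE -addbA addbb addbF. Qed.

Lemma flip_at v i : flip v i i = ~~ v i.
Proof. by rewrite ffunE eqxx addbT. Qed.

Lemma flip_other v i j : j != i -> flip v i j = v j.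
Proof. by rewrite ffunE => /negPf ->; rewrite addbF. Qed.

Lemma flip_neq v i : flip v i != v.
Proof. by apply/eqP => /ffunP/(_ i); rewrite flip_at; case: (v i). Qed.

Lemma flip_inj v : injective (flip v).
Proof.
move=> i j /ffunP/(_ i); rewrite flip_at ffunE.
by case: eqP => // _; case: (v i).
Qed.

Lemma adjP u v : reflect (exists i, v = flip u i) (adj u v).
Proof. by apply: (iffP existsP) => -[i /eqP]; exists i => //; apply/eqP. Qed.

Lemma adj_sym : symmetric adj.
Proof.
by move=> u v; apply/adjP/adjP => -[i ->]; exists i; rewrite flipK.
Qed.

Lemma spanP A i : reflect (exists u v, [/\ u \in A, v \in A & u i != v i]) (i \in span A).
Proof.
rewrite inE; apply: (iffP existsP) => [[u /andP[uA /existsP[v /andP[vA uv]]]]|].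
  by exists u, v.
by move=> [u [v [uA vA uv]]]; exists u; rewrite uA; apply/existsP; exists v; rewrite vA.
Qed.

Lemma span_bool A i b : i \in span A -> exists2 u, u \in A & u i = b.
Proof.
case/spanP => u [v [uA vA uv]]; have [<-|ub] := eqVneq (u i) b; first by exists u.
by exists v => //; case: (u i) (v i) b uv ub => -[] [].
Qed.

Lemma span_notin A i u v : i \notin span A -> u \in A -> v \in A -> u i = v i.
Proof. by move=> iA uA vA; apply: contraNeq iA => uv; apply/spanP; exists u, v. Qed.

Lemma spanS A B : A \subset B -> span A \subset span B.
Proof.
move=> /subsetP sAB; apply/subsetP => i /spanP[u [v [uA vA uv]]].
by apply/spanP; exists u, v; split => //; apply: sAB.
Qed.

Lemma span1 v : span [set v] = set0.
Proof.
by apply/setP => i; rewrite in_set0; apply/spanP => -[u [w [/set1P-> /set1P->]]]; rewrite eqxx.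
Qed.

Lemma span_flip A u i : u \in A -> span (flip u i |: A) \subset i |: span A.
Proof.
move=> uA; apply/subsetP => j; rewrite in_setU1; have [//|ji /=] := eqVneq j i.
apply: contraTT => jA; apply/spanP => -[v [w []]]; rewrite !in_setU1.
by case/orP => [/eqP->|vA]; case/orP => [/eqP->|wA]; rewrite ?flip_other ?eqxx//;
  move/eqP; apply; apply: span_notin jA _ _.
Qed.

(** Grow [A] from one vertex, each time adding a vertex across the cut around the part already
    built: by [span_flip] it brings at most one new direction. *)
Lemma card_span A : cut_connected adj A -> A != set0 -> #|span A| < #|A|.
Proof.
move=> /cut_connectedP cA /set0Pn[v vA].
suff H k : k < #|A| -> exists B, [/\ B \subset A, #|B| = k.+1 & #|span B| <= k].
  have A0 : 0 < #|A| by apply/card_gt0P; exists v.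
  have [|B [sBA cB sB]] := H #|A|.-1; first by rewrite prednK.
  have -> : A = B by apply/esym/eqP; rewrite eqEcard sBA cB prednK /=.
  by rewrite cB ltnS.
elim: k => [_|k IH kA].
  by exists [set v]; rewrite sub1set cards1 span1 cards0; split.
have [B [sBA cB sB]] := IH (ltnW kA).
have [||u [w [uB wA wB /adjP[i wE]]]] := cA B sBA.
- by rewrite -card_gt0 cB.
- by apply: contraTneq kA => <-; rewrite cB ltnn.
exists (w |: B); split.
- by apply/subsetP => z; rewrite in_setU1 => /orP[/eqP->|/(subsetP sBA)].
- by rewrite cardsU1 wB cB.
- rewrite wE; apply: leq_trans (subset_leq_card (span_flip i uB)) _.
  by rewrite cardsU1; lia.
Qed.

(** The subcube through [v] with free directions [D]. *)
Definition box v D : {set vertex d} := 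
  [set u : vertex d | [forall i, (u i != v i) ==> (i \in D)]].

Lemma card_box v D : #|box v D| <= 2 ^ #|D|.
Proof.
pose f u : {set 'I_d} := [set i | u i != v i].
rewrite -card_powerset -(@card_in_imset _ _ f).
  apply/subset_leq_card/subsetP => S /imsetP[u]; rewrite inE => /forallP h ->.
  rewrite powersetE; apply/subsetP => i; rewrite inE => uv.
  by have := h i; rewrite uv.
move=> u w _ _ /setP uw; apply/ffunP => i; have := uw i; rewrite !inE.
by case: (u i) (v i) (w i) => -[] [].
Qed.

Lemma sub_box_span v A : v \in A -> A \subset box v (span A).
Proof.
move=> vA; apply/subsetP => u uA; rewrite inE; apply/forallP => i; apply/implyP => uv.
by apply/spanP; exists u, v.
Qed.

Lemma boxS v D D' : D \subset D' -> box v D \subset box v D'.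
Proof.
move=> /subsetP sD; apply/subsetP => u; rewrite !inE => /forallP h.
by apply/forallP => i; apply/implyP => ui; apply: sD; have := h i; rewrite ui.
Qed.

(** As [m <= d], the span can be enlarged to exactly [m] directions. There are ['C(d, m)] choices
    for these, and each gives a subcube through [v] with at most [2 ^ m] points, of which the set is
    a subset. *)
Lemma card_small_span v m : m <= d ->
  #|[set A : {set vertex d} | (v \in A) && (#|span A| <= m)]| <= 'C(d, m) * 2 ^ (2 ^ m).
Proof.
move=> md; set F := [set A | _].
have sF : F \subset \bigcup_(D in [set D : {set 'I_d} | #|D| == m]) powerset (box v D).
  apply/subsetP => A; rewrite inE => /andP[vA sA].
  have [D /andP[sAD /eqP cD]] : exists D : {set 'I_d}, (span A \subset D) && (#|D| == m).
    have cC : m - #|span A| <= #|~: span A|.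
      by have := cardsC (span A); rewrite card_ord; lia.
    have : 0 < #|[set S : {set 'I_d} | S \subset ~: span A & #|S| == m - #|span A|]|.
      by rewrite cards_draws bin_gt0.
    case/card_gt0P => S; rewrite inE => /andP[SA /eqP cS].
    exists (span A :|: S); rewrite subsetUl cardsU cS.
    have -> : span A :&: S = set0.
      by apply/eqP; rewrite setI_eq0 disjoint_sym disjoints_subset.
    by rewrite /= cards0 subn0 subnKC.
  apply/bigcupP; exists D; first by rewrite inE cD.
  by rewrite powersetE (subset_trans (sub_box_span vA))// boxS.
apply: leq_trans (subset_leq_card sF) _.
rewrite -[d in 'C(d, _)]card_ord -card_draws; apply: card_bigcup_leq => D.
by rewrite inE card_powerset => /eqP <-; rewrite leq_exp2l// card_box.
Qed.

(* A tight set is the vertex set of an induced tree whose edges have pairwise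
   distinct directions. *)
Definition tight A := cut_connected adj A && (#|A| == #|span A|.+1).

(** Projection onto a facet, which contracts all edges of direction [x]. *)
Definition unset_at x v : vertex d := [ffun j => if j == x then false else v j].

Lemma span_unset_at A x : span (unset_at x @: A) = span A :\ x.
Proof.
apply/setP => i; rewrite in_setD1; apply/spanP/andP => [[u [v [/imsetP[u' uA ->]]]]|[ix]].
  case/imsetP => v' vA ->; rewrite !ffunE; have [//|ix uv] := eqVneq i x; split => //.
  by apply/spanP; exists u', v'.
case/spanP => u [v [uA vA uv]]; exists (unset_at x u), (unset_at x v).
by rewrite !imset_f// !ffunE (negPf ix).
Qed.

(** Pull a cut of the image back to [A]. The edge that crosses it there cannot have direction [x],
    since its ends have different images, so it survives the projection. *)
Lemma cut_connected_unset_at A x :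
  cut_connected adj A -> cut_connected adj (unset_at x @: A).
Proof.
move=> /cut_connectedP cA; apply/cut_connectedP => B sBA B0 BA.
pose B' := [set u in A | unset_at x u \in B].
have BE : unset_at x @: B' = B.
  apply/setP => u; apply/imsetP/idP => [[v]|uB].
    by rewrite inE => /andP[_ vB] ->.
  have /imsetP[v vA uE] := subsetP sBA _ uB.
  by exists v => //; rewrite inE vA -uE.
have [|||u [v [uB vA vB /adjP[i vE]]]] := cA B'.
- by apply/subsetP => u; rewrite inE => /andP[].
- by apply: contraNneq B0 => B'0; rewrite -BE B'0 imset0.
- by apply: contraNneq BA => B'A; rewrite -BE B'A.
move: uB vB; rewrite !inE vA /= => /andP[uA uB] vB.
exists (unset_at x u), (unset_at x v); split => //; first by rewrite imset_f.
apply/adjP; exists i; rewrite vE; have [ix|ix] := eqVneq i x.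
  case/negP: vB; suff -> : unset_at x v = unset_at x u by [].
  by apply/ffunP => j; rewrite vE ix !ffunE; case: eqVneq => //; rewrite addbF.
by apply/ffunP => j; rewrite !ffunE; case: eqVneq => // ->; rewrite eq_sym (negPf ix).
Qed.

(* Contracting direction [x] keeps [A] connected and removes [x] from its span, so
   by [card_span] the contraction identifies at most one pair of vertices. *)
Lemma tight_uniq_edge A x u v : tight A -> x \in span A ->
  u \in A -> flip u x \in A -> v \in A -> flip v x \in A -> u x = v x -> u = v.
Proof.
case/andP => cA /eqP kA xA uA fuA vA fvA uxv; apply/eqP; apply: contraT => uv.
have := card_span (cut_connected_unset_at x cA).
have -> : (unset_at x @: A != set0).
  by apply/set0Pn; exists (unset_at x u); apply: imset_f.
rewrite span_unset_at => /(_ isT).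
have := cardsD1 x (span A); rewrite xA => /= cs.
have unset_flip w : unset_at x (flip w x) = unset_at x w.
  by apply/ffunP => j; rewrite !ffunE; case: eqVneq => //; rewrite addbF.
have fuv : flip u x != flip v x by apply: contraNneq uv => /(can_inj (flipK x)) ->.
have ufv w w' : w x = w' x -> w != flip w' x.
  by move=> ww'; apply/eqP => /ffunP/(_ x); rewrite flip_at ww'; case: (w' x).
have sub : unset_at x @: A \subset unset_at x @: (A :\ flip u x :\ flip v x).
  apply/subsetP => w /imsetP[w' w'A ->].
  have [->|w'v] := eqVneq w' (flip v x).
    by rewrite unset_flip imset_f// !inE vA (ufv _ _ (erefl _)) (ufv v u)// .
  have [->|w'u] := eqVneq w' (flip u x).
    by rewrite unset_flip imset_f// !inE uA (ufv _ _ (erefl _)) (ufv u v)// .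
  by rewrite imset_f// !inE w'A w'u w'v.
have := leq_trans (subset_leq_card sub) (leq_imset_card _ _).
have := cardsD1 (flip u x) A; rewrite fuA => /=.
have := cardsD1 (flip v x) (A :\ flip u x); rewrite !inE fvA eq_sym fuv => /=.
have arith (a s s' b c i : nat) : a = s.+1 -> s = 1 + s' -> b = 1 + c -> a = 1 + b ->
  i <= c -> s' < i -> false by clear; lia.
exact: arith kA cs.
Qed.

Definition side A x (c : bool) : {set vertex d} := [set u in A | u x == c].

Lemma sideU A x c : side A x c :|: side A x (~~ c) = A.
Proof.
by apply/setP => u; rewrite !inE; case: (u x) c (u \in A) => -[] [].
Qed.

Lemma card_side A x c : #|side A x c| + #|side A x (~~ c)| = #|A|.
Proof.
rewrite -[in RHS](sideU A x c) cardsU (_ : _ :&: _ = set0) ?cards0 ?subn0//.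
by apply/setP => u; rewrite !inE; case: (u x) c (u \in A) => -[] [].
Qed.

(** An edge leaving [side A x c] changes coordinate [x], so [x] is its direction. A general [r]
    covers both the cube and its random subgraph. *)
Lemma cut_edge r A x c : subrel r adj -> cut_connected r A -> x \in span A ->
  exists w, [/\ w \in A, w x = c, flip w x \in A & r w (flip w x)].
Proof.
move=> radj /cut_connectedP cA xA.
have [||| u [v [uB vA vB ruv]]] := cA (side A x c).
- by apply/subsetP => u; rewrite inE => /andP[].
- by apply/set0Pn; have [u uA uc] := span_bool c xA; exists u; rewrite inE uA uc /=.
- have [u uA uc] := span_bool (~~ c) xA.
  by apply: contraTneq uA => <-; rewrite inE uc; case: c {uc}; rewrite andbF.
have /adjP[i vE] := radj _ _ ruv.
move: uB vB; rewrite !inE vA /= => /andP[uA /eqP uc] vc.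
suff ix : i = x by exists u; split => //; rewrite -ix -vE.
by apply: contraNeq vc => ix; rewrite vE flip_other ?uc// eq_sym.
Qed.

(** By [tight_uniq_edge] the edge of [r] found by [cut_edge] is the given one. So a subgraph that
    connects a tight set contains all of its inner edges: they form a tree. *)
Lemma tight_cut_edge r A u x : subrel r adj -> tight A -> cut_connected r A ->
  u \in A -> flip u x \in A -> r u (flip u x).
Proof.
move=> radj tA cA uA fuA.
have xA : x \in span A.
  by apply/spanP; exists u, (flip u x); rewrite flip_at; split => //; case: (u x).
have [w [wA wx fwA rw]] := cut_edge (u x) radj cA xA.
by rewrite (tight_uniq_edge tA xA uA fuA wA fwA).
Qed.

(** Only one vertex of the side is an end of an edge of [A] in direction [x]. Of the two parts of a
    cut of the side, one misses this vertex; an edge by which that part is left inside [A] then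
    keeps coordinate [x], so it stays in the side. *)
Lemma tight_side_connected A x c : tight A -> x \in span A ->
  cut_connected adj (side A x c).
Proof.
move=> tA xA; apply/cut_connectedP; have [/cut_connectedP cA _] := andP tA.
have main (B : {set vertex d}) : B \subset side A x c -> B != set0 -> B != side A x c ->
    (forall w, w \in A -> w x = c -> flip w x \in A -> w \notin B) ->
    exists u v, [/\ u \in B, v \in side A x c, v \notin B & adj u v].
  move=> sB B0 BA nw.
  have [|||u [v [uB vA vB auv]]] := cA B => //.
  - by apply: subset_trans sB _; apply/subsetP => u; rewrite inE => /andP[].
  - apply: contraNneq BA => BA; rewrite eqEsubset sB; apply/subsetP => u.
    by rewrite inE BA => /andP[].
  exists u, v; split => //; rewrite inE vA /=.
  have := subsetP sB _ uB; rewrite inE => /andP[uA /eqP uc].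
  have /adjP[i vE] := auv.
  have [ix|ix] := eqVneq i x.
    by have := nw u uA uc; rewrite -ix -vE => /(_ vA); rewrite uB.
  by rewrite vE flip_other ?uc// eq_sym.
move=> B sB B0 BA.
case: (pickP [pred w | [&& w \in B, w \in A, w x == c & flip w x \in A]]) => [w|no].
  move=> /and4P[wB wA /eqP wc fwA].
  have [||||u [v [uB vA vB auv]]] := main (side A x c :\: B).
  - exact: subsetDl.
  - by rewrite -subset0 subDset setU0 ; apply: contra BA => sAB; rewrite eqEsubset sB.
  - apply: contraNneq B0 => E; rewrite -subset0; apply/subsetP => u uB.
    by have := subsetP sB _ uB; rewrite -E inE uB.
  - move=> w' w'A w'c fw'A.
    by rewrite (tight_uniq_edge tA xA w'A fw'A wA fwA) ?inE ?wB// w'c wc.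
  move: uB vB; rewrite !in_setD vA andbT negbK => /andP[uB us] vB.
  by exists v, u; rewrite adj_sym.
apply: main => // w wA wc fwA; apply/negP => wB.
by have := no w; rewrite /= wB wA wc eqxx fwA.
Qed.

(** By [card_span] each side has more vertices than directions, while [span A] has at most one
    direction besides those of the sides. Since [A] has just one vertex more than directions,
    equality holds everywhere and the two spans cannot overlap. *)
Lemma tight_split A x c : tight A -> x \in span A ->
  [/\ tight (side A x c), tight (side A x (~~ c)),
      [disjoint span (side A x c) & span (side A x (~~ c))] &
      span A = x |: (span (side A x c) :|: span (side A x (~~ c)))].
Proof.
move=> tA xA; have [cA /eqP kA] := andP tA.
have [w [wA wx fwA aw]] := cut_edge c (fun _ _ => id) cA xA.
have c0 := tight_side_connected c tA xA; have c1 := tight_side_connected (~~ c) tA xA.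
have w0 : w \in side A x c by rewrite inE wA wx /=.
have w1 : flip w x \in side A x (~~ c) by rewrite inE fwA flip_at wx /=.
set S0 := span (side A x c) in c0 *; set S1 := span (side A x (~~ c)) in c1 *.
have lt0 : #|S0| < #|side A x c| by apply: card_span => //; apply/set0Pn; exists w.
have lt1 : #|S1| < #|side A x (~~ c)|.
  by apply: card_span => //; apply/set0Pn; exists (flip w x).
have sub : span A \subset x |: (S0 :|: S1).
  apply/subsetP => i; rewrite !in_setU !in_set1; have [//|ix /=] := eqVneq i x.
  apply: contraTT; rewrite negb_or => /andP[i0 i1].
  have h u : u \in A -> u i = w i.
    rewrite -(sideU A x c) in_setU => /orP[uA|uA]; first exact: span_notin i0 _ _.
    by rewrite -(flip_other w ix); exact: span_notin i1 _ _.
  by apply/spanP => -[u [v [uA vA]]]; rewrite (h u)// (h v)// eqxx.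
have xn b : x \notin span (side A x b).
  by apply/spanP => -[u [v []]]; rewrite !inE => /andP[_ /eqP->] /andP[_ /eqP->]; rewrite eqxx.
have cU : #|x |: (S0 :|: S1)| = (#|S0| + #|S1| - #|S0 :&: S1|).+1.
  by rewrite cardsU1 cardsU in_setU (negPf (xn _)) (negPf (xn _)).
have cI : #|S0 :&: S1| <= #|S0| by rewrite subset_leq_card// subsetIl.
have arith (a a0 a1 s s0 s1 si : nat) : a0 + a1 = a -> a = s.+1 -> s0 < a0 -> s1 < a1 ->
    si <= s0 -> s <= (s0 + s1 - si).+1 -> [/\ si = 0, a0 = s0.+1, a1 = s1.+1 & s = (s0 + s1).+1].
  by clear => *; split; lia.
have [cap k0 k1 ks] := arith _ _ _ _ _ _ _ (card_side A x c) kA lt0 lt1 cI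
  (leq_trans (subset_leq_card sub) (eq_leq cU)).
rewrite /tight c0 c1 /= k0 k1 !eqxx; split => //.
- by rewrite -setI_eq0 -cards_eq0 cap.
- by apply/eqP; rewrite eqEcard sub cU cap ks subn0 leqnn.
Qed.

(** The converse of [tight_split]. As [x] lies in neither span, the coordinate [x] is constant on
    each piece and takes opposite values on them, so the union determines the pieces; this makes the
    decomposition in [card_tight_sets] injective. *)
Lemma tight_glue A0 A1 x w : tight A0 -> tight A1 -> w \in A0 -> flip w x \in A1 ->
  x \notin span A0 -> x \notin span A1 -> [disjoint span A0 & span A1] ->
  [/\ tight (A0 :|: A1), span (A0 :|: A1) = x |: (span A0 :|: span A1),
      side (A0 :|: A1) x (w x) = A0 & side (A0 :|: A1) x (~~ w x) = A1].
Proof.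
move=> /andP[c0 /eqP k0] /andP[c1 /eqP k1] w0 w1 x0 x1 dis.
have s0 u : u \in A0 -> u x = w x by move=> u0; apply: span_notin x0 _ _.
have s1 u : u \in A1 -> u x = ~~ w x by move=> u1; rewrite -flip_at; apply: span_notin x1 _ _.
have dA : [disjoint A0 & A1].
  rewrite -setI_eq0; apply/eqP/setP => u; rewrite !inE; apply/andP => -[/s0 + /s1].
  by move=> ->; case: (w x).
have kU : #|A0 :|: A1| = #|A0| + #|A1|.
  by rewrite cardsU (eqP (_ : A0 :&: A1 == set0)) ?cards0 ?subn0// setI_eq0.
have sE : span (A0 :|: A1) = x |: (span A0 :|: span A1).
  apply/eqP; rewrite eqEsubset; apply/andP; split; last first.
    rewrite subUset subUset sub1set !spanS ?subsetUl ?subsetUr// !andbT.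
    apply/spanP; exists w, (flip w x); rewrite !in_setU w0 w1 orbT flip_at.
    by split => //; case: (w x).
  apply/subsetP => i; rewrite !in_setU !in_set1; have [//|ix /=] := eqVneq i x.
  apply: contraTT; rewrite negb_or => /andP[i0 i1].
  have h u : u \in A0 :|: A1 -> u i = w i.
    rewrite in_setU => /orP[uA|uA]; first exact: span_notin i0 _ _.
    by rewrite -(flip_other w ix); exact: span_notin i1 _ _.
  by apply/spanP => -[u [v [uA vA]]]; rewrite (h u)// (h v)// eqxx.
have sidesE : side (A0 :|: A1) x (w x) = A0 /\ side (A0 :|: A1) x (~~ w x) = A1.
  split; apply/setP => u; rewrite !inE; apply/andP/idP.
  - by case=> /orP[//|/s1 ->]; case: (w x).
  - by move=> u0; rewrite u0 (s0 _ u0) /=.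
  - by case=> /orP[/s0 ->|//]; case: (w x).
  - by move=> u1; rewrite u1 orbT (s1 _ u1) /=.
have [-> ->] := sidesE; split => //; rewrite /tight kU sE cardsU1 in_setU (negPf x0) (negPf x1).
have -> : #|span A0 :|: span A1| = #|span A0| + #|span A1|.
  by rewrite cardsU (eqP (_ : _ :&: _ == set0)) ?cards0 ?subn0// setI_eq0.
rewrite k0 k1 addSn addnS eqxx andbT; apply/cut_connectedP => B sB B0 BA.
have main (A : {set vertex d}) : cut_connected adj A -> A \subset A0 :|: A1 ->
    B :&: A != set0 -> B :&: A != A ->
    exists u v, [/\ u \in B, v \in A0 :|: A1, v \notin B & adj u v].
  move=> /cut_connectedP cA sA C0 CA.
  have [|u [v [uB vA vB auv]]] := cA (B :&: A) _ C0 CA; first by rewrite subsetIr.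
  exists u, v; split => //.
  - by move: uB; rewrite inE => /andP[].
  - exact: (subsetP sA).
  - by move: vB; rewrite inE vA andbT.
have [B00|B00] := eqVneq (B :&: A0) set0.
  have [B1A|B1A] := eqVneq (B :&: A1) A1.
    exists (flip w x), w; split.
    - by move: w1; rewrite -B1A inE => /andP[].
    - by rewrite inE w0.
    - by apply/negP => wB; have := in_set0 w; rewrite -B00 inE wB w0.
    - by apply/adjP; exists x; rewrite flipK.
  apply: main c1 (subsetUr _ _) _ B1A.
  apply: contraNneq B0 => B10.
  by rewrite -(setIidPl sB) setIUr B00 B10 setU0.
have [B0A|B0A] := eqVneq (B :&: A0) A0; last exact: main c0 (subsetUl _ _) _ B0A.
have [B10|B10] := eqVneq (B :&: A1) set0.
  exists w, (flip w x); split.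
  - by move: w0; rewrite -B0A inE => /andP[].
  - by rewrite inE w1 orbT.
  - by apply/negP => wB; have := in_set0 (flip w x); rewrite -B10 inE wB w1.
  - by apply/adjP; exists x.
apply: main c1 (subsetUr _ _) B10 _.
apply: contraNneq BA => B1A.
by rewrite -(setIidPl sB) setIUr B0A B1A.
Qed.

End cube.

(** * Abel's identity *)

Section abel.
Local Open Scope ring_scope.

(* The sum is the value at [1] of [(1 - X)^n] after [m] applications of
   [f |-> (X f)'], each of which lowers the order of vanishing at [1] by one. *)
Lemma alternating_binomial_sum (R : comNzRingType) n m : (m < n)%N ->
  \sum_(k < n.+1) 'C(n, k)%:R * (-1) ^+ k * k.+1%:R ^+ m = 0 :> R.
Proof.
pose f j : {poly R} := \sum_(k < n.+1) ('C(n, k)%:R * (-1) ^+ k * k.+1%:R ^+ j) *: 'X^k.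
have Tf j : (f j * 'X)^`() = f j.+1.
  rewrite /f mulr_suml (raddf_sum deriv); apply: eq_bigr => k _.
  by rewrite -scalerAl -exprSr /= derivZ derivXn -pred_Sn -scaler_nat scalerA exprSr mulrA.
have f0 : f 0%N = (1 - 'X) ^+ n.
  rewrite exprBn; apply: eq_bigr => k _.
  rewrite expr1n !mulr1 -scalerA scaler_nat -signr_odd -[in RHS]signr_odd.
  by case: (odd k); rewrite ?expr1 ?expr0 ?scaleN1r ?mulN1r ?scale1r ?mul1r.
have fE j : (j <= n)%N -> exists g, f j = (1 - 'X) ^+ (n - j) * g.
  elim: j => [_|j IH jn]; first by exists 1; rewrite subn0 mulr1.
  have [g fj] := IH (ltnW jn).
  exists ((1 - 'X) * (g * 'X)^`() - (g * 'X) *+ (n - j)).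
  rewrite -Tf fj -mulrA derivM deriv_exp derivB derivX derivC sub0r.
  have -> : (n - j = (n - j.+1).+1)%N by rewrite subnSK.
  by rewrite -pred_Sn exprS -mulr_natr; ring.
move=> mn; have [g] := fE m (ltnW mn).
rewrite -(subnSK mn) exprS => /(congr1 (horner^~ 1)).
rewrite !hornerE subrr mul0r mul0r /f horner_sum => fm0; rewrite -[RHS]fm0.
by apply: eq_bigr => k _; rewrite !hornerE expr1n mulr1.
Qed.
Lemma poly_eq_deriv (p q : {poly rat}) a :
  p^`() = q^`() -> p.[a] = q.[a] -> p = q.
Proof.
move=> dpq ha; apply/eqP; rewrite -subr_eq0; set r := p - q.
have dr : r^`() = 0 by rewrite derivB dpq subrr.
have rC : r = (r`_0)%:P.
  apply/polyP => -[|i]; rewrite coefC//=.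
  have := congr1 (fun s : {poly rat} => s`_i) dr; rewrite coef_deriv coef0.
  by move/eqP; rewrite mulrn_eq0 => /eqP.
have : r.[a] = 0 by rewrite hornerD hornerN ha subrr.
by rewrite rC hornerC => ->.
Qed.
(* Both sides have the same derivative, by induction after [X |-> X + 1], and
   both vanish at [- n.+1] when [n > 0]: there the left side is an n-th finite
   difference of a polynomial of degree [n - 1]. *)
Lemma abel_poly n :
  \sum_(k < n.+1) ('C(n, k) * k.+1 ^ k.-1)%:R *: ('X + (n - k)%:R%:P) ^+ (n - k)
  = ('X + n.+1%:R%:P) ^+ n :> {poly rat}.
Proof.
elim: n => [|n IH].
  by rewrite big_ord1 subnn !expr0 bin0 /= scale1r.
apply: (@poly_eq_deriv _ _ (- n.+2%:R)).
  rewrite deriv_exp derivD derivX derivC addr0 mul1r -pred_Sn.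
  rewrite (raddf_sum deriv) big_ord_recr /= subnn expr0 derivZ derivC scaler0 addr0.
  have := congr1 (fun p : {poly rat} => (p \Po ('X + 1%:P)) *+ n.+1) IH.
  rewrite /= rmorphXn /= comp_polyD comp_polyX comp_polyC -addrA -polyCD nat1r.
  move=> <-; rewrite linear_sum /= -sumrMnl.
  apply: eq_bigr => k _; rewrite /= comp_polyZ rmorphXn /= comp_polyD comp_polyX comp_polyC.
  rewrite -addrA -polyCD nat1r.
  have kn : (k <= n)%N by rewrite -ltnS.
  rewrite derivZ deriv_exp derivD derivX derivC addr0 mul1r subSn// -pred_Sn.
  rewrite -!scaler_nat !scalerA -!natrM; congr (_%:R *: _).
  rewrite mulnA -mulnA [(_ ^ _ * _)%N]mulnC mulnA.
  have := mul_bin_down n.+1 k; rewrite /= subSn// => ->.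
  by rewrite [('C(_, _) * _)%N]mulnC.
rewrite horner_exp hornerD hornerX hornerC addNr expr0n /= horner_sum.
have := congr1 ( *%R ((-1) ^+ n.+1)) (@alternating_binomial_sum rat _ _ (ltnSn n)).
rewrite mulr0 mulr_sumr => alt; rewrite -[RHS]alt.
apply: eq_bigr => k _; rewrite hornerZ horner_exp hornerD hornerX hornerC.
have kn : (k <= n.+1)%N by rewrite -ltnS.
have -> : - n.+2%:R + (n.+1 - k)%:R = - 1 * k.+1%:R :> rat.
  by rewrite natrB// mulN1r -(natr1 n.+1) -(natr1 k); ring.
rewrite exprMn natrM natrX.
have -> : (-1) ^+ n.+1 = (-1) ^+ (n.+1 - k) * (-1) ^+ k :> rat by rewrite -exprD subnK.
have -> : k.+1%:R ^+ n = k.+1%:R ^+ k.-1 * k.+1%:R ^+ (n.+1 - k) :> rat.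
  have [->|k0] := eqVneq (k : nat) 0%N; first by rewrite !expr1n mulr1.
  by rewrite -exprD; congr (_ ^+ _); move: k0 kn; clear; lia.
have s2 : (-1) ^+ k * (-1) ^+ k = 1 :> rat by rewrite -expr2 sqrr_sign.
rewrite -[LHS]mul1r -[X in X * _]s2; move: (_ ^+ (_ - _)) => ?; ring.
Qed.

(** Abel's identity at ['X = 1], summed in reverse order. *)
Lemma rooted_tree_recursion n :
  (\sum_(k < n.+1) 'C(n, k) * (k.+1 * k.+1 ^ k.-1 * (n - k).+1 ^ (n - k).-1) = n.+2 ^ n)%N.
Proof.
apply/eqP; rewrite -(@eqr_nat rat) natrX; apply/eqP.
have := congr1 (horner^~ 1) (abel_poly n).
rewrite horner_exp hornerD hornerX hornerC nat1r => <-.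
rewrite (reindex_inj rev_ord_inj) /= natr_sum horner_sum; apply: eq_bigr => k _.
have kn : (k <= n)%N by rewrite -ltnS.
rewrite hornerZ horner_exp hornerD hornerX hornerC nat1r -natrX -natrM subSS bin_sub// subKn//.
congr (_%:R); rewrite -[RHS]mulnA; congr (_ * _)%N; rewrite mulnC; congr (_ * _)%N.
by rewrite -expnS; case: (n - k)%N.
Qed.
End abel.

(** * Counting tight sets *)

Lemma sum_subsets_card (T : finType) (S : {set T}) (F : nat -> nat) :
  \sum_(A : {set T} | A \subset S) F #|A| = \sum_(k < #|S|.+1) 'C(#|S|, k) * F k.
Proof.
rewrite (partition_big (fun A : {set T} => inord #|A| : 'I_#|S|.+1) predT)//=.
apply: eq_bigr => k _; rewrite -cards_draws -sum_nat_const.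
apply: eq_big => [A|A /andP[AS /eqP <-]]; last by rewrite inordK// ltnS subset_leq_card.
rewrite inE; have [AS|//] := boolP (A \subset S).
by rewrite -val_eqE/= inordK// ltnS subset_leq_card.
Qed.

Section tight_count.
Variable d : nat.
Implicit Types (u v w : vertex d) (A B : {set vertex d}) (i x : 'I_d) (D : {set 'I_d}).

Definition tight_sets v D : {set {set vertex d}} :=
  [set A | [&& tight A, span A == D & v \in A]].

(* Cutting the unique edge in a direction [x] of [D] splits a tight set into two
   tight sets with disjoint spans; with [n = #|D|.-1] and [T k] the number for
   spans of size [k], [T n.+1 = \sum_k 'C(n, k) * k.+1 * T k * T (n - k)]. *)
Lemma card_tight_sets v D : #|tight_sets v D| = #|D|.+1 ^ #|D|.-1.
Proof.
have [n] := ubnP #|D|; elim: n v D => // n IH v D; rewrite ltnS => Dn.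
have [->|[x xD]] := set_0Vmem D.
  rewrite cards0 exp1n -(cards1 [set v]); congr #|pred_of_set _|.
  apply/setP => A; rewrite inE in_set1; apply/and3P/eqP => [[/andP[_ /eqP kA] /eqP sA vA]|->].
    apply/eqP; rewrite eq_sym eqEcard sub1set vA kA sA cards0 cards1.
    by [].
  rewrite /tight span1 cards1 cards0 inE !eqxx andbT; split => //.
  apply/cut_connectedP => B; rewrite subset1 => /orP[] /eqP ->; by rewrite eqxx.
pose D' := D :\ x.
have cD : #|D| = #|D'|.+1 by rewrite (cardsD1 x) xD.
(* A triple consists of the piece that contains [v], the end in this piece of the edge of direction
   [x], and the other piece. *)
pose Om : {set {set vertex d} * vertex d * {set vertex d}} :=
  [set t | [&& span t.1.1 \subset D', t.1.1 \in tight_sets v (span t.1.1), t.1.2 \in t.1.1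
     & t.2 \in tight_sets (flip t.1.2 x) (D' :\: span t.1.1)]].
have OmP t : t \in Om -> 
    [/\ tight t.1.1, tight t.2, v \in t.1.1, t.1.2 \in t.1.1 & flip t.1.2 x \in t.2] /\
    [/\ x \notin span t.1.1, x \notin span t.2, [disjoint span t.1.1 & span t.2] &
      span t.1.1 :|: span t.2 = D'].
  rewrite in_set => /and4P[sD].
  rewrite in_set => /and3P[t0 _ v0] w0.
  rewrite in_set => /and3P[t1 /eqP s1 w1]; split; split => //.
  - by apply/negP => /(subsetP sD); rewrite in_setD1 eqxx.
  - by rewrite s1 in_setD in_setD1 eqxx andbF.
  - by rewrite s1 -setI_eq0 setIDA setDIl setDv set0I.
  - by rewrite s1 setDE setUIr setUCr setIT; apply/setUidPr.
have Omf : [set t.1.1 :|: t.2 | t in Om] = tight_sets v D.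
  apply/setP => A; apply/imsetP/idP => [[t /OmP[[t0 t1 v0 w0 w1] [x0 x1 dis sU]] ->]|].
    have [tU sE _ _] := tight_glue t0 t1 w0 w1 x0 x1 dis.
    by rewrite in_set tU sE sU setD1K// eqxx in_setU v0.
  rewrite inE => /and3P[tA /eqP sA vA].
  have xA : x \in span A by rewrite sA.
  have [t0 t1 dis sE] := tight_split (v x) tA xA.
  have [cA _] := andP tA.
  have [w [wA wx fwA _]] := cut_edge (v x) (fun _ _ => id) cA xA.
  exists (side A x (v x), w, side A x (~~ v x)); last by rewrite sideU.
  have xn b : x \notin span (side A x b).
    by apply/spanP => -[u [u' []]]; rewrite !inE => /andP[_ /eqP->] /andP[_ /eqP->]; rewrite eqxx.
  have D'E : D' = span (side A x (v x)) :|: span (side A x (~~ v x)).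
    by rewrite /D' -sA sE setU1K// in_setU negb_or !xn.
  rewrite in_set /= {1}D'E subsetUl /= in_set t0 eqxx /= inE vA eqxx /=.
  rewrite inE wA wx eqxx /= in_set t1 in_set fwA flip_at wx eqxx /= andbT.
  rewrite D'E setDUl setDv set0U; apply/eqP/esym/setDidPl.
  by rewrite disjoint_sym.
have Ominj : {in Om &, injective (fun t => t.1.1 :|: t.2)}.
  move=> [[A0 w] A1] [[B0 z] B1] /OmP /= [[t0 t1 v0 w0 w1] [x0 x1 dis _]].
  move=> /OmP /= [[t0' t1' v0' w0' w1'] [x0' x1' dis' _]] E.
  have [tU _ EA0 EA1] := tight_glue t0 t1 w0 w1 x0 x1 dis.
  have [_ sE EB0 EB1] := tight_glue t0' t1' w0' w1' x0' x1' dis'.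
  have wv : w x = v x by apply: span_notin x0 _ _.
  have zv : z x = v x by apply: span_notin x0' _ _.
  have EAB0 : A0 = B0 by rewrite -EA0 -EB0 E wv zv.
  have EAB1 : A1 = B1 by rewrite -EA1 -EB1 E wv zv.
  subst B0 B1; congr (_, _, _).
  apply: (@tight_uniq_edge _ (A0 :|: A1) x) => //; rewrite ?in_setU ?w0 ?w0' ?w1 ?w1' ?orbT//.
    by rewrite sE in_setU1 eqxx.
  by rewrite wv zv.
rewrite -Omf (card_in_imset Ominj) -sum1_card.
pose Q (p : {set vertex d} * vertex d) :=
  [&& span p.1 \subset D', p.1 \in tight_sets v (span p.1) & p.2 \in p.1].
rewrite (eq_bigl (fun t => Q t.1 &&
    (t.2 \in tight_sets (flip t.1.2 x) (D' :\: span t.1.1)))); last first.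
  by move=> t; rewrite in_set /Q /= -!andbA.
rewrite -(pair_big_dep Q (fun p A1 => A1 \in tight_sets (flip p.2 x) (D' :\: span p.1)) (fun _ _ => 1)) /=.
pose g k := (#|D'| - k).+1 ^ (#|D'| - k).-1.
transitivity (\sum_(p | Q p) g #|span p.1|).
  apply: eq_bigr => p /and3P[sD _ _]; rewrite sum1_card IH; last first.
    by rewrite (leq_ltn_trans (subset_leq_card (subsetDl _ _)))// -ltnS -cD ltnS.
  by rewrite cardsD (setIidPr sD).
rewrite (eq_bigl (fun p =>
    ((span p.1 \subset D') && (p.1 \in tight_sets v (span p.1))) && (p.2 \in p.1))); last first.
  by move=> p; rewrite -andbA.
rewrite -(pair_big_dep (fun A => (span A \subset D') && (A \in tight_sets v (span A)))
  (fun A w => w \in A) (fun A w => g #|span A|)) /=.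
rewrite (partition_big (fun A => span A) (fun D0 => D0 \subset D')) /=; last by move=> A /andP[].
(* The first factor counts the ends [w] in a tight set with span [D0], the second the tight sets
   themselves. *)
transitivity (\sum_(D0 : {set 'I_d} | D0 \subset D') #|D0|.+1 * #|D0|.+1 ^ #|D0|.-1 * g #|D0|).
  apply: eq_bigr => D0 sD.
  transitivity (\sum_(A in tight_sets v D0) #|D0|.+1 * g #|D0|).
    apply: eq_big => [A|A].
      rewrite !inE eqxx /=; have [->|_] := eqVneq (span A) D0; last by rewrite !andbF.
      by rewrite sD andbT.
    move=> /andP[/andP[_ ]]; rewrite inE => /and3P[/andP[_ /eqP kA] _ _] /eqP sA.
    by rewrite sum_nat_const kA sA.
  rewrite sum_nat_const IH; first by rewrite -mulnA mulnCA.
  by rewrite (leq_ltn_trans (subset_leq_card sD))// -ltnS -cD ltnS.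
rewrite (sum_subsets_card _ (fun k => k.+1 * k.+1 ^ k.-1 * g k)) cD /=.
exact: rooted_tree_recursion.
Qed.

Lemma card_tight_containing v n :
  #|[set A : {set vertex d} | [&& tight A, #|A| == n.+1 & v \in A]]| = 'C(d, n) * n.+1 ^ n.-1.
Proof.
rewrite -[d in 'C(d, _)]card_ord -card_draws -sum_nat_const -sum1_card.
rewrite (partition_big (fun A : {set vertex d} => span A)
    (fun D => D \in [set D : {set 'I_d} | #|D| == n])) /=; last first.
  by move=> A; rewrite !inE => /and3P[/andP[_ /eqP ->]]; rewrite eqSS.
apply: eq_bigr => D; rewrite inE => /eqP cD.
rewrite -[in RHS]cD -(card_tight_sets v) -sum1_card; apply: eq_bigl => A.
rewrite !inE; have [sA|] := eqVneq (span A) D; last by rewrite !andbF.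
rewrite andbT /=; have [/andP[_ /eqP ->]|//] := boolP (tight A).
by rewrite sA cD eqxx.
Qed.

End tight_count.

(** * Finite probability spaces *)

Section finite_probability_theory.
Local Open Scope ring_scope.
Variables (R : realType) (T : finType) (P : T -> R).
Implicit Types X Y : T -> R.

Lemma expectationZ c X : expectation P (fun w => c * X w) = c * expectation P X.
Proof. by rewrite /expectation mulr_sumr; apply: eq_bigr => w _; rewrite mulrCA. Qed.

Lemma expectationB X Y :
  expectation P (fun w => X w - Y w) = expectation P X - expectation P Y.
Proof. by rewrite /expectation -sumrB; apply: eq_bigr => w _; rewrite mulrBr. Qed.

Lemma expectation_sum (J : finType) (Q : pred J) (X : J -> T -> R) :
  expectation P (fun w => \sum_(j | Q j) X j w) = \sum_(j | Q j) expectation P (X j).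
Proof.
rewrite /expectation exchange_big /=; apply: eq_bigr => w _; by rewrite mulr_sumr.
Qed.

Lemma eq_expectation X Y : X =1 Y -> expectation P X = expectation P Y.
Proof. by move=> XY; apply: eq_bigr => w _; rewrite XY. Qed.

Lemma prob_expectation (A : pred T) : prob P A = expectation P (fun w => (A w)%:R).
Proof.
rewrite /prob /expectation big_mkcond /=; apply: eq_bigr => w _.
by case: (A w); rewrite ?mulr1 ?mulr0.
Qed.

Hypothesis P_ge0 : forall w, 0 <= P w.

Lemma le_expectation X Y : (forall w, X w <= Y w) -> expectation P X <= expectation P Y.
Proof. by move=> XY; apply: ler_sum => w _; apply: ler_wpM2l. Qed.

Lemma expectation_ge0 X : (forall w, 0 <= X w) -> 0 <= expectation P X.
Proof. by move=> X0; apply: sumr_ge0 => w _; apply: mulr_ge0. Qed.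

Lemma norm_expectation X : `|expectation P X| <= expectation P (fun w => `|X w|).
Proof.
apply: le_trans (ler_norm_sum _ _ _) _; apply: ler_sum => w _.
by rewrite normrM (ger0_norm (P_ge0 w)).
Qed.

Hypothesis P_sum1 : \sum_w P w = 1.

Lemma expectation_cst c : expectation P (fun=> c) = c.
Proof. by rewrite /expectation -mulr_suml P_sum1 mul1r. Qed.

End finite_probability_theory.

(** * Random subsets of a finite set *)

Section bernoulli_sets.
Local Open Scope ring_scope.
Variables (R : realType) (E : finType) (p : R).
Implicit Types (G S : {set E}) (f g : {set E} -> R).

(** The weight [Qp] for an arbitrary finite type of edges; for [edge d] the two are convertible. *)
Definition bernoulli_weight G : R := \prod_e bernoulli_pmf p (e \in G).

Definition depends_on (A : Type) S (f : {set E} -> A) := forall G, f G = f (G :&: S).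

Lemma depends_onS A S S' (f : {set E} -> A) :
  S \subset S' -> depends_on S f -> depends_on S' f.
Proof. by move=> SS fS G; rewrite fS [RHS]fS -setIA (setIidPr SS). Qed.

(** Expand a product of two-term sums over the edges: an edge of [S1] keeps only the term [p], an
    edge of [S2] only [1 - p], and for any other edge the two terms add up to 1. *)
Lemma bernoulli_weight_in_out S1 S2 : [disjoint S1 & S2] ->
  expectation bernoulli_weight (fun G => ((S1 \subset G) && [disjoint S2 & G])%:R)
  = p ^+ #|S1| * (1 - p) ^+ #|S2|.
Proof.
move=> dis.
pose F e := p * (e \notin S2)%:R; pose H e := (1 - p) * (e \notin S1)%:R.
transitivity (\prod_e (F e + H e)).
  rewrite bigA_distr; apply: eq_bigr => G _.
  transitivity (bernoulli_weight G *
      \prod_e (if e \in G then (e \notin S2)%:R else (e \notin S1)%:R)).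
    congr (_ * _); have [/andP[/subsetP S1G S2G]|] := boolP (_ && _).
      rewrite big1// => e _; case: ifPn => eG.
        by rewrite (disjointFl S2G eG).
      by rewrite (contra (S1G e) eG).
    rewrite negb_and => /orP[/subsetPn[e eS1 eG]|/pred0Pn[e /andP[/= eS2 eG]]].
      by rewrite (bigD1 e)//= (negPf eG) eS1 mul0r.
    by rewrite (bigD1 e)//= eG eS2 mul0r.
  rewrite -big_split; apply: eq_bigr => e _; rewrite /F /H /bernoulli_pmf /=.
  by case: (e \in G).
rewrite (bigID (mem S1)) /=; congr (_ * _).
  rewrite -prodr_const; apply: eq_bigr => e eS1.
  by rewrite /F /H eS1 (disjointFr dis eS1)/= mulr1 mulr0 addr0.
rewrite -prodr_const big_mkcond [RHS]big_mkcond; apply: eq_bigr => e _ /=.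
rewrite /F /H; have [eS2|eS2] := boolP (e \in S2).
  by rewrite (disjointFl dis eS2)/= mulr1 mulr0 add0r.
by case: (e \in S1) => //=; rewrite !mulr1 addrC subrK.
Qed.

Lemma bernoulli_weight_sum1 : \sum_G bernoulli_weight G = 1.
Proof.
have := @bernoulli_weight_in_out set0 set0; rewrite cards0 !expr0 mul1r.
rewrite -setI_eq0 setI0 eqxx => /(_ isT) <-; apply: eq_bigr => G _.
by rewrite sub0set -setI_eq0 set0I eqxx mulr1.
Qed.

(** Splitting [G] into [G :&: S] and [G :\: S] factors the sum into two partial sums [a] and [b].
    The same factorisation with one or both functions equal to 1 turns these partial sums into
    expectations. *)
Lemma bernoulli_indep S f g : depends_on S f -> depends_on (~: S) g ->
  expectation bernoulli_weight (fun G => f G * g G)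
  = expectation bernoulli_weight f * expectation bernoulli_weight g.
Proof.
pose W S G : R := \prod_(e in S) bernoulli_pmf p (e \in G).
pose a h := \sum_(G : {set E} | G \subset S) W S G * h G.
pose b h := \sum_(G : {set E} | G \subset ~: S) W (~: S) G * h G.
have factor (h k : {set E} -> R) : depends_on S h -> depends_on (~: S) k ->
    expectation bernoulli_weight (fun G => h G * k G) = a h * b k.
  move=> hS kS; rewrite /a mulr_suml.
  rewrite /expectation (partition_big (fun G => G :&: S) (fun G => G \subset S))/=; last first.
    by move=> G _; apply: subsetIr.
  apply: eq_bigr => G1 sG1; rewrite /b mulr_sumr.
  rewrite (reindex_onto (fun G2 => G1 :|: G2) (fun G => G :\: S))/=; last first.
    by move=> G /eqP <-; rewrite setID.
  apply: eq_big => [G2|G2].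
    rewrite setIUl (setIidPl sG1) setDUl.
    have -> : G1 :\: S = set0 by apply/eqP; rewrite setD_eq0.
    rewrite set0U; apply/andP/idP => [[_ /eqP <-]|G2S]; first by rewrite setDE subsetIr.
    have -> : G2 :&: S = set0 by apply/eqP; rewrite setI_eq0 disjoints_subset.
    by rewrite setU0 eqxx setDE (setIidPl G2S).
  move=> /andP[/eqP GS /eqP GC].
  have GC' : (G1 :|: G2) :&: ~: S = G2 by rewrite -setDE.
  rewrite hS kS GS GC' mulrACA; congr (_ * _).
  rewrite /bernoulli_weight (bigID (mem S)) /=; congr (_ * _).
    by apply: eq_bigr => e eS; rewrite -[in RHS]GS in_setI eS andbT.
  apply: eq_big => [e|e eS]; first by rewrite in_setC.
  by rewrite -[in RHS]GC' in_setI in_setC eS andbT.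
move=> fS gS.
have one S' : depends_on S' (fun=> 1 : R) by [].
have := factor _ _ (one _) (one _).
have -> : expectation bernoulli_weight (fun _ => 1 * 1) = 1.
  by rewrite expectation_cst ?mulr1//; exact: bernoulli_weight_sum1.
have := factor _ _ fS (one _); have := factor _ _ (one _) gS.
rewrite (eq_expectation _ (fun G => mul1r (g G))) (eq_expectation _ (fun G => mulr1 (f G))).
move=> -> -> ab1; rewrite (factor _ _ fS gS).
by rewrite -[LHS]mul1r [X in X * _]ab1; ring.
Qed.

Hypothesis p01 : 0 <= p <= 1.

Lemma bernoulli_weight_ge0 G : 0 <= bernoulli_weight G.
Proof. by apply: prodr_ge0 => e _; apply: bernoulli_pmf_ge0. Qed.

End bernoulli_sets.

(** * Edges and components of the cube *)

Section cube_edges.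
Variable d : nat.
Implicit Types (u v w : vertex d) (A B : {set vertex d}) (i x : 'I_d) (G : {set edge d}).

Lemma cube_adjE u v : cube_adj u v = adj u v.
Proof.
apply/idP/adjP => [|[i ->]].
  rewrite /cube_adj => /cards1P[i /setP iE]; exists i; apply/ffunP => j.
  have := iE j; rewrite !inE ffunE => <-.
  by case: (u j) (v j) => -[].
rewrite /cube_adj (_ : [set _ | _] = [set i]) ?cards1//.
by apply/setP => j; rewrite !inE ffunE; case: (u j) (j == i) => -[].
Qed.

Lemma flip_edge u i : [set u; flip u i] \in cube_edges d.
Proof.
rewrite inE; apply/existsP; exists u; apply/existsP; exists (flip u i).
by rewrite cube_adjE eqxx andbT; apply/adjP; exists i.
Qed.

Definition cube_edge u i : edge d := exist _ [set u; flip u i] (flip_edge u i).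

Lemma cube_edgeP (e : edge d) : exists u i, e = cube_edge u i.
Proof.
have := valP e; rewrite inE => /existsP[u /existsP[v /andP[]]].
rewrite cube_adjE => /adjP[i ->] /eqP eE; exists u, i.
exact: val_inj.
Qed.

Lemma cube_edge_flip u i : cube_edge (flip u i) i = cube_edge u i.
Proof. by apply: val_inj; rewrite /= flipK setUC. Qed.

Lemma cube_edge_eq u i v j : cube_edge u i = cube_edge v j ->
  i = j /\ (u = v \/ u = flip v i).
Proof.
move=> /(congr1 val)/= /setP E.
have uE := E u; have fE := E (flip u i); move: uE fE.
rewrite !inE eqxx /= => /esym/orP[/eqP -> | /eqP ->].
  rewrite eqxx orbT => /esym/orP[|/eqP/flip_inj ->]; last by split => //; left.
  by move=> h; have := flip_neq v i; rewrite h.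
rewrite eqxx orbT => /esym/orP[/eqP/(canRL (flipK i))/flip_inj ->|].
  by split => //; right.
by move=> h; have := flip_neq (flip v j) i; rewrite h.
Qed.

Lemma sub_adjP G u v : reflect (exists2 i, v = flip u i & cube_edge u i \in G) (sub_adj G u v).
Proof.
apply: (iffP existsP) => [[e /andP[eG /eqP eE]]|[i -> eG]]; last first.
  by exists (cube_edge u i); rewrite eG /=.
have [w [i ewi]] := cube_edgeP e; move: eE; rewrite ewi /= => /setP E.
have uE := E u; have vE := E v; have wE := E w; have fE := E (flip w i).
move: uE vE wE fE; rewrite !inE !eqxx /= ?orbT.
move=> /orP[/eqP -> |/eqP ->].
  move=> /orP[/eqP ->|/eqP ->].
    by move=> _; rewrite orbb (negPf (flip_neq _ _)).
  by move=> _ _; exists i => //; rewrite -ewi.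
move=> /orP[/eqP ->|/eqP ->].
  by move=> _ _; exists i; rewrite ?flipK// cube_edge_flip -ewi.
by rewrite orbb eq_sym (negPf (flip_neq _ _)).
Qed.

Lemma sub_adj_flip G u i : sub_adj G u (flip u i) = (cube_edge u i \in G).
Proof. by apply/sub_adjP/idP => [[j /flip_inj ->]|eG]//; exists i. Qed.

Lemma sub_adj_sym G : symmetric (sub_adj G).
Proof.
move=> u v; apply/sub_adjP/sub_adjP => -[i -> eG]; exists i;
  by rewrite ?flipK// cube_edge_flip.
Qed.

Lemma sub_adj_adj G : subrel (sub_adj G) (@adj d).
Proof. by move=> u v /sub_adjP[i -> _]; apply/adjP; exists i. Qed.

Definition inside A : {set edge d} := [set e : edge d | val e \subset A].
Definition incident A : {set edge d} := [set e : edge d | ~~ [disjoint val e & A]].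
Definition boundary A : {set edge d} := incident A :\: inside A.

Lemma in_inside A u i : (cube_edge u i \in inside A) = (u \in A) && (flip u i \in A).
Proof. by rewrite inE /= subUset !sub1set. Qed.

Lemma in_incident A u i : (cube_edge u i \in incident A) = (u \in A) || (flip u i \in A).
Proof.
rewrite inE /=; apply/pred0Pn/orP => [[v /andP[/= + vA]]|[uA|fA]].
- by rewrite in_set2 => /orP[] /eqP <-; [left|right].
- by exists u; rewrite /= set21.
- by exists (flip u i); rewrite /= set22.
Qed.

Lemma in_boundary A u i : (cube_edge u i \in boundary A) = (u \in A) (+) (flip u i \in A).
Proof.
by rewrite in_setD in_inside in_incident; case: (u \in A) (flip u i \in A) => -[].
Qed.

Lemma mem_componentsE A G : (A \in components G) =
  [&& A != set0, cut_connected (sub_adj G) A & [disjoint boundary A & G]].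
Proof.
rewrite /components mem_components_cut; last exact: sub_adj_sym.
congr [&& _, _ & _]; apply/forallP/pred0P => [h e|h u].
  apply/negbTE/negP => /andP[/= eb eG]; have [u [i eE]] := cube_edgeP e.
  move: eb eG; rewrite {}eE in_boundary => eb eG.
  have hu w : w \in A -> cube_edge w i \in G -> flip w i \in A.
    move=> wA wG; have := h w; rewrite wA => /forallP/(_ (flip w i)).
    by rewrite sub_adj_flip wG.
  have [uA|uA] := boolP (u \in A); first by move: eb; rewrite uA (hu u uA eG).
  have fuA : flip u i \in A by move: eb; rewrite (negPf uA).
  have := hu _ fuA; rewrite cube_edge_flip eG flipK => /(_ isT).
  by rewrite (negPf uA).
apply/implyP => uA; apply/forallP => v; apply/implyP => /sub_adjP[i -> eG].
by have := h (cube_edge u i); rewrite /= eG andbT in_boundary uA; case: (_ \in A).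
Qed.

Lemma component_connected A G : A \in components G -> cut_connected (@adj d) A.
Proof.
rewrite mem_componentsE => /and3P[_ + _].
by apply: sub_cut_connected => u v _ _; apply: sub_adj_adj.
Qed.

Lemma components_disjoint A B G : A \in components G -> B \in components G ->
  A != B -> [disjoint A & B].
Proof.
have eqr : {in [set: vertex d] & &, equivalence_rel (connect (sub_adj G))}.
  move=> x y z _ _ _; split=> [|xy]; first exact: connect0.
  exact: same_connect (sym_connect_sym (sub_adj_sym G)) _ _ xy _.
have /and3P[_ /trivIsetP tr _] := equivalence_partitionP eqr.
exact: tr.
Qed.

Lemma component_depends A : depends_on (incident A) (fun G => A \in components G).
Proof.
move=> G; rewrite !mem_componentsE; congr [&& _, _ & _].
  by apply/idP/idP; apply: sub_cut_connected => u v uA vA /sub_adjP[i vE eG];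
    apply/sub_adjP; exists i => //; move: eG; rewrite in_setI in_incident uA ?andbT.
by rewrite -!setI_eq0 [G :&: _]setIC setIA (setIidPl (subsetDl _ _)).
Qed.

(** Double count of the pairs of a vertex of [A] and a direction: those that leave [A] correspond to
    boundary edges, one to one. *)
Lemma card_pairs A : #|[set ui : vertex d * 'I_d | (ui.1 \in A) && (flip ui.1 ui.2 \in A)]|
  + #|boundary A| = #|A| * d.
Proof.
set I := [set ui | _].
pose O := [set ui : vertex d * 'I_d | (ui.1 \in A) && (flip ui.1 ui.2 \notin A)].
have <- : #|O| = #|boundary A|.
  rewrite -(@card_in_imset _ _ (fun ui : vertex d * 'I_d => cube_edge ui.1 ui.2) O).
    apply: eq_card => e; apply/imsetP/idP => [[[u i]]|].
      by rewrite inE /= => /andP[uA fA] ->; rewrite in_boundary uA (negPf fA).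
    have [u [i ->]] := cube_edgeP e; rewrite in_boundary.
    have [uA|uA] := boolP (u \in A); rewrite ?addTb ?addFb => fA.
      by exists (u, i); rewrite // inE uA.
    by exists (flip u i, i); rewrite ?cube_edge_flip// inE /= fA flipK.
  move=> [u i] [v j]; rewrite !inE /= => /andP[uA fuA] /andP[vA fvA] /cube_edge_eq[<-].
  by case=> [-> //|uv]; move: fuA; rewrite uv flipK vA.
have <- : #|setX A [set: 'I_d]| = #|A| * d by rewrite cardsX cardsT card_ord.
rewrite -cardsUI (_ : I :&: O = set0) ?cards0 ?addn0; last first.
  by apply/setP => -[u i]; rewrite !inE /=; case: (u \in A) (flip u i \in A) => -[].
apply: eq_card => -[u i]; rewrite !inE /= andbT.
by case: (u \in A) (flip u i \in A) => -[].
Qed.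

(** By [card_pairs], since a pair that stays in [A] is determined by its two ends in [A]. *)
Lemma card_boundary_ge A : #|A| * d <= #|boundary A| + #|A| ^ 2.
Proof.
rewrite -card_pairs addnC leq_add2l expnS expn1 -cardsX.
rewrite -(@card_in_imset _ _ (fun ui : vertex d * 'I_d => (ui.1, flip ui.1 ui.2))).
  apply/subset_leq_card/subsetP => -[u v] /imsetP[[w i]].
  by rewrite !inE /= => /andP[wA fA] [-> ->]; rewrite wA.
by move=> [u i] [v j] _ _ [<-] /flip_inj ->.
Qed.

(** A tight set has exactly one inner edge in each direction of its span, by [cut_edge] and
    [tight_uniq_edge]; the value [c] selects one of its ends. *)
Lemma card_side_pairs A (c : bool) : tight A ->
  #|[set ui : vertex d * 'I_d | [&& ui.1 \in A, flip ui.1 ui.2 \in A & ui.1 ui.2 == c]]|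
  = #|span A|.
Proof.
move=> tA; set S := [set ui | _].
rewrite -(@card_in_imset _ _ snd S).
  apply: eq_card => i; apply/imsetP/idP => [[[u j]]|iA].
    rewrite inE /= => /and3P[uA fA _] ->; apply/spanP; exists u, (flip u j).
    by rewrite flip_at; split => //; case: (u j).
  have [cA _] := andP tA.
  have [w [wA wc fA _]] := cut_edge c (fun _ _ => id) cA iA.
  by exists (w, i); rewrite // inE wA fA /= wc.
move=> [u i] [v j]; rewrite !inE /= => /and3P[uA fuA /eqP uc] /and3P[vA fvA /eqP vc] ij.
rewrite -ij in fvA vc *; congr (_, _).
apply: (tight_uniq_edge (x := i) tA) => //; last by rewrite uc.
by apply/spanP; exists u, (flip u i); rewrite flip_at; split => //; case: (u i).
Qed.

Lemma card_inside_tight A : tight A -> #|inside A| = #|span A|.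
Proof.
move=> tA; rewrite -(card_side_pairs false tA); set S := [set ui | _].
rewrite -(@card_in_imset _ _ (fun ui : vertex d * 'I_d => cube_edge ui.1 ui.2) S).
  apply: eq_card => e; apply/idP/imsetP => [|[[u i]]]; last first.
    by rewrite inE /= => /and3P[uA fA _] ->; rewrite in_inside uA.
  have [u [i ->]] := cube_edgeP e; rewrite in_inside => /andP[uA fA].
  have [ui|ui] := boolP (u i); last by exists (u, i); rewrite // inE uA fA (negPf ui).
  by exists (flip u i, i); rewrite ?cube_edge_flip// inE /= flipK uA fA flip_at ui.
move=> [u i] [v j]; rewrite !inE /= => /and3P[_ _ /eqP uc] /and3P[_ _ /eqP vc].
move=> /cube_edge_eq[ij]; rewrite -{}ij in vc *; case=> [-> //|uv].
by move: uc; rewrite uv flip_at vc.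
Qed.

Lemma card_boundary_tight A : tight A -> 2 * #|span A| + #|boundary A| = #|A| * d.
Proof.
move=> tA; rewrite -card_pairs; congr (_ + _); rewrite mul2n -addnn.
rewrite -{1}(card_side_pairs false tA) -(card_side_pairs true tA) -cardsUI.
set S := _ :&: _; have -> : S = set0.
  by apply/setP => -[u i]; rewrite !inE /=; case: (u i); rewrite !andbF.
rewrite cards0 addn0; apply: eq_card => -[u i]; rewrite !inE /=.
by case: (u i) (u \in A) (flip u i \in A) => -[] [].
Qed.

(** By [tight_cut_edge], connectivity of [A] in [G] forces every inner edge, so the event prescribes
    the state of each edge that meets [A] and its probability is exact. *)
Lemma component_tightE A G : tight A ->
  (A \in components G) = (inside A \subset G) && [disjoint boundary A & G].
Proof.
move=> tA; have [cA /eqP kA] := andP tA.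
have A0 : A != set0 by rewrite -card_gt0 kA.
rewrite mem_componentsE A0 /=; congr (_ && _); apply/idP/subsetP => [cG e|sG].
  have [u [i ->]] := cube_edgeP e; rewrite in_inside => /andP[uA fA].
  by rewrite -sub_adj_flip (tight_cut_edge (@sub_adj_adj G) tA cG uA fA).
apply: sub_cut_connected cA => u v uA vA /adjP[i vE]; rewrite vE sub_adj_flip.
by apply: sG; rewrite in_inside uA -vE.
Qed.

(** A boundary edge of [B] has just one end in [B]; if it meets the disjoint set [A], its other end
    is in [A]. *)
Lemma card_boundary_incident A B : [disjoint A & B] ->
  #|boundary B :&: incident A| <= #|A| * #|B|.
Proof.
move=> dAB; rewrite -cardsX.
pose f (uv : vertex d * vertex d) := [set uv.1; uv.2].
have : [set val e | e in boundary B :&: incident A] \subset f @: setX A B.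
  apply/subsetP => S /imsetP[e + ->]; have [u [i ->]] := cube_edgeP e.
  rewrite in_setI in_boundary in_incident => /andP[+ /orP[uA|uA]].
    rewrite (disjointFr dAB uA) addFb => fB; apply/imsetP; exists (u, flip u i) => //.
    by rewrite in_setX uA.
  rewrite (disjointFr dAB uA) addbF => fB; apply/imsetP; exists (flip u i, u) => //.
    by rewrite in_setX uA.
  by rewrite /f /= setUC.
move=> /subset_leq_card; rewrite card_imset; last exact: val_inj.
by move=> h; apply: leq_trans h (leq_imset_card _ _).
Qed.

Definition near_sets t A : {set {set vertex d}} :=
  [set B : {set vertex d} | [&& #|B| == t, cut_connected (@adj d) B &
    ~~ [disjoint incident A & incident B]]].

(** A set that shares an incident edge with [A] contains a vertex of [A] or a neighbour of one,
    hence a point of [W]. By [card_span] it spans at most [t.-1] directions, so [card_small_span]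
    applies at that point. *)
Lemma card_near_sets t A : 0 < t <= d.+1 ->
  #|near_sets t A| <= #|A| * d.+1 * ('C(d, t.-1) * 2 ^ 2 ^ t.-1).
Proof.
move=> /andP[t0 td].
pose W := \bigcup_(u in A) (u |: [set flip u i | i : 'I_d]).
have cW : #|W| <= #|A| * d.+1.
  apply: card_bigcup_leq => u _; rewrite cardsU1.
  by rewrite -add1n leq_add ?leq_b1// (leq_trans (leq_imset_card _ _))// card_ord.
pose F w := [set B : {set vertex d} | (w \in B) && (#|span B| <= t.-1)].
have sub : near_sets t A \subset \bigcup_(w in W) F w.
  apply/subsetP => B; rewrite inE => /and3P[/eqP cB conB /pred0Pn[e /andP[/= eA eB]]].
  have B0 : B != set0 by rewrite -card_gt0 cB.
  have [w wW wB] : exists2 w, w \in W & w \in B.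
    have [u [i eE]] := cube_edgeP e; move: eA eB; rewrite eE !in_incident.
    have inW a b : a \in A -> b \in a |: [set flip a i | i : 'I_d] -> b \in W.
      by move=> aA ba; apply/bigcupP; exists a.
    move=> /orP[uA|uA] /orP[uB|uB].
    - by exists u => //; apply: inW uA _; rewrite setU11.
    - by exists (flip u i) => //; apply: inW uA _; rewrite in_setU1 imset_f ?orbT.
    - exists u => //; apply: inW uA _; rewrite in_setU1.
      by apply/orP; right; apply/imsetP; exists i; rewrite ?flipK.
    - by exists (flip u i) => //; apply: inW uA _; rewrite setU11.
  apply/bigcupP; exists w => //; rewrite inE wB /= -ltnS (prednK t0) -cB.
  exact: card_span.
apply: leq_trans (subset_leq_card sub) _.
apply: (@leq_trans (#|W| * ('C(d, t.-1) * 2 ^ 2 ^ t.-1))); last by rewrite leq_mul2r cW orbT.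
apply: card_bigcup_leq => w _; apply: card_small_span.
by rewrite -ltnS (prednK t0).
Qed.

(** Failing equality in [card_span] costs one more direction; the exponent of [d] drops from [t - 1]
    to [t - 2], which is the relative error [O(1/d)] of the mean. *)
Lemma card_not_tight v t : 1 < t -> t <= d.+2 ->
  #|[set A : {set vertex d} | [&& #|A| == t, cut_connected (@adj d) A, ~~ tight A & v \in A]]|
  <= 'C(d, t.-2) * 2 ^ 2 ^ t.-2.
Proof.
move=> t1 td; apply: leq_trans (card_small_span v _); last by lia.
apply/subset_leq_card/subsetP => A; rewrite !inE => /and4P[/eqP kA cA ntA vA].
have A0 : A != set0 by apply/set0Pn; exists v.
have := card_span cA A0; rewrite vA /=; move: ntA; rewrite /tight cA /= => /eqP.
have arith (a s : nat) : a = t -> a <> s.+1 -> s < a -> s <= t.-2 by move: t1; clear; lia.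
exact: arith.
Qed.

End cube_edges.

Local Open Scope ring_scope.
(** * The Chen-Stein method *)

Section poisson_stein.
Variables (R : realType) (m : R).
Hypothesis m_gt0 : 0 < m.

(** The inequality is strict: the distribution function at [j] is [poisson_cdf m0 j.+1]. *)
Definition poisson_cdf (m0 : R) (j : nat) : R := \sum_(i < j) poisson_pmf m0 i.

Lemma poisson_pmfE k : poisson_pmf m k = m ^+ k / k`!%:R * expR (- m).
Proof. by rewrite /poisson_pmf m_gt0. Qed.

Lemma poisson_pmf_gt0 k : 0 < poisson_pmf m k.
Proof. by rewrite poisson_pmfE mulr_gt0 ?expR_gt0// divr_gt0 ?exprn_gt0// ltr0n fact_gt0. Qed.

Lemma poisson_pmfS k : k.+1%:R * poisson_pmf m k.+1 = m * poisson_pmf m k.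
Proof.
rewrite !poisson_pmfE factS natrM exprS.
have k0 : k`!%:R != 0 :> R by rewrite pnatr_eq0 -lt0n fact_gt0.
have k1 : k.+1%:R != 0 :> R by rewrite pnatr_eq0.
by field; rewrite k0 nat1r k1.
Qed.

Lemma poisson_cdfS j : poisson_cdf m j.+1 = poisson_cdf m j + poisson_pmf m j.
Proof. by rewrite /poisson_cdf big_ord_recr. Qed.

Lemma poisson_cdf_ge0 j : 0 <= poisson_cdf m j.
Proof. by apply: sumr_ge0 => i _; apply: poisson_pmf_ge0. Qed.

Lemma poisson_cdf_nd : {homo poisson_cdf m : i j / (i <= j)%N >-> i <= j}.
Proof.
apply: homo_leq => [x|y x z|i]; [exact: lexx|exact: le_trans|].
by rewrite poisson_cdfS lerDl poisson_pmf_ge0.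
Qed.

Lemma poisson_cdf_series j :
  poisson_cdf m j = series (exp_coeff m) j * expR (- m).
Proof.
rewrite /poisson_cdf /series /= big_mkord mulr_suml.
by apply: eq_bigr => i _; rewrite poisson_pmfE /exp_coeff.
Qed.

Lemma cvg_poisson_cdf : (poisson_cdf m j @[j --> \oo] --> (1 : R))%classic.
Proof.
rewrite -(expRxMexpNx_1 m); under eq_fun do rewrite poisson_cdf_series.
apply: cvgMl; exact: is_cvg_series_exp_coeff.
Qed.

Lemma poisson_cdf_le1 j : poisson_cdf m j <= 1.
Proof.
rewrite -(cvg_lim _ cvg_poisson_cdf)//; apply: nondecreasing_cvgn_le.
  exact: poisson_cdf_nd.
by apply/cvg_ex; exists 1; exact: cvg_poisson_cdf.
Qed.

(** By [poisson_pmfS] the left side is the sum of [i * pi_i] over [i <= j], and each such [i] is at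
    most [j]. *)
Lemma poisson_cdf_left j : m * poisson_cdf m j <= j%:R * poisson_cdf m j.+1.
Proof.
rewrite /poisson_cdf big_ord_recl mulrDr !mulr_sumr.
rewrite -[leLHS]add0r; apply: lerD; first by rewrite mulr_ge0// poisson_pmf_ge0.
apply: ler_sum => i _; rewrite -poisson_pmfS; apply: ler_wpM2r; first exact: poisson_pmf_ge0.
by rewrite ler_nat.
Qed.

(** The counterpart of [poisson_cdf_left] for the upper tail, where [i >= j]; it is shown for the
    masses of bounded intervals and passes to the limit. *)
Lemma poisson_cdf_right j : j%:R * (1 - poisson_cdf m j.+1) <= m * (1 - poisson_cdf m j).
Proof.
have main k : j%:R * (poisson_cdf m (j + k).+1 - poisson_cdf m j.+1)
    <= m * (poisson_cdf m (j + k) - poisson_cdf m j).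
  elim: k => [|k IH]; first by rewrite addn0 !subrr !mulr0.
  rewrite addnS (poisson_cdfS (j + k).+1) [in leRHS]poisson_cdfS.
  rewrite -addrA [_ - poisson_cdf m j.+1]addrC addrA mulrDr.
  rewrite -[X in m * X]addrA [_ - poisson_cdf m j]addrC addrA [leRHS]mulrDr.
  apply: lerD => //; rewrite -poisson_pmfS; apply: ler_wpM2r; first exact: poisson_pmf_ge0.
  by rewrite ler_nat; lia.
have c1 : (j%:R * (poisson_cdf m (j + k).+1 - poisson_cdf m j.+1) @[k --> \oo]
   --> j%:R * (1 - poisson_cdf m j.+1))%classic.
  apply: cvgMr; apply: cvgB; last exact: cvg_cst.
  rewrite (_ : (fun k => _) = (fun k => poisson_cdf m (k + j.+1)%N)); last first.
    by apply/funext => k; rewrite addnC addnS.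
  by rewrite (cvg_shiftn j.+1); exact: cvg_poisson_cdf.
have c2 : (m * (poisson_cdf m (j + k) - poisson_cdf m j) @[k --> \oo]
   --> m * (1 - poisson_cdf m j))%classic.
  apply: cvgMr; apply: cvgB; last exact: cvg_cst.
  rewrite (_ : (fun k => _) = (fun k => poisson_cdf m (k + j)%N)); last first.
    by apply/funext => k; rewrite addnC.
  by rewrite (cvg_shiftn j); exact: cvg_poisson_cdf.
by apply: (ler_cvg_to c1 c2); near=> k; exact: main.
Unshelve. all: by end_near. Qed.

(* With [a], [x], [b] the parts of [sum_i pi_i h_i] below, at and above [j], the
   increment of the solution at [j] times [m j pi_j] is
   [a (j (1-F') - m (1-F)) + b (m F - j F') + x (j (1-F') + m F)], where [F] and
   [F'] are the masses of [0, j) and [0, j]; the first two brackets are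
   nonpositive, which gives both bounds. *)
Lemma stein_increment (F pi j a b x : R) : 0 < j -> 0 < pi -> 0 <= F -> F + pi <= 1 ->
  m * F <= j * (F + pi) -> j * (1 - (F + pi)) <= m * (1 - F) ->
  0 <= a <= F -> 0 <= b <= 1 - (F + pi) -> 0 <= x <= pi ->
  `|(a + x - (F + pi) * (a + x + b)) / (m * pi) - (a - F * (a + x + b)) / (j * pi)| <= m^-1.
Proof.
move=> j0 pi0 F0 F1 hl hr /andP[a0 aF] /andP[b0 bF] /andP[x0 xpi].
set D := _ - _.
have -> : D = (a * (j * (1 - (F + pi)) - m * (1 - F)) + b * (m * F - j * (F + pi))
    + x * (j * (1 - (F + pi)) + m * F)) / (m * j * pi).
  by rewrite /D; field; rewrite !gt_eqF.
have jpi0 : 0 < m * j * pi by rewrite !mulr_gt0.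
have -> : m^-1 = (j * pi) / (m * j * pi) by field; rewrite !gt_eqF.
rewrite ler_norml -mulNr !ler_pM2r ?invr_gt0//.
have s1 : j * (1 - (F + pi)) - m * (1 - F) <= 0 by rewrite subr_le0.
have s2 : m * F - j * (F + pi) <= 0 by rewrite subr_le0.
have s3 : 0 <= j * (1 - (F + pi)) + m * F <= j.
  apply/andP; split; first by rewrite addr_ge0// mulr_ge0 ?subr_ge0// ltW.
  by rewrite -[leRHS]mulr1 -lerBrDl -mulrBr opprB addrCA subrr addr0.
move: s3 => /andP[s3 s4].
have a1 : F * (j * (1 - (F + pi)) - m * (1 - F)) <= a * (j * (1 - (F + pi)) - m * (1 - F)).
  by apply: ler_wnM2r.
have a2 : a * (j * (1 - (F + pi)) - m * (1 - F)) <= 0 by apply: mulr_ge0_le0.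
have b1 : (1 - (F + pi)) * (m * F - j * (F + pi)) <= b * (m * F - j * (F + pi)).
  by apply: ler_wnM2r.
have b2 : b * (m * F - j * (F + pi)) <= 0 by apply: mulr_ge0_le0.
have x1 : 0 <= x * (j * (1 - (F + pi)) + m * F) by apply: mulr_ge0.
have x2 : x * (j * (1 - (F + pi)) + m * F) <= pi * j by apply: ler_pM.
have e1 : F * (j * (1 - (F + pi)) - m * (1 - F)) + (1 - (F + pi)) * (m * F - j * (F + pi))
   = - (pi * (j * (1 - (F + pi)) + m * F)) by ring.
have e2 : pi * (j * (1 - (F + pi)) + m * F) <= pi * j by apply: ler_wpM2l => //; exact: ltW.
by rewrite [j * pi]mulrC; apply/andP; split; lra.
Qed.

(** The index is shifted: [g k] is the usual Stein solution at [k + 1], and at [k = 0] the term with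
    [k.-1] carries the factor 0. The finite support of [h] makes its Poisson mean a finite sum. *)
Lemma stein_solution (N : nat) (h : nat -> R) :
  (forall k, 0 <= h k <= 1) -> (forall k, (N <= k)%N -> h k = 0) ->
  exists g : nat -> R,
    (forall k, `|g k.+1 - g k| <= m^-1) /\
    (forall k, m * g k - k%:R * g k.-1 = h k - \sum_(i < N) poisson_pmf m i * h i).
Proof.
move=> h01 hN; set c := \sum_(i < N) _.
pose G j := \sum_(i < j) poisson_pmf m i * (h i - c).
have GS j : G j.+1 = G j + poisson_pmf m j * (h j - c) by rewrite /G big_ord_recr.
have pmf0 k : poisson_pmf m k != 0 by rewrite gt_eqF// poisson_pmf_gt0.
have m0 : m != 0 by rewrite gt_eqF.
exists (fun k => G k.+1 / (m * poisson_pmf m k)); split => [k|[|k]]; last first.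
- have E := poisson_pmfS k; rewrite /= -E.
  have k1 : k.+1%:R != 0 :> R by rewrite pnatr_eq0.
  by rewrite GS; field; rewrite pmf0 nat1r k1 m0.
- by rewrite mulr0n mul0r subr0 GS /G big_ord0 add0r; field; rewrite m0 pmf0.
pose a := \sum_(i < k.+1) poisson_pmf m i * h i.
(* [M] exceeds [k.+1] and is at least [N], so the mean [c] splits into its parts [a] below, one term
   at, and [b] above [k.+1], as in [stein_increment]. *)
pose M := (N + k.+2)%N.
have cM : c = \sum_(i < M) poisson_pmf m i * h i.
  rewrite /c /M -(big_mkord xpredT (fun i => poisson_pmf m i * h i)).
  rewrite -(big_mkord xpredT (fun i => poisson_pmf m i * h i)).
  rewrite (big_cat_nat (leq0n N) (leq_addr _ _))/=.
  rewrite [X in _ + X]big_nat_cond [X in _ + X]big1 ?addr0// => i /andP[/andP[Ni _] _].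
  by rewrite hN ?mulr0.
pose b := \sum_(k.+2 <= i < M) poisson_pmf m i * h i.
have cE : c = a + poisson_pmf m k.+1 * h k.+1 + b.
  rewrite cM -(big_mkord xpredT (fun i => poisson_pmf m i * h i)).
  rewrite (big_cat_nat (n := k.+2)) ?leq_addl//= -/b; congr (_ + _).
  by rewrite big_nat_recr//= big_mkord.
have GE j : G j = \sum_(i < j) poisson_pmf m i * h i - poisson_cdf m j * c.
  rewrite /G /poisson_cdf mulr_suml -sumrB; apply: eq_bigr => i _.
  by rewrite mulrBr.
have hmono (i : nat) : 0 <= poisson_pmf m i * h i <= poisson_pmf m i.
  have /andP[h0 h1] := h01 i; rewrite mulr_ge0 ?poisson_pmf_ge0//=.
  by rewrite ler_piMr// poisson_pmf_ge0.
rewrite -(poisson_pmfS k) !GE big_ord_recr /= -/a (poisson_cdfS k.+1) cE.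
apply: stein_increment.
- by rewrite ltr0n.
- exact: poisson_pmf_gt0.
- exact: poisson_cdf_ge0.
- by rewrite -poisson_cdfS; exact: poisson_cdf_le1.
- by rewrite -poisson_cdfS; exact: poisson_cdf_left.
- by rewrite -poisson_cdfS; exact: poisson_cdf_right.
- apply/andP; split; first by apply: sumr_ge0 => i _; have /andP[] := hmono i.
  by apply: ler_sum => i _; have /andP[] := hmono i.
- apply/andP; split; first by apply: sumr_ge0 => i _; have /andP[] := hmono i.
  rewrite lerBrDr -poisson_cdfS (le_trans _ (poisson_cdf_le1 M))//.
  rewrite /poisson_cdf -[leRHS](big_mkord xpredT (poisson_pmf m)).
  rewrite (big_cat_nat (n := k.+2)) ?leq_addl//= addrC; apply: lerD; last by rewrite big_mkord.
  by apply: ler_sum => i _; have /andP[] := hmono i.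
- exact: hmono.
Qed.

End poisson_stein.

Lemma nat_lipschitz (R : realType) (g : nat -> R) (K : R) :
  (forall k, `|g k.+1 - g k| <= K) -> forall i j, `|g (i + j)%N - g i| <= K * j%:R.
Proof.
move=> gK i; elim=> [|j IH]; first by rewrite addn0 subrr normr0 mulr0.
rewrite addnS -natr1 mulrDr mulr1 -(subrKA (g (i + j)%N)) addrC.
by rewrite (le_trans (ler_normD _ _))// lerD.
Qed.

(** * Poisson approximation for locally dependent indicators *)

Section chen_stein.
Variables (R : realType) (T : finType) (P : T -> R).
Hypotheses (P_ge0 : forall w, 0 <= P w) (P_sum1 : \sum_w P w = 1).
Variables (J : finType) (I : J -> pred T) (near : rel J).
Hypothesis near_refl : reflexive near.

Let X w : nat := (\sum_a I a w)%N.
Let far a w : nat := (\sum_(b | ~~ near a b) I b w)%N.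
Let pr a := expectation P (fun w => (I a w)%:R).

Hypothesis far_indep : forall a (f : nat -> R),
  expectation P (fun w => (I a w)%:R * f (far a w)) = pr a * expectation P (f \o far a).

Let mean := \sum_a pr a.

Hypothesis mean_gt0 : 0 < mean.

(** The terms usually called [b1] and [b2] of the Chen-Stein bound; the third one, [b3], vanishes
    under [far_indep]. *)
Definition chen_stein_error : R :=
  \sum_a \sum_(b | near a b) pr a * pr b +
  \sum_a \sum_(b | near a b && (b != a)) expectation P (fun w => (I a w && I b w)%:R).

(** For each [a], compare [g (X w)] and [g (X w).-1] with [g (far a w)], which is uncorrelated with
    [I a]. The arguments differ by the number of near indicators in the first case and, when [I a w]
    holds, by the number of those other than [a] in the second. *)
Lemma chen_stein_lipschitz (g : nat -> R) (K : R) : (forall k, `|g k.+1 - g k| <= K) ->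
  `|expectation P (fun w => mean * g (X w) - (X w)%:R * g (X w).-1)| <= K * chen_stein_error.
Proof.
move=> gK; have lip := nat_lipschitz gK.
pose Y a w : nat := (\sum_(b | near a b && (b != a)) I b w)%N.
pose Z a w : nat := (\sum_(b | near a b) I b w)%N.
have XE a w : X w = (far a w + Z a w)%N by rewrite /X (bigID (near a)) /= addnC.
have ZE a w : Z a w = (I a w + Y a w)%N by rewrite /Z (bigD1 a)//= near_refl.
have -> : expectation P (fun w => mean * g (X w) - (X w)%:R * g (X w).-1) =
    \sum_a (pr a * expectation P (fun w => g (X w) - g (far a w)) +
            expectation P (fun w => (I a w)%:R * (g (far a w) - g (X w).-1))).
  transitivity (\sum_a (pr a * expectation P (fun w => g (X w)) -
                        expectation P (fun w => (I a w)%:R * g (X w).-1))).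
    rewrite expectationB expectationZ sumrB -mulr_suml; congr (_ - _).
    rewrite -expectation_sum; apply: eq_expectation => w.
    by rewrite -mulr_suml /X natr_sum.
  apply: eq_bigr => a _; rewrite expectationB mulrBr.
  have -> : expectation P (fun w => (I a w)%:R * (g (far a w) - g (X w).-1)) =
     pr a * expectation P (g \o far a) - expectation P (fun w => (I a w)%:R * g (X w).-1).
    rewrite -far_indep -expectationB; apply: eq_expectation => w.
    by rewrite mulrBr.
  by rewrite addrA subrK.
rewrite /chen_stein_error mulrDr !mulr_sumr -big_split /=.
apply: le_trans (ler_norm_sum _ _ _) _; apply: ler_sum => a _.
have pr0 : 0 <= pr a by apply: expectation_ge0.
apply: le_trans (ler_normD _ _) _; apply: lerD.
  rewrite normrM (ger0_norm pr0) -mulr_sumr mulrCA; apply: ler_wpM2l => //.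
  rewrite -expectation_sum -expectationZ.
  apply: le_trans (norm_expectation P_ge0 _) _; apply: le_expectation => // w.
  by rewrite (XE a) -natr_sum; exact: lip.
rewrite -expectation_sum -expectationZ.
apply: le_trans (norm_expectation P_ge0 _) _; apply: le_expectation => // w.
rewrite (XE a) ZE; case: (I a w) => /=; last first.
  by rewrite mul0r normr0 big1 ?mulr0.
by rewrite mul1r distrC -natr_sum addnCA add1n /=; exact: lip.
Qed.

(** The sum is the discrepancy on the set where the difference of the two laws is nonnegative minus
    that on the set where it is negative. Each is bounded with the Stein solution for the indicator
    of the set, whose increments are at most [mean^-1]; hence the factor 2. *)
Lemma chen_stein (N : nat) :
  \sum_(k < N) `|nat_law P X k - poisson_pmf mean k| <= 2 * (mean^-1 * chen_stein_error).
Proof.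
have main (h : nat -> R) : (forall k, 0 <= h k <= 1) -> (forall k, (N <= k)%N -> h k = 0) ->
    `|\sum_(k < N) (nat_law P X k - poisson_pmf mean k) * h k| <= mean^-1 * chen_stein_error.
  move=> h01 hN; have [g [gK gE]] := stein_solution mean_gt0 h01 hN.
  apply: le_trans (chen_stein_lipschitz gK).
  under eq_bigr do rewrite mulrBl; rewrite sumrB.
  rewrite (eq_expectation _ (fun w => gE (X w))) expectationB (expectation_cst P_sum1).
  rewrite le_eqVlt; apply/orP; left; apply/eqP; congr `|_ - _|.
  under eq_bigr do rewrite /nat_law prob_expectation mulrC -expectationZ.
  rewrite -expectation_sum; apply: eq_expectation => w /=.
  have [XN|XN] := ltnP (X w) N.
    rewrite (bigD1 (Ordinal XN))//= eqxx mulr1 big1 ?addr0// => k kX.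
    by rewrite eq_sym -val_eqE/= in kX; rewrite (negPf kX) mulr0.
  rewrite hN// big1// => k _.
  by rewrite (gtn_eqF (leq_trans (ltn_ord k) XN)) mulr0.
pose D k := nat_law P X k - poisson_pmf mean k.
pose h (s : bool) k : R := ((k < N)%N && ((0 <= D k) == s))%:R.
have h01 s k : 0 <= h s k <= 1 by rewrite ler0n lern1 leq_b1.
have hN s k : (N <= k)%N -> h s k = 0 by rewrite /h leqNgt => /negPf ->.
have -> : \sum_(k < N) `|D k| = \sum_(k < N) D k * h true k + - \sum_(k < N) D k * h false k.
  rewrite -sumrB; apply: eq_bigr => k _; rewrite /h ltn_ord /=.
  have [Dk|Dk] := leP 0 (D k); first by rewrite ger0_norm// eqxx mulr1 mulr0 subr0.
  by rewrite ltr0_norm// eqxx mulr1 mulr0 sub0r.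
rewrite mulr2n mulrDl !mul1r; apply: lerD.
  by apply: le_trans (main _ (h01 true) (hN true)); exact: ler_norm.
apply: le_trans (main _ (h01 false) (hN false)); rewrite -normrN; exact: ler_norm.
Qed.
End chen_stein.

(** * Probabilities of components *)

Section component_probability.
Variables (R : realType) (p : R) (d t : nat).
Hypotheses (p_gt0 : 0 < p) (p_lt1 : p < 1) (t_gt0 : (0 < t)%N).
Local Notation q := (1 - p).
Local Notation E := (expectation (@Qp R p d)).
Implicit Types (A B : {set vertex d}) (G : {set edge d}) (v : vertex d).

Let q_gt0 : 0 < q. Proof. by rewrite subr_gt0. Qed.
Let q_le1 : q <= 1. Proof. by rewrite lerBlDr lerDl ltW. Qed.

Let ratio_ge0 m n : 0 <= q ^+ m / q ^+ n.
Proof. by rewrite divr_ge0// exprn_ge0// ltW. Qed.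

Lemma Qp_ge0 G : 0 <= Qp p G.
Proof. by apply: bernoulli_weight_ge0; rewrite !ltW. Qed.

Lemma Qp_sum1 : \sum_G @Qp R p d G = 1.
Proof. exact: bernoulli_weight_sum1. Qed.

(** The size is part of the event, so that the indicators are indexed by all sets of vertices. *)
Definition is_t_component A G : bool := (#|A| == t) && (A \in components G).

(** The first disjunct gives reflexivity even when [incident A] is empty. *)
Definition near_set A B : bool := (A == B) || ~~ [disjoint incident A & incident B].

Definition component_prob A : R := E (fun G => (is_t_component A G)%:R).

Lemma component_prob_ge0 A : 0 <= component_prob A.
Proof. by apply: expectation_ge0 => // G; exact: Qp_ge0. Qed.

Lemma comp_countE G : comp_count t G = (\sum_A is_t_component A G)%N.
Proof.
rewrite /comp_count -sum1_card big_mkcond; apply: eq_bigr => A _.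
by rewrite inE andbC /is_t_component; case: (_ && _).
Qed.

Lemma mu_component_prob : mu_ p t d = \sum_A component_prob A.
Proof.
rewrite /mu_ /component_prob -expectation_sum; apply: eq_expectation => G.
by rewrite /X_ comp_countE natr_sum.
Qed.

Lemma is_t_component_depends A : depends_on (incident A) (is_t_component A).
Proof. by move=> G; rewrite /is_t_component [in LHS]component_depends. Qed.

Lemma far_depends A B : ~~ near_set A B -> depends_on (~: incident A) (is_t_component B).
Proof.
rewrite negb_or negbK => /andP[_ dis].
apply: depends_onS (@is_t_component_depends B).
by rewrite -disjoints_subset disjoint_sym.
Qed.

Lemma component_indep A (T : Type) (Y : {set edge d} -> T) (f : T -> R) :
  depends_on (~: incident A) Y ->
  E (fun G => (is_t_component A G)%:R * f (Y G)) = component_prob A * E (f \o Y).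
Proof.
move=> hY; apply: (@bernoulli_indep _ _ p (incident A)
  (fun G => (is_t_component A G)%:R) (f \o Y)) => G.
- by congr (_%:R); rewrite is_t_component_depends.
- by rewrite /= hY.
Qed.

(** The [t.-1] inner edges must be present, and the boundary edges, counted by
    [card_boundary_tight], absent. *)
Lemma component_probE A : (#|A| = t)%N -> tight A ->
  component_prob A = p ^+ t.-1 * q ^+ (t * d - 2 * t.-1).
Proof.
move=> kA tA; have [_ /eqP kS] := andP tA.
have sA : #|span A| = t.-1 by rewrite -kA kS.
rewrite /component_prob (@eq_expectation _ _ _ _
  (fun G => ((inside A \subset G) && [disjoint boundary A & G])%:R)).
  rewrite [LHS](@bernoulli_weight_in_out R (edge d) p (inside A) (boundary A)).
    rewrite (card_inside_tight tA) sA; congr (_ * _ ^+ _).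
    by have := card_boundary_tight tA; rewrite kA sA => <-; rewrite addKn.
  by apply/pred0P => e /=; rewrite in_setD; case: (e \in inside A).
by move=> G; rewrite /is_t_component kA eqxx (component_tightE _ tA).
Qed.

Lemma component_prob_eq0 A : ~~ ((#|A| == t) && cut_connected (@adj d) A) -> component_prob A = 0.
Proof.
move=> h; rewrite /component_prob -[RHS](expectation_cst Qp_sum1); apply: eq_expectation => G.
suff -> : is_t_component A G = false by [].
by apply/negP => /andP[kA /component_connected cA]; rewrite kA cA in h.
Qed.

(** All boundary edges are absent, and [card_boundary_ge] bounds their number from below. A quotient
    avoids the truncated difference of exponents for small [d]. *)
Lemma component_prob_le A : component_prob A <= q ^+ (t * d) / q ^+ (t ^ 2).
Proof.
have [/eqP kA|kA] := boolP (#|A| == t); last first.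
  by rewrite component_prob_eq0 ?(negPf kA).
apply: (@le_trans _ _ (q ^+ #|boundary A|)); last first.
  rewrite ler_pdivlMr ?exprn_gt0// -exprD.
  have := card_boundary_ge A; rewrite kA => hle.
  by apply: ler_wiXn2l => //; exact: ltW.
have := @bernoulli_weight_in_out R (edge d) p set0 (boundary A).
rewrite cards0 expr0 mul1r => <-; last by rewrite -setI_eq0 set0I.
apply: le_expectation => [G|G]; first exact: Qp_ge0.
rewrite ler_nat sub0set /= /is_t_component mem_componentsE.
by case: [disjoint _ & _]; rewrite ?leq_b1// !andbF.
Qed.

(** Overlapping sets cannot both be components. For disjoint ones, the boundary edges of [B] that do
    not meet [A] are independent of the event for [A]; their number is at least [t * d - 2 * t ^ 2],
    one [t ^ 2] from [card_boundary_ge] and one from [card_boundary_incident]. *)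
Lemma component_prob_pair A B : A != B ->
  E (fun G => (is_t_component A G && is_t_component B G)%:R)
  <= component_prob A * (q ^+ (t * d) / q ^+ (2 * t ^ 2)).
Proof.
move=> AB; have r0 := ratio_ge0 (t * d) (2 * t ^ 2).
have [/eqP kA|kA] := boolP (#|A| == t); last first.
  apply: (@le_trans _ _ 0); last by rewrite mulr_ge0// component_prob_ge0.
  rewrite -(expectation_cst Qp_sum1 0); apply: le_expectation => [G|G]; first exact: Qp_ge0.
  by rewrite /is_t_component (negPf kA).
have [/eqP kB|kB] := boolP (#|B| == t); last first.
  apply: (@le_trans _ _ 0); last by rewrite mulr_ge0// component_prob_ge0.
  rewrite -(expectation_cst Qp_sum1 0); apply: le_expectation => [G|G]; first exact: Qp_ge0.
  by rewrite /is_t_component (negPf kB) andbF.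
have [dAB|dAB] := boolP [disjoint A & B]; last first.
  apply: (@le_trans _ _ 0); last by rewrite mulr_ge0// component_prob_ge0.
  rewrite -(expectation_cst Qp_sum1 0); apply: le_expectation => [G|G]; first exact: Qp_ge0.
  rewrite (_ : _ && _ = false)//; apply/negP => /andP[/andP[_ cA] /andP[_ cB]].
  by case/negP: dAB; exact: components_disjoint cA cB AB.
pose S := boundary B :\: incident A.
apply: (@le_trans _ _ (E (fun G => (is_t_component A G)%:R * ([disjoint S & G])%:R))).
  apply: le_expectation => [G|G]; first exact: Qp_ge0.
  rewrite -natrM ler_nat; case: (is_t_component A G) => //=; rewrite mul1n.
  rewrite /is_t_component mem_componentsE.
  have [_|dS] := boolP [disjoint S & G]; first exact: leq_b1.
  rewrite leqn0 eqb0; apply: contra dS => /and4P[_ _ _ dB].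
  by apply: disjointWl dB; apply: subsetDl.
rewrite (component_indep (Y := fun G => [disjoint S & G]) (fun b : bool => b%:R)); last first.
  have SE : S :&: ~: incident A = S by apply/setIidPl; rewrite /S setDE subsetIr.
  by move=> G; rewrite -!setI_eq0 [G :&: _]setIC setIA SE.
apply: ler_wpM2l; first exact: component_prob_ge0.
have := @bernoulli_weight_in_out R (edge d) p set0 S.
rewrite cards0 expr0 mul1r -setI_eq0 set0I eqxx => /(_ isT) hS.
rewrite (@eq_expectation _ _ _ _ (fun G => ((set0 \subset G) && [disjoint S & G])%:R)); last first.
  by move=> G; rewrite sub0set.
rewrite [leLHS]hS ler_pdivlMr ?exprn_gt0// -exprD; apply: ler_wiXn2l => //; first exact: ltW.
have := card_boundary_ge B; rewrite kB; have := card_boundary_incident dAB; rewrite kA kB.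
have := cardsID (incident A) (boundary B); rewrite -/S.
by move: #|_ :&: _| #|S| #|boundary B| => a b c; clear; nia.
Qed.

(** The bound of [card_near_sets], plus one for the set itself. *)
Definition near_bound : nat := (t * d.+1 * ('C(d, t.-1) * 2 ^ 2 ^ t.-1)).+1.

Definition error_bound : R :=
  near_bound%:R * (q ^+ (t * d) / q ^+ (t ^ 2) + q ^+ (t * d) / q ^+ (2 * t ^ 2)).

Lemma near_sum_le A (F : {set vertex d} -> R) (c : R) : (t <= d.+1)%N -> #|A| = t -> 0 <= c ->
  (forall B, F B <= c) ->
  (forall B, ~~ ((#|B| == t) && cut_connected (@adj d) B) -> F B <= 0) ->
  \sum_(B | near_set A B) F B <= near_bound%:R * c.
Proof.
move=> td kA c0 Fc F0.
apply: (@le_trans _ _ (\sum_(B in A |: near_sets t A) c)).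
  rewrite big_mkcond [leRHS]big_mkcond; apply: ler_sum => B _.
  rewrite in_setU1 inE /near_set eq_sym; case: eqVneq => [_|AB] //=.
  have [h|h] := boolP ((#|B| == t) && cut_connected (@adj d) B); rewrite andbA ?h ?(negPf h) /=.
    by case: ifP.
  by case: ifP => // _; exact: F0.
rewrite sumr_const -[leLHS]mulr_natl; apply: ler_wpM2r => //; rewrite ler_nat.
rewrite cardsU1 /near_bound -add1n leq_add ?leq_b1//.
by rewrite -[X in (_ <= X * _ * _)%N]kA; apply: card_near_sets; rewrite t_gt0.
Qed.

Let near_error := chen_stein_error (@Qp R p d) is_t_component near_set.

Lemma near_error_le : (t <= d.+1)%N -> near_error <= mu_ p t d * error_bound.
Proof.
move=> td; rewrite /near_error /chen_stein_error mu_component_prob -big_split /= mulr_suml.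
apply: ler_sum => A _; rewrite -/(component_prob A).
have [kA|kA] := eqVneq #|A| t; last first.
  have pA : component_prob A = 0 by rewrite component_prob_eq0// (negPf kA).
  rewrite pA mul0r big1 ?add0r => [|B _]; last by rewrite mul0r.
  rewrite sumr_le0// => B /andP[_ BA].
  by rewrite eq_sym in BA; have := component_prob_pair BA; rewrite pA mul0r.
rewrite /error_bound mulrDr mulrDr; apply: lerD.
  rewrite -mulr_sumr; apply: ler_wpM2l; first exact: component_prob_ge0.
  apply: near_sum_le => //.
  - by move=> B; exact: component_prob_le.
  - by move=> B h; rewrite -/(component_prob B) component_prob_eq0.
rewrite mulrCA big_mkcondr /=; apply: near_sum_le => //.
- by rewrite mulr_ge0 ?component_prob_ge0.
- move=> B; case: ifPn => [BA|_]; first by apply: component_prob_pair; rewrite eq_sym.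
  by rewrite mulr_ge0 ?component_prob_ge0.
- move=> B h; case: ifP => // _; rewrite -(component_prob_eq0 h).
  apply: le_expectation => [G|G]; first exact: Qp_ge0.
  by rewrite ler_nat; case: (is_t_component A G).
Qed.

Lemma near_set_refl : reflexive near_set.
Proof. by move=> A; rewrite /near_set eqxx. Qed.

Lemma comp_count_poisson (N : nat) : (t <= d.+1)%N -> 0 < mu_ p t d ->
  \sum_(k < N) `|nat_law (@Qp R p d) (@comp_count d t) k - poisson_pmf (mu_ p t d) k|
  <= 2 * error_bound.
Proof.
move=> td mu0.
have mE : mu_ p t d = \sum_A expectation (@Qp R p d) (fun G => (is_t_component A G)%:R).
  exact: mu_component_prob.
have indep A (f : nat -> R) :
  E (fun G => (is_t_component A G)%:R * f (\sum_(B | ~~ near_set A B) is_t_component B G)%N)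
  = E (fun G => (is_t_component A G)%:R) *
    E (f \o fun G => \sum_(B | ~~ near_set A B) is_t_component B G)%N.
  apply: component_indep => G; apply: eq_bigr => B AB.
  by rewrite [in LHS](far_depends AB).
have := @chen_stein R _ _ Qp_ge0 Qp_sum1 _ _ _ near_set_refl indep _ N.
rewrite -mE => /(_ mu0) /le_trans h.
rewrite (eq_bigr (fun k : 'I_N =>
  `|nat_law (@Qp R p d) (fun G => (\sum_A is_t_component A G)%N) k - poisson_pmf (mu_ p t d) k|)).
  apply: h; apply: ler_wpM2l => //; rewrite mulrC ler_pdivrMr// mulrC.
  exact: near_error_le.
move=> k _; rewrite /nat_law /prob; congr (`|_ - _|).
by apply: eq_bigl => G; rewrite /= comp_countE.
Qed.

(** Covariances of far pairs vanish, the diagonal terms [E (I_A ^ 2) = E I_A] add up to the mean,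
    and what remains is dominated by the Chen-Stein error. *)
Lemma Var_mu : (t <= d.+1)%N ->
  `|Var_ p t d - mu_ p t d| <= mu_ p t d * error_bound.
Proof.
move=> td; apply: le_trans (near_error_le td).
have EXY A B : E (fun G => (is_t_component A G)%:R * (is_t_component B G)%:R) =
   E (fun G => (is_t_component A G && is_t_component B G)%:R).
  by apply: eq_expectation => G; rewrite -natrM mulnb.
have -> : Var_ p t d = \sum_A \sum_B (E (fun G => (is_t_component A G && is_t_component B G)%:R)
     - component_prob A * component_prob B).
  rewrite /Var_ /variance -/(mu_ p t d) mu_component_prob.
  transitivity (E (fun G => \sum_A \sum_B (((is_t_component A G)%:R - component_prob A)
     * ((is_t_component B G)%:R - component_prob B)))).
    apply: eq_expectation => G; rewrite /X_ comp_countE natr_sum -sumrB expr2 mulr_suml.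
    by apply: eq_bigr => A _; rewrite mulr_sumr.
  rewrite expectation_sum; apply: eq_bigr => A _; rewrite expectation_sum; apply: eq_bigr => B _.
  rewrite -EXY.
  transitivity (E (fun G => (is_t_component A G)%:R * (is_t_component B G)%:R
     - component_prob A * (is_t_component B G)%:R
     - (component_prob B * (is_t_component A G)%:R - component_prob A * component_prob B))).
    by apply: eq_expectation => G; ring.
  rewrite !expectationB !expectationZ (expectation_cst Qp_sum1).
  rewrite -/(component_prob A) -/(component_prob B).
  by ring.
rewrite mu_component_prob -sumrB.
rewrite /near_error /chen_stein_error -big_split /=.
apply: le_trans (ler_norm_sum _ _ _) _; apply: ler_sum => A _.
rewrite (bigID (near_set A)) /= [X in _ + X - _]big1 ?addr0; last first.
  move=> B AB; apply/eqP; rewrite subr_eq0 -EXY; apply/eqP.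
  exact: (component_indep (fun b : bool => b%:R) (far_depends AB)).
rewrite sumrB addrAC (bigD1 A) /=; last exact: near_set_refl.
rewrite (@eq_expectation _ _ _ _ (fun G => (is_t_component A G)%:R)); last first.
  by move=> G; rewrite andbb.
rewrite -/(component_prob A) [component_prob A + _]addrC addrK addrC -normrN opprD opprK.
apply: le_trans (ler_normB _ _) _; apply: lerD.
  by rewrite ger0_norm ?sumr_ge0// => B _; rewrite mulr_ge0 ?component_prob_ge0.
rewrite ger0_norm ?sumr_ge0// => B _.
by apply: expectation_ge0 => // G; exact: Qp_ge0.
Qed.

(** The contribution of tight sets to [t * mu]; the factor [t] comes from marking a vertex of each
    set. *)
Definition mu_main : R :=
  2 ^+ d * ('C(d, t.-1) * t ^ t.-2)%:R * (p ^+ t.-1 * q ^+ (t * d - 2 * t.-1)).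

Lemma sum_component_prob_containing :
  t%:R * mu_ p t d = \sum_(v : vertex d) \sum_(A : {set vertex d} | v \in A) component_prob A.
Proof.
rewrite (exchange_big_dep xpredT)//= mu_component_prob mulr_sumr; apply: eq_bigr => A _.
rewrite sumr_const -[RHS]mulr_natl; have [->//|kA] := eqVneq #|A| t.
by rewrite component_prob_eq0 ?mulr0// (negPf kA).
Qed.

Lemma card_vertex : #|{: vertex d}| = (2 ^ d)%N.
Proof. by rewrite card_ffun card_bool card_ord. Qed.

Lemma sum_tight_containing v :
  \sum_(A : {set vertex d} | v \in A) component_prob A =
  ('C(d, t.-1) * t ^ t.-2)%:R * (p ^+ t.-1 * q ^+ (t * d - 2 * t.-1))
  + \sum_(A in [set A : {set vertex d} |
      [&& #|A| == t, cut_connected (@adj d) A, ~~ tight A & v \in A]])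
      component_prob A.
Proof.
rewrite (bigID (@tight d)) /=; congr (_ + _).
  rewrite (bigID (fun A : {set vertex d} => #|A| == t)) /= [X in _ + X]big1 ?addr0; last first.
    by move=> A /andP[_ kA]; rewrite component_prob_eq0// (negPf kA).
  have := @card_tight_containing d v t.-1; rewrite prednK// => <-.
  rewrite mulr_natl -sumr_const; apply: eq_big => [A|A /andP[/andP[_ tA] /eqP kA]].
    by rewrite inE; case: (v \in A); case: (tight A); rewrite /= ?andbT ?andbF.
  exact: component_probE.
rewrite big_mkcond [RHS]big_mkcond; apply: eq_bigr => A _; rewrite inE.
case: (v \in A) => //=; last by rewrite !andbF.
case: (tight A) => /=; first by rewrite !andbF.
rewrite andbT; case: ifPn => // h; exact: component_prob_eq0.
Qed.

Lemma mu_lower : mu_main <= t%:R * mu_ p t d.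
Proof.
rewrite sum_component_prob_containing /mu_main -mulrA.
have -> : 2 ^+ d = #|{: vertex d}|%:R :> R by rewrite card_vertex natrX.
rewrite mulr_natl -sumr_const; apply: ler_sum => v _.
by rewrite sum_tight_containing lerDl sumr_ge0// => A _; exact: component_prob_ge0.
Qed.

(** The factor [(1 < t)%N%:R] removes the error term for [t = 1], where [t.-2] truncates to 0 and
    this term would be as large as the main one; single vertices are always tight. *)
Lemma mu_upper : (t <= d.+2)%N -> t%:R * mu_ p t d <=
  mu_main + (1 < t)%N%:R *
    (2 ^+ d * ('C(d, t.-2) * 2 ^ 2 ^ t.-2)%:R * (q ^+ (t * d) / q ^+ (t ^ 2))).
Proof.
move=> td; rewrite sum_component_prob_containing /mu_main.
have -> : 2 ^+ d = #|{: vertex d}|%:R :> R by rewrite card_vertex natrX.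
set M := (_ * _)%N%:R; set P := p ^+ _ * _; set K := (_ * _)%N%:R; set r := _ / _.
have -> : #|{: vertex d}|%:R * M * P + (1 < t)%N%:R * (#|{: vertex d}|%:R * K * r)
   = #|{: vertex d}|%:R * (M * P + (1 < t)%N%:R * (K * r)) by ring.
rewrite mulr_natl -sumr_const; apply: ler_sum => v _.
rewrite sum_tight_containing lerD2l.
set S := [set _ | _].
apply: (@le_trans _ _ (\sum_(A in S) q ^+ (t * d) / q ^+ (t ^ 2))).
  by apply: ler_sum => A _; exact: component_prob_le.
rewrite sumr_const -[leLHS]mulr_natl [leRHS]mulrA /K -natrM.
apply: ler_wpM2r; first exact: ratio_ge0.
rewrite ler_nat.
have [t1|] := ltnP 1 t; first by rewrite mul1n; exact: card_not_tight.
move=> t1; have t1E : t = 1%N by apply/eqP; rewrite eqn_leq t1 t_gt0.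
rewrite mul0n leqn0 cards_eq0; apply/eqP/setP => A; rewrite !inE.
apply/negP => /and4P[/eqP kA cA /negP ntA _]; apply: ntA.
have /cards1P[u ->] : #|A| == 1%N by rewrite kA t1E.
rewrite /tight span1 cards1 cards0 eqxx andbT.
apply/cut_connectedP => B; rewrite subset1 => /orP[] /eqP ->; by rewrite eqxx.
Qed.

End component_probability.

(** * Chernoff bound and normal limit of the Poisson distribution *)

Section poisson_tails.
Variable R : realType.
Implicit Types (m s x : R).

(** Follows from [1 - x <= expR (- x)], as [1 + x + 2 x^2] times [1 - x] equals
    [1 + x^2 (1 - 2 x)]. *)
Lemma expR_le_quadratic x : x <= 2^-1 -> expR x <= 1 + x + 2 * x ^+ 2.
Proof.
move=> x2; have x1 : 0 < 1 - x by lra.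
have h := expR_ge1Dx (- x).
have -> : expR x = (expR (- x))^-1 by rewrite expRN invrK.
apply: (@le_trans _ _ (1 - x)^-1); first by rewrite lef_pV2 ?posrE ?expR_gt0.
rewrite -[leLHS]mul1r ler_pdivrMr//; nra.
Qed.

(** Exponential tilting yields the Poisson weights of mean [m * expR th], whose partial sums are at
    most 1. *)
Lemma poisson_mgf m (N : nat) (th : R) : 0 < m ->
  \sum_(k < N) poisson_pmf m k * expR (th * k%:R) <= expR (m * (expR th - 1)).
Proof.
move=> m0; have m1 : 0 < m * expR th by rewrite mulr_gt0 ?expR_gt0.
have -> : \sum_(k < N) poisson_pmf m k * expR (th * k%:R)
    = expR (m * (expR th - 1)) * poisson_cdf (m * expR th) N.
  rewrite /poisson_cdf mulr_sumr; apply: eq_bigr => k _.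
  rewrite !poisson_pmfE// exprMn -expRM_natr mulrBr mulr1 expRD.
  rewrite [RHS](_ : _ = m ^+ k / k`!%:R * expR (- m) * expR (th * k%:R)
    * (expR (m * expR th) * expR (- (m * expR th)))); last by ring.
  by rewrite expRxMexpNx_1 mulr1.
by rewrite ler_piMr ?expR_ge0// poisson_cdf_le1.
Qed.

Lemma poisson_chernoff m s (N : nat) : 0 < m -> 0 <= s <= 2 * m ->
  \sum_(k < N | s <= `|k%:R - m|) poisson_pmf m k <= 2 * expR (- (s ^+ 2 / (8 * m))).
Proof.
(* This [th] minimises [2 * m * th ^+ 2 - th * s], and [s <= 2 * m] makes it at most 1/2, as
   [expR_le_quadratic] demands. The sign [sg] below distinguishes the two tails. *)
move=> m0 /andP[s0 sm]; pose th := s / (4 * m).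
have th0 : 0 <= th by rewrite divr_ge0// mulr_ge0// ltW.
have th2 : th <= 2^-1 by rewrite ler_pdivrMr ?mulr_gt0//; lra.
have thE : m * (2 * th ^+ 2) - th * s = - (s ^+ 2 / (8 * m)).
  by rewrite /th; field; rewrite gt_eqF.
have main (sg : R) : `|sg| = 1 ->
    \sum_(k < N) poisson_pmf m k * expR (sg * th * (k%:R - m) - th * s)
    <= expR (- (s ^+ 2 / (8 * m))).
  move=> sg1; have sg2 : sg ^+ 2 = 1 by rewrite -real_normK ?num_real// sg1 expr1n.
  have sgth : sg * th <= 2^-1.
    by apply: le_trans th2; rewrite (le_trans (ler_norm _))// normrM sg1 mul1r ger0_norm.
  have -> : \sum_(k < N) poisson_pmf m k * expR (sg * th * (k%:R - m) - th * s)
     = (\sum_(k < N) poisson_pmf m k * expR (sg * th * k%:R)) * expR (- (sg * th * m) - th * s).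
    rewrite mulr_suml; apply: eq_bigr => k _.
    by rewrite -[RHS]mulrA -expRD; congr (_ * expR _); ring.
  apply: (@le_trans _ _ (expR (m * (expR (sg * th) - 1)) * expR (- (sg * th * m) - th * s))).
    by apply: ler_wpM2r; [exact: expR_ge0|exact: poisson_mgf].
  rewrite -expRD ler_expR -thE.
  have := expR_le_quadratic sgth; rewrite exprMn sg2 mul1r.
  rewrite -(ler_pM2l m0) => h; lra.
apply: (@le_trans _ _ (\sum_(k < N) poisson_pmf m k *
    (expR (1 * th * (k%:R - m) - th * s) + expR (-1 * th * (k%:R - m) - th * s)))).
  rewrite big_mkcond; apply: ler_sum => k _; case: ifPn => [|_]; last first.
    by rewrite mulr_ge0 ?poisson_pmf_ge0// addr_ge0 ?expR_ge0.
  move=> sk; rewrite -[leLHS]mulr1; apply: ler_wpM2l; first exact: poisson_pmf_ge0.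
  have [km|km] := leP 0 (k%:R - m).
    rewrite -[leLHS]addr0; apply: lerD; last exact: expR_ge0.
    rewrite -[leLHS]expR0 ler_expR mul1r -mulrBr mulr_ge0// subr_ge0.
    by rewrite (ger0_norm km) in sk.
  rewrite -[leLHS]add0r; apply: lerD; first exact: expR_ge0.
  rewrite -[leLHS]expR0 ler_expR mulN1r mulNr -mulrN -mulrBr mulr_ge0// subr_ge0.
  by rewrite (ltr0_norm km) in sk.
under eq_bigr do rewrite mulrDr.
rewrite big_split /= mulr_natl mulr2n; apply: lerD; apply: main; rewrite ?normrN ?normr1//.
Qed.


(** The second-order Taylor remainder of [ln] at 1. Its derivative is explicit and nonnegative, so
    the mean value theorem gives both its sign and its size. *)
Let lnrem (w : R) := ln w - (w - 1) + (w - 1) ^+ 2 / 2.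

Let is_derive_lnrem (w : R) : 0 < w -> is_derive w 1 lnrem ((w - 1) ^+ 2 / w).
Proof.
move=> w0; have ? := is_derive1_ln w0.
by apply: is_derive_eq; rewrite /GRing.scale /=; field; rewrite gt_eqF.
Qed.

Let lnrem1 : lnrem 1 = 0.
Proof. by rewrite /lnrem ln1 !subrr expr0n mul0r addr0. Qed.

Let lnrem_within (a b : R) : 0 < a -> {within `[a, b], continuous lnrem}%classic.
Proof.
move=> a0; apply: derivable_within_continuous => x; rewrite in_itv /= => /andP[ax _].
by have ? := is_derive_lnrem (lt_le_trans a0 ax); exact: ex_derive.
Qed.

Lemma ln1D_le (u : R) : -1 < u <= 0 -> ln (1 + u) <= u - u ^+ 2 / 2.
Proof.
move=> /andP[u1 u0]; have u10 : 0 < 1 + u by lra.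
have [|||c] := @MVT_segment R lnrem (fun w => (w - 1) ^+ 2 / w) (1 + u) 1.
- by lra.
- by move=> x; rewrite in_itv /= => /andP[ux _]; apply: is_derive_lnrem; exact: lt_trans ux.
- exact: lnrem_within.
rewrite in_itv /= => /andP[uc c1]; rewrite lnrem1 sub0r /lnrem.
have -> : 1 + u - 1 = u by ring.
have : 0 <= (c - 1) ^+ 2 / c * (1 - (1 + u)).
  by rewrite mulr_ge0 ?divr_ge0 ?sqr_ge0//; lra.
lra.
Qed.

(** The intermediate point [c] satisfies [|c - 1| <= |u|] and [c >= 1/2], whence the constant 2. *)
Lemma ln1D_cubic (u : R) : `|u| <= 2^-1 -> `|ln (1 + u) - u + u ^+ 2 / 2| <= 2 * `|u| ^+ 3.
Proof.
move=> u2; have [u0|u0] := leP 0 u.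
  rewrite (ger0_norm u0) in u2 *.
  have [|||c] := @MVT_segment R lnrem (fun w => (w - 1) ^+ 2 / w) 1 (1 + u).
  - by lra.
  - by move=> x; rewrite in_itv /= => /andP[ux _]; apply: is_derive_lnrem; exact: lt_trans ux.
  - exact: lnrem_within.
  rewrite in_itv /= => /andP[c1 cu]; rewrite lnrem1 subr0 /lnrem.
  have -> : 1 + u - 1 = u by ring.
  move=> ->; rewrite ger0_norm; last by rewrite mulr_ge0// divr_ge0 ?sqr_ge0//; lra.
  rewrite [u ^+ 3]exprSr mulrA; apply: ler_wpM2r => //; rewrite ler_pdivrMr; last by lra.
  by nra.
rewrite (ltr0_norm u0) in u2 *.
have [|||c] := @MVT_segment R lnrem (fun w => (w - 1) ^+ 2 / w) (1 + u) 1.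
- by lra.
- by move=> x; rewrite in_itv /= => /andP[ux _]; apply: is_derive_lnrem; apply: lt_trans ux; lra.
- by apply: lnrem_within; lra.
rewrite in_itv /= => /andP[uc c1]; rewrite lnrem1 sub0r /lnrem.
have -> : 1 + u - 1 = u by ring.
move=> /(congr1 (fun z => `|z|)); rewrite normrN => ->.
rewrite ger0_norm; last by rewrite mulr_ge0 ?divr_ge0 ?sqr_ge0//; lra.
have -> : 1 - (1 + u) = - u by ring.
rewrite [(- u) ^+ 3]exprSr mulrA; apply: ler_wpM2r; first by lra.
by rewrite ler_pdivrMr; [nra|lra].
Qed.

(** With [w = 1 + u] this is [ln w <= (w - 1/w) / 2]. It replaces [ln1D_le], which is false for
    positive [u], and still provides exponential decay of the scaled density on the right. *)
Lemma ln1D_le_pos (u : R) : 0 <= u -> ln (1 + u) <= u - u ^+ 2 / (2 * (1 + u)).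
Proof.
move=> u0; pose f (w : R) := ln w - w / 2 + w^-1 / 2.
have df (w : R) : 0 < w -> is_derive w 1 f (- ((w - 1) ^+ 2 / (2 * w ^+ 2))).
  move=> w0; have ? := is_derive1_ln w0; have wn0 : w != 0 by rewrite gt_eqF.
  have ? := @is_deriveV _ id w 1 1 wn0 (is_derive_id _ _).
  by apply: is_derive_eq; rewrite /GRing.scale /=; field.
have [|||c] := @MVT_segment R f (fun w => - ((w - 1) ^+ 2 / (2 * w ^+ 2))) 1 (1 + u).
- by lra.
- by move=> x; rewrite in_itv /= => /andP[ux _]; apply: df; exact: lt_trans ux.
- apply: derivable_within_continuous => x; rewrite in_itv /= => /andP[ax _].
  by have ? := df x (lt_le_trans ltr01 ax); exact: ex_derive.
move=> _ fE.
have h : f (1 + u) - f 1 <= 0.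
  rewrite fE mulNr oppr_le0 mulr_ge0 ?divr_ge0 ?sqr_ge0//; last by lra.
  by rewrite mulr_ge0 ?sqr_ge0.
move: h; rewrite /f ln1 invr1.
have -> : u ^+ 2 / (2 * (1 + u)) = (1 + u) / 2 - 1 + (1 + u)^-1 / 2.
  by field; rewrite gt_eqF//; lra.
lra.
Qed.

End poisson_tails.

(** * Normal limit of the Poisson distribution through Gamma tails *)

Section poisson_normal.
Variable R : realType.
Implicit Types (n : nat) (l z y : R).
Local Notation mu := (@lebesgue_measure R).

(* As a function of its mean, the Poisson distribution function is a Gamma tail:
   its derivative is [- gamma_density n]. *)
Definition poisson_sum n l : R := \sum_(k < n.+1) l ^+ k / k`!%:R * expR (- l).

Definition gamma_density n l : R := l ^+ n / n`!%:R * expR (- l).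

(** The derivative of each summand is a difference of consecutive densities, so the sum
    telescopes. *)
Lemma is_derive_poisson_sum n l :
  is_derive l 1 (poisson_sum n) (- gamma_density n l).
Proof.
elim: n => [|n IH].
  rewrite (_ : poisson_sum 0 = fun l => expR (- l)); last first.
    by apply/funext => w; rewrite /poisson_sum big_ord1 expr0 fact0 divr1 mul1r.
  by apply: is_derive_eq; rewrite /gamma_density /GRing.scale /= fact0 expr0 divr1 mul1r mulrN1.
rewrite (_ : poisson_sum n.+1 =
    fun l => poisson_sum n l + l ^+ n.+1 / n.+1`!%:R * expR (- l)); last first.
  by apply/funext => w; rewrite /poisson_sum big_ord_recr.
have term (c : R) : is_derive l 1 (fun l => l ^+ n.+1 * c * expR (- l))
    (c * (n.+1%:R * l ^+ n - l ^+ n.+1) * expR (- l)).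
  have ? : is_derive l 1 (fun l : R => l ^+ n.+1) (n.+1%:R * l ^+ n).
    have -> : (fun l : R => l ^+ n.+1) = id ^+ n.+1 by rewrite exprfctE.
    by apply: is_derive_eq; rewrite /GRing.scale /= mulr1.
  by apply: is_derive_eq; rewrite /GRing.scale /=; ring.
have ? := term (n.+1`!%:R^-1).
apply: is_derive_eq; rewrite /gamma_density factS natrM.
have n0 : n`!%:R != 0 :> R by rewrite pnatr_eq0 -lt0n fact_gt0.
have n1 : n.+1%:R != 0 :> R by rewrite pnatr_eq0.
by field; rewrite n0 nat1r n1.
Qed.

Lemma poisson_sum_cdf n l : 0 < l -> poisson_sum n l = poisson_cdf l n.+1.
Proof. by move=> l0; apply: eq_bigr => k _; rewrite poisson_pmfE. Qed.

Lemma poisson_sum0 n : poisson_sum n 0 = 1.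
Proof.
rewrite /poisson_sum big_ord_recl big1 ?addr0.
  by rewrite expr0 fact0 divr1 mul1r oppr0 expR0.
by move=> i _; rewrite expr0n /= !mul0r.
Qed.

(** Half of the exponential decay makes the power into a Poisson probability of mean [l / 2], at
    most 1; the other half tends to 0. *)
Lemma cvg_poisson_sum n : (poisson_sum n l @[l --> +oo] --> (0 : R))%classic.
Proof.
pose K : R := \sum_(k < n.+1) 2 ^+ k.
have bnd l : 0 < l -> 0 <= poisson_sum n l <= K * expR (- (l / 2)).
  move=> l0; apply/andP; split.
    by rewrite poisson_sum_cdf// poisson_cdf_ge0.
  rewrite /K mulr_suml; apply: ler_sum => k _.
  have l2 : 0 < l / 2 by rewrite divr_gt0.
  have pm : poisson_pmf (l / 2) k <= 1.
    by apply: le_trans (poisson_cdf_le1 l2 k.+1); rewrite poisson_cdfS lerDr poisson_cdf_ge0.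
  move: pm; rewrite poisson_pmfE// => pm.
  have -> : l ^+ k / k`!%:R * expR (- l) =
      2 ^+ k * expR (- (l / 2)) * ((l / 2) ^+ k / k`!%:R * expR (- (l / 2))).
    have -> : expR (- l) = expR (- (l / 2)) * expR (- (l / 2)).
      by rewrite -expRD; congr expR; field.
    have -> : l ^+ k = 2 ^+ k * (l / 2) ^+ k by rewrite -exprMn; congr (_ ^+ _); field.
    by move: (_^-1) ((l / 2) ^+ k) => a b; ring.
  by rewrite ler_piMr// mulr_ge0 ?expR_ge0// exprn_ge0.
apply: (@squeeze_cvgr _ _ _ _ (fun=> 0) (fun l => K * expR (- (l / 2)))).
- by near=> l; apply: bnd; near: l; apply: nbhs_pinfty_gt; rewrite num_real.
- exact: cvg_cst.
- have : (K * expR (- (l / 2)) @[l --> +oo] --> K * 0)%classic; last by rewrite mulr0.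
  apply: cvgMr; apply: (cvg_comp (fun l : R => l / 2) (fun l => expR (- l))); last exact: cvgr_expR.
  by apply: gt0_cvgMly => //; exact: cvg_id.
Unshelve. all: by end_near. Qed.

(** The mean is standardised around the count [n], rather than the count around the mean. *)
Definition center_scale n z : R := n%:R + Num.sqrt n%:R * z.

Lemma is_derive_center_scale n z :
  is_derive z 1 (fun z => poisson_sum n (center_scale n z))
    (- (Num.sqrt n%:R * gamma_density n (center_scale n z))).
Proof.
have ? := is_derive_poisson_sum n (center_scale n z).
have ? : is_derive z 1 (center_scale n) (Num.sqrt n%:R).
  by apply: is_derive_eq; rewrite /GRing.scale /=; ring.
apply: (@is_derive_eq _ _ _ (poisson_sum n \o center_scale n)).
by rewrite /GRing.scale /=; ring.
Qed.

Lemma continuous_gamma_density n : continuous (gamma_density n).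
Proof.
move=> l; apply: cvgM; first by apply: cvgMl; exact: exprn_continuous.
by apply: continuous_comp; [exact: opp_continuous|exact: continuous_expR].
Qed.

Lemma continuous_center_scale n : continuous (center_scale n).
Proof.
by move=> z; apply: cvgD; [exact: cvg_cst|apply: cvgMr; exact: cvg_id].
Qed.

Lemma gamma_density_ge0 n l : 0 <= l -> 0 <= gamma_density n l.
Proof. by move=> l0; rewrite mulr_ge0 ?expR_ge0// divr_ge0 ?exprn_ge0. Qed.

Lemma integral_gamma_density n y : (0 < n)%N -> 0 <= center_scale n y ->
  (\int[mu]_(z in `[y, +oo[) (Num.sqrt n%:R * gamma_density n (center_scale n z))%:E
   = (poisson_sum n (center_scale n y))%:E)%E.
Proof.
move=> n0 y0; pose F z := - poisson_sum n (center_scale n z).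
have dF z : is_derive z 1 F (Num.sqrt n%:R * gamma_density n (center_scale n z)).
  have ? := is_derive_center_scale n z.
  by apply: is_derive_eq; rewrite opprK.
rewrite (@ge0_continuous_FTC2y R _ F y 0).
- by rewrite -EFinB sub0r opprK.
- move=> z yz; rewrite mulr_ge0// gamma_density_ge0// (le_trans y0)//.
  by rewrite lerD2l ler_wpM2l.
- apply: continuous_subspaceT => z; apply: cvgMr.
  apply: (continuous_comp (@continuous_center_scale n z)).
  exact: continuous_gamma_density.
- have : (F z @[z --> +oo] --> - (0 : R))%classic; last by rewrite oppr0.
  apply: cvgN.
  apply: (cvg_comp (center_scale n) (poisson_sum n)); last exact: cvg_poisson_sum.
  apply: (cvg_comp (fun z => Num.sqrt n%:R * z) (fun z => n%:R + z)).
    by apply: gt0_cvgMry; [rewrite sqrtr_gt0 ltr0n|exact: cvg_id].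
  exact: cvg_addrl.
- by move=> z _; have ? := dF z; exact: ex_derive.
- have ? := dF y; apply: cvg_at_right_filter.
  by apply/differentiable_continuous/derivable1_diffP; exact: ex_derive.
- by move=> z _; rewrite derive1E; have ? := dF z; exact: derive_val.
Qed.


(** For [n > 0], the Gamma density at [center_scale n z] divided by its value at [z = 0]. Factoring
    out the peak leaves a function whose limit needs no estimate of the factorial. *)
Definition scaled_density n z : R := expR (- (Num.sqrt n%:R * z)) * (1 + z / Num.sqrt n%:R) ^+ n.

Definition density_peak n : R := Num.sqrt n%:R * gamma_density n n%:R.

Let sqrt_gt0 n : 0 < Num.sqrt n.+1%:R :> R.
Proof. by rewrite sqrtr_gt0 ltr0n. Qed.

Let sqr_sqrt n : Num.sqrt n%:R ^+ 2 = n%:R :> R.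
Proof. by rewrite sqr_sqrtr. Qed.

Lemma gamma_density_scaled n z :
  Num.sqrt n.+1%:R * gamma_density n.+1 (center_scale n.+1 z)
  = density_peak n.+1 * scaled_density n.+1 z.
Proof.
have s0 : Num.sqrt n.+1%:R != 0 :> R by rewrite gt_eqF.
rewrite /density_peak /gamma_density /scaled_density /center_scale.
have -> : n.+1%:R + Num.sqrt n.+1%:R * z = n.+1%:R * (1 + z / Num.sqrt n.+1%:R).
  move: (sqr_sqrt n.+1) (sqrt_gt0 n); set s := Num.sqrt _; move=> <- s_gt0.
  by field; rewrite ?gt_eqF.
rewrite exprMn.
have -> : expR (- (n.+1%:R * (1 + z / Num.sqrt n.+1%:R)))
    = expR (- n.+1%:R) * expR (- (Num.sqrt n.+1%:R * z)).
  rewrite -expRD; congr expR.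
  move: (sqr_sqrt n.+1) (sqrt_gt0 n); set s := Num.sqrt _; move=> <- s_gt0.
  by field; rewrite ?gt_eqF.
by ring.
Qed.

Let scaled_densityE n z : - Num.sqrt n.+1%:R < z ->
  scaled_density n.+1 z = expR (n.+1%:R * (ln (1 + z / Num.sqrt n.+1%:R) - z / Num.sqrt n.+1%:R)).
Proof.
move=> zn; have u1 : 0 < 1 + z / Num.sqrt n.+1%:R.
  by rewrite -ltrBlDl sub0r ltr_pdivlMr// mulN1r.
rewrite /scaled_density -[X in X ^+ _](lnK (_ : _ \is Num.pos)) ?posrE//.
rewrite -expRM_natl -expRD; congr expR.
have -> : Num.sqrt n.+1%:R * z = n.+1%:R * (z / Num.sqrt n.+1%:R).
  move: (sqr_sqrt n.+1) (sqrt_gt0 n); set s := Num.sqrt _; move=> <- s_gt0.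
  by field; rewrite ?gt_eqF.
by ring.
Qed.

Lemma scaled_density_ge0 n z : - Num.sqrt n.+1%:R <= z -> 0 <= scaled_density n.+1 z.
Proof.
move=> zn; rewrite mulr_ge0 ?expR_ge0// exprn_ge0//.
by rewrite -lerBlDl sub0r ler_pdivlMr// mulN1r.
Qed.

Lemma scaled_density_le n z : - Num.sqrt n.+1%:R <= z ->
  scaled_density n.+1 z <= expR ((1 - `|z|) / 2).
Proof.
rewrite le_eqVlt => /orP[/eqP <-|zn].
  rewrite /scaled_density mulNr divff ?gt_eqF// subrr expr0n /= mulr0.
  exact: expR_ge0.
rewrite scaled_densityE// ler_expR.
set u := z / _; have u1 : -1 < u by rewrite /u ltr_pdivlMr// mulN1r.
have n0 : 0 < n.+1%:R :> R by rewrite ltr0n.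
have zu : n.+1%:R * u ^+ 2 = z ^+ 2.
  rewrite /u.
  move: (sqr_sqrt n.+1) (sqrt_gt0 n); set s := Num.sqrt _; move=> <- s_gt0.
  by field; rewrite ?gt_eqF.
have [z0|z0] := leP 0 z; last first.
  have u0 : u <= 0 by rewrite /u pmulr_lle0 ?invr_gt0// ltW.
  have := @ln1D_le R u; rewrite u1 u0 => /(_ isT).
  rewrite -(ler_pM2l n0) => h.
  have hh : n.+1%:R * (ln (1 + u) - u) <= - (z ^+ 2 / 2).
    by rewrite -zu; lra.
  by apply: le_trans hh _; rewrite ltr0_norm//; nra.
have u0 : 0 <= u by rewrite /u divr_ge0// ltW.
have uz : u <= z.
  have : Num.sqrt 1 <= Num.sqrt n.+1%:R :> R by rewrite ler_wsqrtr// ler1n.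
  by rewrite sqrtr1 => s1; rewrite /u ler_pdivrMr// ler_peMr.
have := ln1D_le_pos u0; rewrite -(ler_pM2l n0) => h.
have u10 : 0 < 2 * (1 + u) by lra.
have hh : n.+1%:R * (ln (1 + u) - u) <= - (z ^+ 2 / (2 * (1 + u))).
  by rewrite -zu -mulrA; lra.
apply: le_trans hh _; rewrite ger0_norm// lerNl.
rewrite ler_pdivlMr//; nra.
Qed.

Lemma cvg_invr_sqrt : ((Num.sqrt n.+1%:R)^-1 @[n --> \oo] --> (0 : R))%classic.
Proof.
rewrite -(@sqrtr0 R); under eq_fun do rewrite -sqrtrV//.
apply: (cvg_comp (fun n => n.+1%:R^-1) (@Num.sqrt R)); first exact: cvg_harmonic.
exact: sqrt_continuous.
Qed.

(** With [u = z / sqrt n], the exponent [n (ln (1 + u) - u)] is [- z^2 / 2] up to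
    [2 |z|^3 / sqrt n], by [ln1D_cubic]. *)
Lemma cvg_scaled_density z :
  (scaled_density n.+1 z @[n --> \oo] --> expR (- (z ^+ 2 / 2)))%classic.
Proof.
have zs : (z / Num.sqrt n.+1%:R @[n --> \oo] --> z * 0)%classic.
  by apply: cvgMr; exact: cvg_invr_sqrt.
rewrite mulr0 in zs.
have zsmall : (\forall n \near \oo, `|z / Num.sqrt n.+1%:R| <= 2^-1)%classic.
  by have /cvgr0Pnorm_le/(_ 2^-1) := zs; apply.
pose e n : R := n.+1%:R * (ln (1 + z / Num.sqrt n.+1%:R) - z / Num.sqrt n.+1%:R).
have ecvg : (e n @[n --> \oo] --> - (z ^+ 2 / 2))%classic.
  have b0 : (2 * `|z| ^+ 3 * (Num.sqrt n.+1%:R)^-1 @[n --> \oo] --> 2 * `|z| ^+ 3 * 0)%classic.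
    by apply: cvgMr; exact: cvg_invr_sqrt.
  rewrite mulr0 in b0.
  have lo := cvgB (cvg_cst (- (z ^+ 2 / 2))) b0.
  have hi := cvgD (cvg_cst (- (z ^+ 2 / 2))) b0.
  rewrite subr0 in lo; rewrite addr0 in hi.
  apply: (@squeeze_cvgr _ _ _ _
    (fun n => - (z ^+ 2 / 2) - 2 * `|z| ^+ 3 * (Num.sqrt n.+1%:R)^-1)
    (fun n => - (z ^+ 2 / 2) + 2 * `|z| ^+ 3 * (Num.sqrt n.+1%:R)^-1)); last 2 first.
  - exact: lo.
  - exact: hi.
  near=> n.
  have us : `|z / Num.sqrt n.+1%:R| <= 2^-1 by near: n.
  have := ln1D_cubic us; set u := z / _ => h.
  have n0 : 0 < n.+1%:R :> R by rewrite ltr0n.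
  have zu : n.+1%:R * u ^+ 2 = z ^+ 2.
    rewrite /u.
    move: (sqr_sqrt n.+1) (sqrt_gt0 n); set s := Num.sqrt _; move=> <- s_gt0.
    by field; rewrite ?gt_eqF.
  have nu : n.+1%:R * `|u| ^+ 3 = `|z| ^+ 3 * (Num.sqrt n.+1%:R)^-1.
    rewrite /u normrM (ger0_norm (x := _^-1)) ?invr_ge0//.
    move: (sqr_sqrt n.+1) (sqrt_gt0 n); set s := Num.sqrt _; move=> <- s_gt0.
    by field; rewrite ?gt_eqF.
  have : `|e n + z ^+ 2 / 2| <= 2 * `|z| ^+ 3 * (Num.sqrt n.+1%:R)^-1.
    rewrite -mulrA -nu /e -/u -zu.
    have -> : n.+1%:R * (ln (1 + u) - u) + n.+1%:R * u ^+ 2 / 2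
       = n.+1%:R * (ln (1 + u) - u + u ^+ 2 / 2) by ring.
    by rewrite normrM (ger0_norm (ltW n0)) mulrCA ler_pM2l.
  by rewrite ler_norml => /andP[? ?]; apply/andP; split; rewrite /=; lra.
apply: (@cvg_trans _ (expR (e n) @[n --> \oo])%classic).
  apply: near_eq_cvg; near=> n; rewrite scaled_densityE//.
  have us : `|z / Num.sqrt n.+1%:R| <= 2^-1 by near: n.
  have : - 2^-1 <= z / Num.sqrt n.+1%:R by move: us; rewrite ler_norml => /andP[].
  rewrite ler_pdivlMr// => h; apply: lt_le_trans h.
  by rewrite mulNr ltrN2 mulrC gtr_pMr// invf_lt1// ltr1n.
by apply: continuous_cvg => //; exact: continuous_expR.
Unshelve. all: by end_near. Qed.


Let dominating z : R := expR ((1 - `|z|) / 2).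

Let continuous_dominating : continuous dominating.
Proof.
move=> z; apply: (continuous_comp (f := fun z => (1 - `|z|) / 2)); last exact: continuous_expR.
by apply: cvgMl; apply: cvgB; [exact: cvg_cst|exact: norm_continuous].
Qed.

Let integrable_dominating : mu.-integrable [set: R]%classic (EFin \o dominating).
Proof.
apply/integrableP; split.
  by apply/measurable_EFinP; exact: continuous_measurable_fun.
under eq_integral => z _ do rewrite /= ger0_norm ?expR_ge0//.
rewrite ge0_symfun_integralT//=; last 2 first.
- by move=> z; exact: expR_ge0.
- by move=> z; rewrite /dominating /= normrN.
rewrite (_ : [set x | 0 <= x]%classic = `[0, +oo[%classic); last first.
  by apply/seteqP; split => x/=; rewrite in_itv/= andbT.
pose F z : R := - 2 * expR ((1 - z) / 2).
have dF z : is_derive z 1 F (expR ((1 - z) / 2)).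
  by apply: is_derive_eq; rewrite /GRing.scale /=; field.
have -> : (\int[mu]_(z in `[0%R, +oo[) (dominating z)%:E
    = \int[mu]_(z in `[0%R, +oo[) (expR ((1 - z) / 2))%:E)%E.
  apply: eq_integral.
  by move=> z; rewrite in_setE /= in_itv /= andbT => z0; rewrite /dominating ger0_norm.
rewrite (@ge0_continuous_FTC2y R _ F 0 0).
- by rewrite -EFinB -EFinM ltry.
- by move=> z _; exact: expR_ge0.
- apply: continuous_subspaceT => z.
  apply: (continuous_comp (f := fun z => (1 - z) / 2)); last exact: continuous_expR.
  by apply: cvgMl; apply: cvgB; [exact: cvg_cst|exact: cvg_id].
- have : (F z @[z --> +oo] --> - 2 * (0 : R))%classic; last by rewrite mulr0.
  apply: cvgMr.
  have E : (fun z : R => expR ((1 - z) / 2)) =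
      (fun z => expR (- z)) \o (fun z => - 2^-1 + 2^-1 * z).
    by apply/funext => z /=; congr expR; field.
  rewrite E; apply: (cvg_comp (fun z : R => - 2^-1 + 2^-1 * z) (fun z => expR (- z)));
    last exact: cvgr_expR.
  apply: (cvg_comp (fun z => 2^-1 * z) (fun z => - 2^-1 + z)).
    by apply: gt0_cvgMry; [rewrite invr_gt0|exact: cvg_id].
  exact: cvg_addrl.
- by move=> z _; have ? := dF z; exact: ex_derive.
- have ? := dF 0; apply: cvg_at_right_filter.
  by apply/differentiable_continuous/derivable1_diffP; exact: ex_derive.
- by move=> z _; rewrite derive1E; have ? := dF z; exact: derive_val.
Qed.

Let continuous_scaled_density n : continuous (scaled_density n).
Proof.
move=> z; apply: cvgM.
  apply: (continuous_comp (f := fun z => - (Num.sqrt n%:R * z))); last exact: continuous_expR.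
  by apply: cvgN; apply: cvgMr; exact: cvg_id.
apply: (@continuous_comp _ _ _ (fun z => 1 + z / Num.sqrt n%:R) (fun w => w ^+ n));
  last exact: exprn_continuous.
by apply: cvgD; [exact: cvg_cst|apply: cvgMl; exact: cvg_id].
Qed.


(** The range of [z] on which the mean [center_scale n.+1 z] is nonnegative. *)
Let right_half n : set R := `[- Num.sqrt n.+1%:R, +oo[%classic.

Let right_halfE n z : right_half n z = (- Num.sqrt n.+1%:R <= z) :> Prop.
Proof. by rewrite /right_half /= in_itv /= andbT. Qed.

(** Used for the whole line, which fixes the limit of the peak, and for a half-line, which gives the
    distribution function. *)
Lemma cvg_integral_scaled_density (D : set R) : measurable D ->
  (\int[mu]_(z in D `&` right_half n) (scaled_density n.+1 z)%:E @[n --> \oo]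
   --> \int[mu]_(z in D) (normal_fun (0 : R) 1 z)%:E)%E%classic.
Proof.
move=> mD.
pose f_ n z : \bar R := ((scaled_density n.+1 z)%:E * (\1_(right_half n) z)%:E)%E.
have mf n : measurable_fun D (f_ n).
  apply: emeasurable_funM; apply/measurable_EFinP; apply: measurable_funTS.
    exact: continuous_measurable_fun.
  by apply: measurable_indic; exact: measurable_itv.
have fE n z : f_ n z = (if - Num.sqrt n.+1%:R <= z then scaled_density n.+1 z else 0)%:E.
  rewrite /f_ indicE -EFinM; congr EFin.
  case: ifPn => h; first by rewrite mem_set ?mulr1// right_halfE.
  by rewrite memNset ?mulr0// right_halfE; exact/negP.
have [] := @dominated_convergence _ _ R mu D mD f_
  (fun z => (normal_fun (0 : R) 1 z)%:E) (EFin \o dominating).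
- exact: mf.
- by apply/measurable_EFinP; apply: measurable_funTS; exact: measurable_normal_fun.
- apply: aeW => z _ /=.
  apply: (@cvg_trans _ ((scaled_density n.+1 z)%:E @[n --> \oo])%classic).
    apply: near_eq_cvg; near=> n; rewrite fE ifT//.
    have h : `|z| <= Num.sqrt n.+1%:R.
      have := sqrt_gt0 n; rewrite -[leRHS]mulr1 => s0.
      have : `|z / Num.sqrt n.+1%:R| <= 1.
        near: n.
        have zs : (z / Num.sqrt n.+1%:R @[n --> \oo] --> z * 0)%classic.
          by apply: cvgMr; exact: cvg_invr_sqrt.
        by rewrite mulr0 in zs; have /cvgr0Pnorm_le/(_ 1) := zs; apply.
      by rewrite normrM normfV (gtr0_norm s0) ler_pdivrMr// mul1r mulr1.
    by move: h; rewrite ler_norml => /andP[].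
  apply: cvg_EFin; first by near=> n.
  rewrite /normal_fun subr0 expr1n.
  have -> : - z ^+ 2 / (1 *+ 2) = - (z ^+ 2 / 2) by rewrite mulNr.
  exact: cvg_scaled_density.
- by apply: integrableS integrable_dominating.
- apply: aeW => z n _; rewrite (fE n z) /= lee_fin; case: ifPn => h.
    by rewrite ger0_norm ?scaled_density_le// scaled_density_ge0.
  by rewrite normr0 expR_ge0.
move=> _ _; apply: cvg_trans; apply: near_eq_cvg; near=> n.
rewrite integral_mkcondr; apply: eq_integral => z _.
rewrite fE /patch /=.
case: ifPn => h; first by rewrite mem_set // right_halfE.
by rewrite memNset // right_halfE; exact/negP.
Unshelve. all: by end_near. Qed.


Let density_peak_gt0 n : 0 < density_peak n.+1.
Proof.
by rewrite /density_peak /gamma_density !mulr_gt0 ?expR_gt0 ?exprn_gt0 ?ltr0n.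
Qed.

Lemma integral_scaled_density n y : - Num.sqrt n.+1%:R <= y ->
  (\int[mu]_(z in `[y, +oo[) (scaled_density n.+1 z)%:E
   = (poisson_sum n.+1 (center_scale n.+1 y) / density_peak n.+1)%:E)%E.
Proof.
move=> ny.
have y0 : 0 <= center_scale n.+1 y.
  have := ler_wpM2l (ltW (sqrt_gt0 n)) ny.
  by rewrite mulrN -expr2 sqr_sqrt /center_scale; lra.
have := integral_gamma_density (ltn0Sn n) y0.
under eq_integral do rewrite gamma_density_scaled EFinM.
rewrite ge0_integralZl_EFin//; last 3 first.
- move=> z /=; rewrite in_itv /= andbT => yz; rewrite lee_fin.
  by apply: scaled_density_ge0; apply: le_trans yz.
- by apply/measurable_EFinP; apply: measurable_funTS; exact: continuous_measurable_fun.
- exact/ltW.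
move=> h; rewrite mulrC EFinM -h muleA -EFinM mulVf ?mul1e// gt_eqF//.
Qed.

Lemma integral_normal_pdf_fun (D : set R) : measurable D ->
  (\int[mu]_(z in D) (normal_pdf (0 : R) 1 z)%:E
   = (normal_peak (1 : R))%:E * \int[mu]_(z in D) (normal_fun (0 : R) 1 z)%:E)%E.
Proof.
move=> mD; rewrite -ge0_integralZl_EFin//; last 3 first.
- by move=> z _; rewrite lee_fin normal_fun_ge0.
- by apply/measurable_EFinP; apply: measurable_funTS; exact: measurable_normal_fun.
- exact: normal_peak_ge0.
by apply: eq_integral => z _; rewrite normal_pdfE ?oner_eq0// EFinM.
Qed.

Let normal_peak_neq0 : normal_peak (1 : R) != 0.
Proof. by rewrite gt_eqF// normal_peak_gt0// oner_eq0. Qed.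

Lemma integral_normal_fun_fin (D : set R) : measurable D ->
  (\int[mu]_(z in D) (normal_fun (0 : R) 1 z)%:E
   = (fine (normal_prob (0 : R) 1 D) / normal_peak 1)%:E)%E.
Proof.
move=> mD; have := integral_normal_pdf_fun mD.
rewrite -/(normal_prob 0 1 D) => h.
have fD : normal_prob (0 : R) 1 D \is a fin_num.
  by rewrite fin_num_measure.
by rewrite mulrC EFinM fineK// h muleA -EFinM mulVf// mul1e.
Qed.

(** At the left end of [right_half n] the mean is 0 and [poisson_sum] is 1, so the full integral of
    the scaled density is the inverse of the peak; its limit is known because the normal law has
    mass 1. *)
Lemma cvg_density_peak : (density_peak n.+1 @[n --> \oo] --> normal_peak (1 : R))%classic.
Proof.
have := @cvg_integral_scaled_density [set: R]%classic measurableT.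
rewrite (integral_normal_fun_fin measurableT) probability_setT /= mul1r.
have cs0 n : center_scale n.+1 (- Num.sqrt n.+1%:R) = 0.
  by rewrite /center_scale mulrN -expr2 sqr_sqrt subrr.
under eq_fun do rewrite classical_sets.setTI integral_scaled_density// cs0 poisson_sum0.
move=> /fine_cvgP[_ /= h].
have : ((1 / density_peak n.+1)^-1 @[n --> \oo] --> ((normal_peak (1 : R))^-1)^-1)%classic.
  by apply: cvgV => //; rewrite invr_eq0.
by rewrite invrK; under eq_fun do rewrite div1r invrK.
Qed.

Lemma std_normal_fun_right (x : R) :
  std_normal_fun x = fine (normal_prob (0 : R) 1 `[- x, +oo[%classic).
Proof.
rewrite /std_normal_fun /normal_prob; congr fine.
rewrite -[x in LHS]opprK ge0_integration_by_substitutionNy.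
- by apply: eq_integral => z _; rewrite /= !normal_pdfE ?oner_eq0// /normal_fun !subr0 sqrrN.
- by apply: continuous_subspaceT; apply: continuous_normal_pdf; rewrite oner_eq0.
- by move=> z _; exact: normal_pdf_ge0.
Qed.

Let sqrt_large (a : R) : (\forall n \near \oo, a <= Num.sqrt n%:R)%classic.
Proof.
near=> n; apply: (@le_trans _ _ `|a|); first exact: ler_norm.
rewrite -sqrtr_sqr ler_wsqrtr//; near: n; exact: nbhs_infty_ger.
Unshelve. all: by end_near. Qed.

Lemma cvg_poisson_sum_normal (x : R) :
  (poisson_sum n (center_scale n (- x)) @[n --> \oo] --> std_normal_fun x)%classic.
Proof.
rewrite -cvg_shiftS.
have mD : measurable (`[- x, +oo[ : set R) by exact: measurable_itv.
have := cvg_integral_scaled_density mD.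
rewrite (integral_normal_fun_fin mD) -std_normal_fun_right => h.
have {}h : ((poisson_sum n.+1 (center_scale n.+1 (- x)) / density_peak n.+1)%:E @[n --> \oo]
   --> (std_normal_fun x / normal_peak 1)%:E)%classic.
  apply: cvg_trans h; apply: near_eq_cvg; near=> n.
  have nx : - Num.sqrt n.+1%:R <= - x.
    rewrite lerN2; near: n; apply: filterS (sqrt_large x) => n h.
    by apply: le_trans h _; rewrite ler_wsqrtr// ler_nat.
  rewrite -integral_scaled_density//; congr integral.
  apply/classical_sets.setIidl => z /=; rewrite right_halfE in_itv /= andbT; exact: le_trans.
move/fine_cvgP: h => [_ /= h].
have hh : (poisson_sum n.+1 (center_scale n.+1 (- x)) / density_peak n.+1 * density_peak n.+1
    @[n --> \oo] --> std_normal_fun x / normal_peak 1 * normal_peak 1)%classic.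
  by apply: cvgM; [exact: h|exact: cvg_density_peak].
rewrite divfK// in hh.
apply: cvg_trans hh; apply: near_eq_cvg; near=> n.
by rewrite /= divfK// gt_eqF.
Unshelve. all: by end_near. Qed.

(** Mean value theorem, with the derivative bounded through [scaled_density_le]. As the peaks
    converge, this is uniform in [n] and allows [- x] to be replaced by a sequence that tends to
    it. *)
Lemma poisson_sum_lipschitz n y y' : - Num.sqrt n.+1%:R <= y -> - Num.sqrt n.+1%:R <= y' ->
  `|poisson_sum n.+1 (center_scale n.+1 y) - poisson_sum n.+1 (center_scale n.+1 y')|
  <= density_peak n.+1 * expR 2^-1 * `|y - y'|.
Proof.
wlog yy' : y y' / y <= y'.
  move=> h ny ny'; have [yy'|/ltW yy'] := leP y y'; first exact: h.
  by rewrite distrC [in leRHS]distrC; exact: h.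
move=> ny ny'.
have dF z := is_derive_center_scale n.+1 z.
have [|c] := @MVT_segment R (fun z => poisson_sum n.+1 (center_scale n.+1 z)) _ y y' yy'
    (fun z _ => dF z).
  apply: derivable_within_continuous => z _; have ? := dF z; exact: ex_derive.
rewrite in_itv /= => /andP[yc _]; rewrite distrC => ->.
rewrite normrM normrN gamma_density_scaled normrM (gtr0_norm (density_peak_gt0 n)).
rewrite [`|y - y'|]distrC; apply: ler_wpM2r => //; rewrite ler_pM2l//.
have nc := le_trans ny yc.
rewrite ger0_norm ?scaled_density_ge0// (le_trans (scaled_density_le nc))//.
by rewrite ler_expR; have := normr_ge0 c; lra.
Qed.

Lemma poisson_cdf_normal (m : nat -> R) (N : nat -> nat) (x : R) :
  (\forall d \near \oo, 0 < m d)%classic -> (N d @[d --> \oo] --> \oo)%classic ->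
  ((m d - (N d)%:R) / Num.sqrt (N d)%:R @[d --> \oo] --> - x)%classic ->
  (poisson_cdf (m d) (N d).+1 @[d --> \oo] --> std_normal_fun x)%classic.
Proof.
move=> m0 Noo yx.
have lim : (poisson_sum (N d) (center_scale (N d) (- x)) @[d --> \oo] --> std_normal_fun x)%classic.
  exact: (cvg_comp N (fun n => poisson_sum n (center_scale n (- x))) Noo
    (@cvg_poisson_sum_normal x)).
have Npos : (\forall d \near \oo, (0 < N d)%N)%classic.
  exact: (Noo _ (nbhs_infty_gt 0%N)).
have pk : (density_peak (N d) * expR 2^-1 * `|(m d - (N d)%:R) / Num.sqrt (N d)%:R - (- x)|
   @[d --> \oo] --> (0 : R))%classic.
  have pk0 : (density_peak n @[n --> \oo] --> normal_peak (1 : R))%classic.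
    by rewrite -cvg_shiftS; exact: cvg_density_peak.
  have pk1 := cvg_comp N density_peak Noo pk0.
  have : (density_peak (N d) * expR 2^-1 * `|(m d - (N d)%:R) / Num.sqrt (N d)%:R - (- x)|
   @[d --> \oo] --> normal_peak (1 : R) * expR 2^-1 * `|- x - (- x)|)%classic.
    apply: cvgM; first by apply: cvgMl; exact: pk1.
    by apply: cvg_norm; apply: cvgB => //; exact: cvg_cst.
  by rewrite subrr normr0 mulr0.
have dif : (poisson_cdf (m d) (N d).+1 - poisson_sum (N d) (center_scale (N d) (- x))
   @[d --> \oo] --> (0 : R))%classic.
  apply/cvgr0Pnorm_le => e e0.
  have xN : (\forall d \near \oo, - Num.sqrt (N d)%:R <= - x)%classic.
    have h : (\forall d \near \oo, x <= Num.sqrt (N d)%:R)%classic.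
      exact: (Noo _ (sqrt_large x)).
    by apply: filterS h => d; rewrite lerN2.
  move/cvgr0Pnorm_le/(_ e e0): pk => pk; near=> d.
  have md : 0 < m d by near: d.
  have Nd : (0 < N d)%N by near: d.
  have s0 : 0 < Num.sqrt (N d)%:R :> R by rewrite sqrtr_gt0 ltr0n.
  have mE : m d = center_scale (N d) ((m d - (N d)%:R) / Num.sqrt (N d)%:R).
    by rewrite /center_scale; field; rewrite gt_eqF.
  rewrite -poisson_sum_cdf// {1}mE.
  have : `|density_peak (N d) * expR 2^-1 * `|(m d - (N d)%:R) / Num.sqrt (N d)%:R - (- x)| | <= e.
    by near: d.
  apply: le_trans; rewrite [leRHS]ger0_norm; last first.
    by rewrite -(prednK Nd) !mulr_ge0 ?expR_ge0// ltW.
  rewrite -(prednK Nd); apply: poisson_sum_lipschitz; rewrite (prednK Nd).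
    rewrite ler_pdivlMr// mulNr -expr2 sqr_sqrt; lra.
  by near: d.
have : (poisson_cdf (m d) (N d).+1 - poisson_sum (N d) (center_scale (N d) (- x))
    + poisson_sum (N d) (center_scale (N d) (- x)) @[d --> \oo] --> 0 + std_normal_fun x)%classic.
  by apply: cvgD; [exact: dif|exact: lim].
by rewrite add0r; under eq_fun do rewrite subrK.
Unshelve. all: by end_near. Qed.

End poisson_normal.

(** * Asymptotics *)

(** Division-free form of the lower bound [(1 - k^2/d) d^k], which suits induction on [k] and holds
    also when [d < k^2]. *)
Lemma ffact_lower (R : realType) (d k : nat) : (k <= d)%N ->
  d%:R ^+ k * (d%:R - k%:R ^+ 2) <= d%:R * (d ^_ k)%:R :> R.
Proof.
elim: k => [|k IH] kd; first by rewrite expr0 ffactn0 mul1r mulr1 expr0n subr0.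
rewrite ffactnSr natrM natrB; last exact: ltnW.
have dk0 : 0 <= d%:R - k%:R :> R by rewrite subr_ge0 ler_nat ltnW.
have d0 : 0 <= d%:R :> R by [].
rewrite mulrA; apply: le_trans (ler_wpM2r dk0 (IH (ltnW kd))).
rewrite exprS -!mulrA mulrCA; apply: ler_wpM2l; first exact: exprn_ge0.
have k0 : 0 <= k%:R :> R by [].
by rewrite -(natr1 k); nra.
Qed.

Lemma ffact_upper (R : realType) (d k : nat) : (d ^_ k)%:R <= d%:R ^+ k :> R.
Proof.
elim: k => [|k IH]; first by rewrite ffactn0 expr0.
rewrite ffactnSr natrM exprSr ler_pM// ler_nat; exact: leq_subr.
Qed.

Lemma bin_bounds (R : realType) (d k : nat) : (0 < d)%N -> (k <= d)%N ->
  d%:R ^+ k / k`!%:R * (1 - k%:R ^+ 2 / d%:R) <= ('C(d, k)%:R : R) <= d%:R ^+ k / k`!%:R.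
Proof.
move=> d0 kd; have f0 : 0 < k`!%:R :> R by rewrite ltr0n fact_gt0.
have dr : 0 < d%:R :> R by rewrite ltr0n.
have E : (d ^_ k)%:R = 'C(d, k)%:R * k`!%:R :> R by rewrite -natrM bin_ffact.
apply/andP; split.
  have -> : d%:R ^+ k / k`!%:R * (1 - k%:R ^+ 2 / d%:R)
      = d%:R ^+ k * (d%:R - k%:R ^+ 2) / (d%:R * k`!%:R) :> R.
    by field; rewrite !gt_eqF.
  rewrite ler_pdivrMr ?mulr_gt0// mulrCA -E; exact: ffact_lower.
by rewrite ler_pdivlMr// -E ffact_upper.
Qed.

Lemma bin_le_exp (d k : nat) : ('C(d, k) <= d ^ k)%N.
Proof.
apply: (@leq_trans (d ^_ k)); first by rewrite -bin_ffact leq_pmulr ?fact_gt0.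
elim: k => [|k IH]; first by rewrite ffactn0 expn0.
by rewrite ffactnSr expnSr leq_mul// leq_subr.
Qed.

Section asymptotics_of_the_mean.
Variables (R : realType) (p : R) (t : nat).
Hypotheses (p_gt0 : 0 < p) (p_lt_half : p < 2^-1) (t_gt0 : (0 < t)%N).
Local Notation q := (1 - p).

Let p_lt1 : p < 1. Proof. by move: p_lt_half; lra. Qed.
Let q_gt0 : 0 < q. Proof. by move: p_lt_half; lra. Qed.
Let q_lt1 : q < 1. Proof. by move: p_gt0; lra. Qed.

Definition mean_asymptotic (d : nat) : R :=
  t%:R ^ (t%:Z - 2) / t`!%:R * (p / q ^+ 2) ^+ (t - 1) * d%:R ^+ (t - 1) * (2 * q ^+ t) ^+ d.

(** The common factor of [mu_main] and [t * mean_asymptotic], which then differ only by a binomial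
    coefficient against [d^(t-1) / (t-1)!]. *)
Let B (d : nat) : R := 2 ^+ d * q ^+ (t * d) * (p / q ^+ 2) ^+ t.-1 * (t ^ t.-2)%:R.

Let mean_asymptoticE d : t%:R * mean_asymptotic d = B d * (d%:R ^+ t.-1 / t.-1`!%:R).
Proof.
rewrite /mean_asymptotic /B subn1 [(2 * _) ^+ d]exprMn -exprM.
have -> : t%:R ^ (t%:Z - 2) = (t ^ t.-2)%:R :> R.
  case: t t_gt0 => [//|[|s]] _; first by rewrite exp1rz.
  by rewrite -addn2 PoszD addrK natrX addn2.
have -> : t`!%:R = t%:R * t.-1`!%:R :> R by rewrite -natrM -{1}(prednK t_gt0) factS prednK.
by field; rewrite !pnatr_eq0 -!lt0n fact_gt0 t_gt0.
Qed.

Let mu_mainE d : (2 * t.-1 <= t * d)%N -> mu_main p d t = B d * 'C(d, t.-1)%:R.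
Proof.
move=> td; rewrite /mu_main /B natrM expr_div_n -exprM.
have -> : q ^+ (t * d - 2 * t.-1) = q ^+ (t * d) / q ^+ (2 * t.-1).
  by rewrite exprB ?unitfE ?gt_eqF.
by field; rewrite !expf_neq0// gt_eqF.
Qed.

Let B_gt0 d : 0 < B d.
Proof.
by rewrite /B !mulr_gt0 ?exprn_gt0 ?divr_gt0 ?ltr0n ?expn_gt0 ?t_gt0// exprn_gt0.
Qed.

Lemma mean_asymptotic_gt0 d : (0 < d)%N -> 0 < mean_asymptotic d.
Proof.
move=> d0; have t0 : 0 < t%:R :> R by rewrite ltr0n.
rewrite -(pmulr_rgt0 _ t0) mean_asymptoticE mulr_gt0// divr_gt0 ?ltr0n ?fact_gt0//.
by rewrite exprn_gt0// ltr0n.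
Qed.

Lemma mu_asymptotic : exists2 C : R, 0 < C & forall d : nat, (t <= d)%N ->
  `|mu_ p t d - mean_asymptotic d| <= C / d%:R * mean_asymptotic d.
Proof.
pose K := (2 ^ 2 ^ t.-2)%:R / (q ^+ (t ^ 2) * ((p / q ^+ 2) ^+ t.-1 * (t ^ t.-2)%:R)) : R.
have K0 : 0 < K.
  rewrite divr_gt0 ?ltr0n ?expn_gt0// !mulr_gt0 ?exprn_gt0 ?divr_gt0 ?ltr0n ?expn_gt0 ?t_gt0//.
  by rewrite exprn_gt0.
exists (t%:R ^+ 2 + K * t.-1`!%:R).
  apply: addr_gt0; first by apply: exprn_gt0; rewrite ltr0n.
  by apply: mulr_gt0 => //; rewrite ltr0n fact_gt0.
move=> d td; have d0 : (0 < d)%N := leq_trans t_gt0 td.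
have dr : 0 < d%:R :> R by rewrite ltr0n.
have t0 : 0 < t%:R :> R by rewrite ltr0n.
have f0 : 0 < t.-1`!%:R :> R by rewrite ltr0n fact_gt0.
have td1 : (t.-1 <= d)%N by rewrite (leq_trans (leq_pred _)).
have td2 : (2 * t.-1 <= t * d)%N.
  have h (s : nat) : (2 * s <= s.+1 * s.+1)%N by clear; nia.
  by rewrite (leq_trans (h t.-1))// prednK// leq_mul2l td orbT.
have td3 : (t <= d.+2)%N by rewrite (leq_trans td)// -addn2 leq_addr.
have lo := mu_lower d p_gt0 p_lt1 t_gt0; have up := mu_upper p_gt0 p_lt1 t_gt0 td3.
rewrite (mu_mainE td2) in lo up.
have /andP[bl bu] := @bin_bounds R d t.-1 d0 td1.
have a0 := mean_asymptotic_gt0 d0.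
rewrite -(ler_pM2l t0) -{1}(gtr0_norm t0) -normrM mulrBr [leRHS]mulrCA mean_asymptoticE.
set M := d%:R ^+ t.-1 / t.-1`!%:R in bl bu *.
have M0 : 0 < M by rewrite divr_gt0// exprn_gt0.
have KE0 : 0 <= K * t.-1`!%:R / d%:R.
  by apply: divr_ge0; [apply: mulr_ge0; exact: ltW|exact: ltW].
have BM0 : 0 <= B d * M by apply: mulr_ge0; exact: ltW.
have lo' : B d * (M * (1 - t%:R ^+ 2 / d%:R)) <= t%:R * mu_ p t d.
  apply: le_trans lo; rewrite ler_pM2l//; apply: le_trans bl; rewrite ler_pM2l//.
  rewrite lerD2l lerN2 ler_pM2r ?invr_gt0// -!natrX ler_nat leq_exp2r//; exact: leq_pred.
have up' : t%:R * mu_ p t d <= B d * (M * (1 + K * t.-1`!%:R / d%:R)).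
  apply: le_trans up _; rewrite mulrDr mulr1 mulrDr; apply: lerD; first by rewrite ler_pM2l.
  have [t1|t1] := ltnP 1 t; last first.
    by rewrite mul0r mulrA; exact: mulr_ge0 BM0 KE0.
  rewrite mul1r.
  have -> : B d * (M * (K * t.-1`!%:R / d%:R)) =
      2 ^+ d * (d%:R ^+ t.-2 * (2 ^ 2 ^ t.-2)%:R) * (q ^+ (t * d) / q ^+ (t ^ 2)).
    have -> : M = d%:R * d%:R ^+ t.-2 / t.-1`!%:R.
      by rewrite /M -exprS prednK// -ltnS prednK.
    rewrite /B /K; set r := (p / q ^+ 2) ^+ _.
    have r0 : 0 < r by rewrite exprn_gt0// divr_gt0// exprn_gt0.
    have tt : 0 < (t ^ t.-2)%:R :> R by rewrite ltr0n expn_gt0 t_gt0.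
    by field; rewrite !gt_eqF// ?exprn_gt0.
  apply: ler_wpM2r; first by rewrite divr_ge0// exprn_ge0// ltW.
  apply: ler_wpM2l; first exact: exprn_ge0.
  by rewrite natrM ler_wpM2r// -natrX ler_nat bin_le_exp.
set C := _ + _; rewrite ler_norml; apply/andP; split.
  rewrite lerBrDr; apply: le_trans lo'; rewrite /C.
  have -> : - ((t%:R ^+ 2 + K * t.-1`!%:R) / d%:R * (B d * M)) + B d * M =
     B d * (M * (1 - t%:R ^+ 2 / d%:R)) - (K * t.-1`!%:R / d%:R * (B d * M)) by ring.
  by rewrite gerBl; exact: mulr_ge0 KE0 BM0.
rewrite lerBlDr; apply: le_trans up' _; rewrite /C.
have -> : (t%:R ^+ 2 + K * t.-1`!%:R) / d%:R * (B d * M) + B d * M =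
   B d * (M * (1 + K * t.-1`!%:R / d%:R)) + (t%:R ^+ 2 / d%:R * (B d * M)) by ring.
by rewrite lerDl; apply: mulr_ge0 BM0; apply: divr_ge0; [apply: exprn_ge0|]; exact: ltW.
Qed.

Lemma error_bound_le : exists2 C : R, 0 < C & forall d : nat, (0 < d)%N ->
  error_bound p d t <= C * (d%:R ^+ t * q ^+ (t * d)).
Proof.
pose N := (t * 2 * 2 ^ 2 ^ t.-1).+1.
exists (N%:R * ((q ^+ (t ^ 2))^-1 + (q ^+ (2 * t ^ 2))^-1)).
  by rewrite mulr_gt0 ?ltr0n// addr_gt0// invr_gt0 exprn_gt0.
move=> d d0; rewrite /error_bound -mulrDr.
have -> : N%:R * ((q ^+ (t ^ 2))^-1 + (q ^+ (2 * t ^ 2))^-1) * (d%:R ^+ t * q ^+ (t * d))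
  = N%:R * d%:R ^+ t * (q ^+ (t * d) * ((q ^+ (t ^ 2))^-1 + (q ^+ (2 * t ^ 2))^-1)) by ring.
apply: ler_wpM2r.
  apply: mulr_ge0; first by apply: exprn_ge0; exact: ltW.
  by apply: addr_ge0; rewrite invr_ge0; apply: exprn_ge0; exact: ltW.
rewrite -natrX -natrM ler_nat /near_bound /N mulSn.
have : ('C(d, t.-1) <= d ^ t.-1)%N := bin_le_exp _ _.
have : (0 < d ^ t)%N by rewrite expn_gt0 d0.
have -> : (d ^ t = d * d ^ t.-1)%N by rewrite -expnS prednK.
move: (d ^ t.-1)%N ('C(d, t.-1)) (2 ^ 2 ^ t.-1)%N => a c e dpos ca.
rewrite -add1n leq_add//.
apply: (@leq_trans (t * (2 * d) * (a * e))); last by rewrite eq_leq//; ring.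
by rewrite !leq_mul// mul2n -addnn -addn1 leq_add2l.
Qed.

End asymptotics_of_the_mean.

Lemma eqO_near (R : realType) (f e : nat -> R) (C : R) : 0 < C ->
  (\forall d \near \oo, `|f d| <= C * e d)%classic -> (f =O_\oo e)%classic.
Proof.
move=> C0 h; apply/eqO_exP; exists C => //; apply: filterS h => d /le_trans -> //.
by rewrite ler_pM2l// ler_norm.
Qed.

Lemma one_plus_bigO_near (R : realType) (f g e : nat -> R) (C : R) : 0 < C ->
  (\forall d \near \oo, 0 < g d /\ `|f d - g d| <= C * e d * g d)%classic ->
  one_plus_bigO f g e.
Proof.
move=> C0 h; exists (fun d => (f d - g d) / g d).
  apply: (eqO_near C0); apply: filterS h => d [g0].
  by rewrite normrM normfV (gtr0_norm g0) ler_pdivrMr.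
by apply: filterS h => d [g0 _]; field; rewrite gt_eqF.
Qed.

Lemma exp_poly_bound (R : realType) (k : nat) (x : R) : 0 <= x -> x ^+ k <= k`!%:R * expR x.
Proof.
move=> x0; have f0 : 0 < k`!%:R :> R by rewrite ltr0n fact_gt0.
case: k f0 => [|k] f0; first by rewrite expr0 fact0 mul1r -expR0 ler_expR.
rewrite mulrC -ler_pdivrMr//; apply: le_trans (expR_ge1Dxn k x0).
by rewrite lerDr.
Qed.

Lemma cvg_expRN (R : realType) (c : R) : 0 < c ->
  (expR (- (c * d%:R)) @[d --> \oo] --> (0 : R))%classic.
Proof.
move=> c0; have h : (c * d%:R @[d --> \oo] --> +oo)%classic.
  apply: (cvg_comp (fun d : nat => d%:R) (fun x => c * x) (@cvgr_idn R)).
  by apply: gt0_cvgMry => //; exact: cvg_id.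
exact: (cvg_comp (fun d : nat => c * d%:R) (fun x => expR (- x)) h (@cvgr_expR R)).
Qed.

(** * Mean, variance, total variation and concentration *)

Section component_counts.
Variables (R : realType) (p : R) (t : nat).
Hypotheses (p_gt0 : 0 < p) (p_lt_half : p < 2^-1) (t_gt0 : (0 < t)%N) (t_le_m : t%:Z <= m_ p).
Local Notation q := (1 - p).
Local Notation mu := (mu_ p t).

Let p_lt1 : p < 1. Proof. by move: p_lt_half; lra. Qed.
Let q_gt0 : 0 < q. Proof. by move: p_lt_half; lra. Qed.
Let q_lt1 : q < 1. Proof. by move: p_gt0; lra. Qed.

(** The bound [t <= m_ p] enters the proof here: it says that [t] times the binary logarithm of
    [1 / q] is at most 1. *)
Lemma two_mul_q_expn : 1 <= 2 * q ^+ t.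
Proof.
have lnq : 0 < ln (1 / q) by rewrite ln_gt0// div1r invf_gt1.
have l2 : 0 < ln 2 :> R by rewrite ln_gt0// ltr1n.
have : t%:R <= 1 / log2 (1 / q).
  by have := t_le_m; rewrite /m_ floor_ge_int.
rewrite /log2 ler_pdivlMr ?divr_gt0// mulrA ler_pdivrMr// !mul1r.
rewrite lnV ?posrE// mulrN => h.
have -> : q ^+ t = expR (t%:R * ln q) by rewrite expRM_natl lnK ?posrE.
rewrite -{1}(@lnK R 2) ?posrE// -expRD -{1}expR0 ler_expR; lra.
Qed.

Lemma very_high_probW (pr pr' : nat -> R) : (\forall d \near \oo, pr d <= pr' d)%classic ->
  very_high_prob pr -> very_high_prob pr'.
Proof.
move=> h [c c0 hc]; exists c => //; near=> d; apply: (@le_trans _ _ (pr d)); by near: d.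
Unshelve. all: by end_near. Qed.

(** [N] exceeds every value of [comp_count], so the law of the count has all of its mass below
    [N]. *)
Lemma law_vs_poisson (d N : nat) (B : pred nat) : (t <= d.+1)%N -> 0 < mu d ->
  (#|{set vertex d}| < N)%N ->
  `|prob (@Qp R p d) [pred G | B (comp_count t G)] - \sum_(k < N | B k) poisson_pmf (mu d) k|
  <= 2 * error_bound p d t.
Proof.
move=> td mu0 dN.
have -> : prob (@Qp R p d) [pred G | B (comp_count t G)]
    = \sum_(k < N | B k) nat_law (@Qp R p d) (@comp_count d t) k.
  rewrite /nat_law /prob (exchange_big_dep (fun G => B (comp_count t G)))/=; last first.
    by move=> k G Bk /eqP ->.
  apply: eq_bigr => G BG.
  have cN : (comp_count t G < N)%N by rewrite (leq_ltn_trans (max_card _) dN).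
  rewrite (bigD1 (Ordinal cN)) ?BG ?eqxx//= big1 ?addr0// => k /andP[/andP[_ /eqP kE] kN].
  by case/eqP: kN; apply: val_inj; rewrite /= kE.
rewrite -sumrB; apply: le_trans (ler_norm_sum _ _ _) _.
apply: le_trans (comp_count_poisson p_gt0 p_lt1 t_gt0 N td mu0).
by rewrite big_mkcond; apply: ler_sum => k _; case: ifP.
Qed.

Lemma dTV_poisson (d : nat) : (t <= d.+1)%N -> 0 < mu d ->
  0 <= dTV (nat_law (@Qp R p d) (@comp_count d t)) (poisson_pmf (mu d)) <= error_bound p d t.
Proof.
move=> td mu0; rewrite /dTV; set u := (fun k => _).
have bnd n : series u n <= 2 * error_bound p d t.
  rewrite /series /= big_mkord; exact: comp_count_poisson.
have nd : nondecreasing_seq (series u).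
  by apply: nondecreasing_series => n _ _; exact: normr_ge0.
have cu : cvgn (series u).
  apply: nondecreasing_is_cvgn => //; exists (2 * error_bound p d t) => _ [n _ <-]; exact: bnd.
have l0 : 0 <= limn (series u).
  apply: limr_ge => //; near=> n; rewrite /series /= sumr_ge0// => i _; exact: normr_ge0.
rewrite mulr_ge0//= mulrC ler_pdivrMr// mulrC; apply: limr_le => //.
by near=> n; exact: bnd.
Unshelve. all: by end_near. Qed.

(** Half of the decay rate [a] of [q ^+ (t * d)] absorbs the factor [d ^ t], by [exp_poly_bound]. *)
Lemma error_bound_exp : exists2 b : R, 0 < b & exists2 K : R, 0 < K &
  forall d : nat, (0 < d)%N -> error_bound p d t <= K * expR (- (b * d%:R)).
Proof.
pose a := - ln (q ^+ t); have a0 : 0 < a.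
  rewrite oppr_gt0 ln_lt0// exprn_gt0//=.
  by rewrite exprn_ilt1// ?ltW// -lt0n.
have [C C0 hC] := error_bound_le p_lt_half t_gt0.
exists (a / 2); first by rewrite divr_gt0.
have a2 : 0 < a / 2 by rewrite divr_gt0.
exists (C * (t`!%:R / (a / 2) ^+ t)).
  by rewrite mulr_gt0// divr_gt0 ?ltr0n ?fact_gt0// exprn_gt0.
move=> d d0; apply: le_trans (hC d d0) _; rewrite -mulrA ler_pM2l//.
have -> : q ^+ (t * d) = expR (- (a / 2 * d%:R)) * expR (- (a / 2 * d%:R)).
  rewrite -expRD exprM -[q ^+ t]lnK ?posrE ?exprn_gt0// -expRM_natl; congr expR.
  by rewrite /a; field.
rewrite mulrA; apply: ler_wpM2r; first exact: expR_ge0.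
have := @exp_poly_bound R t (a / 2 * d%:R) (mulr_ge0 (ltW a2) (ler0n _ _)).
rewrite exprMn => h.
rewrite expRN ler_pdivrMr ?expR_gt0// mulrAC ler_pdivlMr ?exprn_gt0//.
by rewrite mulrC.
Qed.

Lemma bernoulli_inequality (a : R) (n : nat) : 0 <= a -> n%:R * a <= (1 + a) ^+ n.
Proof.
move=> a0; suff : 1 + n%:R * a <= (1 + a) ^+ n by apply: le_trans; rewrite lerDr.
elim: n => [|n IH]; first by rewrite mul0r addr0 expr0.
rewrite exprS; apply: le_trans (ler_wpM2l _ IH); last by rewrite addr_ge0.
have n0 : 0 <= n%:R :> R by [].
by rewrite -(natr1 n); nra.
Qed.

(** For [t > 1] the factor [d^(t-1)] suffices, as [2 q^t >= 1]. For [t = 1] this factor is absent,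
    but [p < 1/2] makes [2 q > 1] strict and Bernoulli's inequality applies. *)
Lemma mean_asymptotic_linear : exists2 c : R, 0 < c &
  forall d : nat, (0 < d)%N -> c * d%:R <= mean_asymptotic p t d.
Proof.
have q2 := two_mul_q_expn.
have [t1|t1] := ltnP 1 t; last first.
  have tE : t = 1%N by apply/eqP; rewrite eqn_leq t1 t_gt0.
  exists (2 * q - 1); first by move: p_lt_half; lra.
  move=> d d0; rewrite /mean_asymptotic tE exp1rz (_ : 1`! = 1%N)// divr1 subnn !expr0 !mul1r expr1.
  have -> : 2 * q = 1 + (2 * q - 1) by ring.
  rewrite [leLHS]mulrC (_ : 1 + (2 * q - 1) - 1 = 2 * q - 1); last by ring.
  by apply: bernoulli_inequality; move: p_lt_half; lra.
have t0 : 0 < t%:R :> R by rewrite ltr0n.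
pose c : R := t%:R ^ (t%:Z - 2) / t`!%:R * (p / q ^+ 2) ^+ (t - 1).
have c0 : 0 < c.
  by rewrite !mulr_gt0 ?exprz_gt0 ?invr_gt0 ?ltr0n ?fact_gt0// exprn_gt0// divr_gt0// exprn_gt0.
exists c => // d d0; have d1 : 1 <= d%:R :> R by rewrite ler1n.
rewrite /mean_asymptotic -/c -mulrA ler_pM2l// -[leLHS]mulr1.
apply: ler_pM => //; last exact: exprn_ege1.
by rewrite -[leLHS]expr1 ler_weXn2l// subn_gt0.
Qed.

Lemma mu_linear : exists2 c : R, 0 < c & (\forall d \near \oo, c * d%:R <= mu d)%classic.
Proof.
have [c c0 hc] := mean_asymptotic_linear.
have [C C0 hC] := mu_asymptotic p_gt0 p_lt_half t_gt0.
exists (c / 2); first by rewrite divr_gt0.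
near=> d.
have td : (t <= d)%N by near: d; exact: nbhs_infty_ge.
have d0 : (0 < d)%N := leq_trans t_gt0 td.
have dr : 0 < d%:R :> R by rewrite ltr0n.
have Cd : C * 2 <= d%:R by near: d; exact: nbhs_infty_ger.
have := hC d td; have := hc d d0; set M := mean_asymptotic p t d => hM.
have C2 : C / d%:R <= 2^-1 by rewrite ler_pdivrMr// mulrC ler_pdivlMr.
have M0 : 0 < M by exact: mean_asymptotic_gt0.
have : C / d%:R * M <= 2^-1 * M by rewrite ler_pM2r.
move=> h1; rewrite ler_norml => /andP[h2 _].
by rewrite mulrAC; lra.
Unshelve. all: by end_near. Qed.

Lemma mu_gt0_near : (\forall d \near \oo, 0 < mu d)%classic.
Proof.
have [c c0 hc] := mu_linear; near=> d.
apply: (@lt_le_trans _ _ (c * d%:R)); last by near: d.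
by rewrite mulr_gt0// ltr0n; near: d; exact: nbhs_infty_gt.
Unshelve. all: by end_near. Qed.

Lemma mu_expansion : one_plus_bigO mu (mean_asymptotic p t) (fun d => d%:R^-1).
Proof.
have [C C0 hC] := mu_asymptotic p_gt0 p_lt_half t_gt0.
apply: (one_plus_bigO_near C0); near=> d.
have td : (t <= d)%N by near: d; exact: nbhs_infty_ge.
split; last exact: hC.
by apply: mean_asymptotic_gt0 => //; exact: leq_trans t_gt0 td.
Unshelve. all: by end_near. Qed.

Lemma Var_expansion : one_plus_bigO (Var_ p t) mu (fun d => d%:R ^+ t * q ^+ (t * d)).
Proof.
have [C C0 hC] := error_bound_le p_lt_half t_gt0.
apply: (one_plus_bigO_near C0); near=> d.
have mu0 : 0 < mu d by near: d; exact: mu_gt0_near.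
have td : (t <= d)%N by near: d; exact: nbhs_infty_ge.
split => //; apply: le_trans (Var_mu p_gt0 p_lt1 t_gt0 (leqW td)) _.
by rewrite mulrC ler_pM2r// hC// (leq_trans t_gt0 td).
Unshelve. all: by end_near. Qed.

Lemma dTV_expansion :
  ((fun d => dTV (nat_law (@Qp R p d) (@comp_count d t)) (poisson_pmf (mu d))) =O_\oo
  (fun d => d%:R ^+ t * q ^+ (t * d)))%classic.
Proof.
have [C C0 hC] := error_bound_le p_lt_half t_gt0.
apply: (eqO_near C0); near=> d.
have mu0 : 0 < mu d by near: d; exact: mu_gt0_near.
have td : (t <= d)%N by near: d; exact: nbhs_infty_ge.
have /andP[v0 v1] := dTV_poisson (leqW td) mu0.
by rewrite ger0_norm// (le_trans v1)// hC// (leq_trans t_gt0 td).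
Unshelve. all: by end_near. Qed.

Lemma prob_le (T : finType) (P : T -> R) (A A' : pred T) : (forall w, 0 <= P w) ->
  (forall w, A w -> A' w) -> prob P A <= prob P A'.
Proof.
move=> P0 AA; rewrite !prob_expectation; apply: le_expectation => // w.
by rewrite ler_nat; have := AA w; case: (A w) => // ->.
Qed.

Lemma probC (T : finType) (P : T -> R) (A : pred T) : \sum_w P w = 1 ->
  prob P A = 1 - prob P (predC A).
Proof. by move=> P1; rewrite /prob -P1 [in RHS](bigID A) /= addrK. Qed.

Lemma concentration_sqrt (eps : R) : 0 < eps ->
  very_high_prob (fun d =>
    prob (@Qp R p d) [pred G | `|X_ R t G - mu d| < eps * Num.sqrt (d%:R * mu d)]).
Proof.
have [c c0 hc] := mu_linear.
(* Decreasing [eps] strengthens the claim; together with [c * d <= mu] this bound gives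
   [s <= 2 * mu], the range of [poisson_chernoff]. *)
wlog eps_le : eps / eps ^+ 2 <= 4 * c.
  move=> h e0; have [e4|e4] := leP (eps ^+ 2) (4 * c); first exact: h.
  have s0 : 0 < Num.sqrt (4 * c) by rewrite sqrtr_gt0 mulr_gt0.
  have sE : Num.sqrt (4 * c) ^+ 2 = 4 * c by rewrite sqr_sqrtr// mulr_ge0// ltW.
  have se : Num.sqrt (4 * c) <= eps.
    by rewrite -(@ler_pXn2r _ 2)// ?nnegrE ?(ltW s0) ?(ltW e0)// sE ltW.
  apply: very_high_probW (h _ _ s0); last by rewrite sE.
  near=> d; apply: prob_le => [G|G /=]; first exact: Qp_ge0.
  by move=> /lt_le_trans; apply; apply: ler_wpM2r => //; exact: sqrtr_ge0.
move=> e0.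
have [b b0 [K K0 hK]] := error_bound_exp.
(* The smaller of the rates of the Chernoff bound and of the total variation error; half of it is
   given up to absorb the constant [2 * K + 2]. *)
pose a := Num.min (eps ^+ 2 / 8) b.
have a0 : 0 < a by rewrite lt_min b0 divr_gt0// exprn_gt0.
exists (a / 2); first by rewrite divr_gt0.
have a2 : 0 < a / 2 by rewrite divr_gt0.
have K2 : 0 < 2 * K + 2 by rewrite addr_gt0// mulr_gt0.
near=> d.
have mu0 : 0 < mu d by near: d; exact: mu_gt0_near.
have td : (t <= d)%N by near: d; exact: nbhs_infty_ge.
have d0 : (0 < d)%N := leq_trans t_gt0 td.
have dr : 0 < d%:R :> R by rewrite ltr0n.
have cd : c * d%:R <= mu d by near: d.
rewrite (probC _ (Qp_sum1 p d)) lerD2l lerN2.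
set s := eps * _.
have s0 : 0 <= s by rewrite mulr_ge0 ?sqrtr_ge0// ltW.
have s2 : s ^+ 2 = eps ^+ 2 * (d%:R * mu d).
  by rewrite /s exprMn sqr_sqrtr// mulr_ge0// ltW.
have sm : s <= 2 * mu d.
  have m2 : 0 <= 2 * mu d by rewrite mulr_ge0// ltW.
  rewrite -(@ler_pXn2r _ 2)// s2 exprMn.
  have : eps ^+ 2 * d%:R <= 4 * mu d.
    apply: le_trans (ler_wpM2r (ltW dr) eps_le) _.
    by rewrite -mulrA ler_pM2l.
  move=> /(ler_wpM2r (ltW mu0)) h; rewrite mulrA; apply: le_trans h _.
  by rewrite le_eqVlt; apply/orP; left; apply/eqP; ring.
pose B (k : nat) := s <= `|k%:R - mu d|.
have := @law_vs_poisson d #|{set vertex d}|.+1 B (leqW td) mu0 (ltnSn _).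
rewrite ler_norml => /andP[_]; rewrite lerBlDr => hB.
have -> : prob (@Qp R p d) (predC [pred G | `|X_ R t G - mu d| < s])
   = prob (@Qp R p d) [pred G | B (comp_count t G)].
  by apply: eq_bigl => G; rewrite /= -leNgt.
apply: le_trans hB _.
apply: (@le_trans _ _ ((2 * K + 2) * (expR (- (a / 2 * d%:R)) * expR (- (a / 2 * d%:R))))).
  have -> : expR (- (a / 2 * d%:R)) * expR (- (a / 2 * d%:R)) = expR (- (a * d%:R)).
    by rewrite -expRD; congr expR; field.
  rewrite [leRHS]mulrDl; apply: lerD.
    rewrite -mulrA ler_pM2l//; apply: le_trans (hK d d0) _.
    by rewrite ler_pM2l// ler_expR lerN2 ler_pM2r// ge_min lexx orbT.
  apply: le_trans (poisson_chernoff _ mu0 _) _; first by rewrite s0 sm.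
  rewrite ler_pM2l// ler_expR lerN2 s2.
  have -> : eps ^+ 2 * (d%:R * mu d) / (8 * mu d) = eps ^+ 2 / 8 * d%:R.
    by field; rewrite gt_eqF.
  by rewrite ler_pM2r// ge_min lexx.
rewrite mulrA ler_piMl ?expR_ge0//.
rewrite mulrC -ler_pdivlMr// div1r.
have -> : expR (- (a / 2 * d%:R)) = `|expR (- (a / 2 * d%:R))| by rewrite ger0_norm// expR_ge0.
near: d; have /cvgr0Pnorm_le := cvg_expRN a2; apply.
by rewrite invr_gt0.
Unshelve. all: by end_near. Qed.

Lemma concentration_linear (eps : R) : 0 < eps ->
  very_high_prob (fun d => prob (@Qp R p d) [pred G | `|X_ R t G - mu d| < eps * mu d]).
Proof.
move=> e0; have [c c0 hc] := mu_linear.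
have s0 : 0 < Num.sqrt c by rewrite sqrtr_gt0.
apply: very_high_probW (concentration_sqrt (mulr_gt0 e0 s0)); near=> d.
have mu0 : 0 < mu d by near: d; exact: mu_gt0_near.
have cd : c * d%:R <= mu d by near: d.
apply: prob_le => [G|G /=]; first exact: Qp_ge0.
move=> /lt_le_trans; apply; rewrite -mulrA ler_pM2l// -sqrtrM ?(ltW c0)//.
rewrite -[leRHS]ger0_norm ?(ltW mu0)// -sqrtr_sqr ler_wsqrtr//.
by rewrite mulrA expr2 ler_pM2r.
Unshelve. all: by end_near. Qed.

End component_counts.

(** * Asymptotic normality of the component count *)

Section normal_limit.
Variables (R : realType) (p : R) (t : nat).
Hypotheses (p_gt0 : 0 < p) (p_lt_half : p < 2^-1) (t_gt0 : (0 < t)%N) (t_le_m : t%:Z <= m_ p).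
Local Notation mu := (mu_ p t).
Local Notation Var := (Var_ p t).

Let p_lt1 : p < 1. Proof. by move: p_lt_half; lra. Qed.

Let mu_gt0 : (\forall d \near \oo, 0 < mu d)%classic.
Proof. exact: mu_gt0_near. Qed.

Lemma cvg_error_bound : (error_bound p d t @[d --> \oo] --> (0 : R))%classic.
Proof.
have [b b0 [K K0 hK]] := error_bound_exp p_gt0 p_lt_half t_gt0.
have h : (K * expR (- (b * d%:R)) @[d --> \oo] --> K * 0)%classic.
  by apply: cvgMr; exact: cvg_expRN.
rewrite mulr0 in h.
apply: (@squeeze_cvgr _ _ _ _ (fun=> 0) (fun d : nat => K * expR (- (b * d%:R)))) => //;
  last exact: cvg_cst.
near=> d; have d0 : (0 < d)%N by near: d; exact: nbhs_infty_gt.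
rewrite hK// andbT /error_bound; have q0 : 0 <= 1 - p by move: p_lt1; lra.
by apply: mulr_ge0 => //; apply: addr_ge0; apply: divr_ge0; exact: exprn_ge0.
Unshelve. all: by end_near. Qed.

Lemma cvg_mu : (mu d @[d --> \oo] --> +oo)%classic.
Proof.
have [c c0 hc] := mu_linear p_gt0 p_lt_half t_gt0 t_le_m.
apply: (ger_cvgy hc).
apply: (cvg_comp (fun d : nat => d%:R) (fun x => c * x) (@cvgr_idn R)).
by apply: gt0_cvgMry => //; exact: cvg_id.
Qed.

Lemma cvg_Var_mu : (Var d / mu d @[d --> \oo] --> (1 : R))%classic.
Proof.
apply/subr_cvg0; apply: norm_cvg0.
apply: (@squeeze_cvgr _ _ _ _ (fun=> 0) (fun d => error_bound p d t)); last 2 first.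
- exact: cvg_cst.
- exact: cvg_error_bound.
near=> d; have mu0 : 0 < mu d by near: d; exact: mu_gt0.
have td : (t <= d)%N by near: d; exact: nbhs_infty_ge.
rewrite normr_ge0/=.
have -> : Var d / mu d - 1 = (Var d - mu d) / mu d by field; rewrite gt_eqF.
rewrite normrM normfV (gtr0_norm mu0) ler_pdivrMr// mulrC.
exact: Var_mu p_gt0 p_lt1 t_gt0 (leqW td).
Unshelve. all: by end_near. Qed.

Let std_ratio d : R := Num.sqrt (Var d / mu d).
Let inv_sqrt_mu d : R := Num.sqrt (mu d)^-1.

Let cvg_std_ratio : (std_ratio d @[d --> \oo] --> (1 : R))%classic.
Proof.
have : (std_ratio d @[d --> \oo] --> Num.sqrt (1 : R))%classic; last by rewrite sqrtr1.
exact: (cvg_comp (fun d => Var d / mu d) (@Num.sqrt R) cvg_Var_mu (@sqrt_continuous R 1)).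
Qed.

Let cvg_inv_sqrt_mu : (inv_sqrt_mu d @[d --> \oo] --> (0 : R))%classic.
Proof.
have : (inv_sqrt_mu d @[d --> \oo] --> Num.sqrt (0 : R))%classic; last by rewrite sqrtr0.
apply: (cvg_comp (fun d => (mu d)^-1) (@Num.sqrt R) _ (@sqrt_continuous R 0)).
by apply/(gtr0_cvgV0 mu_gt0); exact: cvg_mu.
Qed.

(** The threshold for the count that corresponds to [X_star <= x]. Its rounding error, [remainder]
    below, is at most 1 and hence negligible against [sqrt mu]. *)
Let shifted x d : R := mu d + x * Num.sqrt (Var d).

Let sqrt_facts : (\forall d \near \oo, [/\ 0 < mu d, 0 < Var d,
  Num.sqrt (Var d) = std_ratio d * Num.sqrt (mu d) & inv_sqrt_mu d = (Num.sqrt (mu d))^-1])%classic.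
Proof.
near=> d; have mu0 : 0 < mu d by near: d; exact: mu_gt0.
have s0 : 0 < Num.sqrt (mu d) by rewrite sqrtr_gt0.
have VM : 0 < Var d / mu d by near: d; apply: (cvgr_gt _ cvg_Var_mu).
have V0 : 0 < Var d by rewrite -(divfK (lt0r_neq0 mu0) (Var d)) mulr_gt0.
split => //.
  by rewrite /std_ratio -sqrtrM ?(ltW VM)// divfK// gt_eqF.
by rewrite /inv_sqrt_mu sqrtrV ?(ltW mu0).
Unshelve. all: by end_near. Qed.

Let cvg_shifted x : (shifted x d / mu d @[d --> \oo] --> (1 : R))%classic.
Proof.
have h : (1 + x * (std_ratio d * inv_sqrt_mu d) @[d --> \oo] --> 1 + x * (1 * 0))%classic.
  by apply: cvgD; [exact: cvg_cst|apply: cvgMr; apply: cvgM].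
rewrite mul1r mulr0 addr0 in h; apply: cvg_trans h; apply: near_eq_cvg; near=> d.
have [mu0 V0 VE sE] : [/\ 0 < mu d, 0 < Var d, Num.sqrt (Var d) = std_ratio d * Num.sqrt (mu d)
  & inv_sqrt_mu d = (Num.sqrt (mu d))^-1] by near: d; exact: sqrt_facts.
have r0 : 0 < Num.sqrt (mu d) by rewrite sqrtr_gt0.
have sm : Num.sqrt (mu d) ^+ 2 = mu d by rewrite sqr_sqrtr// ltW.
rewrite /shifted VE sE; move: sm r0; set r := Num.sqrt _; move=> <- r0.
by field; rewrite gt_eqF.
Unshelve. all: by end_near. Qed.

Let floor_shifted x d : nat := Num.truncn (shifted x d).

Let remainder x d : R := shifted x d - (floor_shifted x d)%:R.

Let remainder_bounds x : (\forall d \near \oo, 0 <= remainder x d <= 1)%classic.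
Proof.
near=> d; have mu0 : 0 < mu d by near: d; exact: mu_gt0.
have : 0 < shifted x d / mu d by near: d; apply: (cvgr_gt _ (cvg_shifted x)).
rewrite pmulr_lgt0 ?invr_gt0// => s0.
have := truncn_itv (ltW s0); rewrite -natr1 => /andP[h1 h2].
by rewrite /remainder /floor_shifted; apply/andP; split; lra.
Unshelve. all: by end_near. Qed.

Let cvg_remainder x : (remainder x d * inv_sqrt_mu d @[d --> \oo] --> (0 : R))%classic.
Proof.
apply: (@squeeze_cvgr _ _ _ _ (fun=> 0) inv_sqrt_mu); last 2 first.
- exact: cvg_cst.
- exact: cvg_inv_sqrt_mu.
near=> d; have /andP[r0 r1] : 0 <= remainder x d <= 1 by near: d; exact: remainder_bounds.
by rewrite mulr_ge0 ?sqrtr_ge0//= ler_piMl// sqrtr_ge0.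
Unshelve. all: by end_near. Qed.

Let cvg_floor_ratio x : ((floor_shifted x d)%:R / mu d @[d --> \oo] --> (1 : R))%classic.
Proof.
have h : (shifted x d / mu d - remainder x d * inv_sqrt_mu d * inv_sqrt_mu d @[d --> \oo]
    --> 1 - 0 * (0 : R))%classic.
  by apply: cvgB; [exact: cvg_shifted|apply: cvgM; [exact: cvg_remainder|exact: cvg_inv_sqrt_mu]].
rewrite mul0r subr0 in h; apply: cvg_trans h; apply: near_eq_cvg; near=> d.
have [mu0 V0 VE sE] : [/\ 0 < mu d, 0 < Var d, Num.sqrt (Var d) = std_ratio d * Num.sqrt (mu d)
  & inv_sqrt_mu d = (Num.sqrt (mu d))^-1] by near: d; exact: sqrt_facts.
have r0 : 0 < Num.sqrt (mu d) by rewrite sqrtr_gt0.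
have sm : Num.sqrt (mu d) ^+ 2 = mu d by rewrite sqr_sqrtr// ltW.
rewrite sE /remainder -mulrA -invfM -expr2 sm mulrBl; ring.
Unshelve. all: by end_near. Qed.

Let cvg_floor x : (floor_shifted x d @[d --> \oo] --> \oo)%classic.
Proof.
apply/(@cvgrnyP R); apply: (@ger_cvgy _ _ _ _ (fun d => 2^-1 * mu d)); last first.
  apply: (cvg_comp mu (fun y => 2^-1 * y) cvg_mu).
  by apply: gt0_cvgMry; [rewrite invr_gt0|exact: cvg_id].
near=> d; have mu0 : 0 < mu d by near: d; exact: mu_gt0.
rewrite -ler_pdivlMr// ltW//; near: d; apply: (cvgr_gt _ (cvg_floor_ratio x)).
by rewrite invf_lt1// ltr1n.
Unshelve. all: by end_near. Qed.

(** The numerator is [- x * sqrt Var] plus a bounded remainder, and both the variance and the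
    threshold are asymptotic to the mean. *)
Let cvg_scaled_deviation x :
  ((mu d - (floor_shifted x d)%:R) / Num.sqrt (floor_shifted x d)%:R @[d --> \oo] --> - x)%classic.
Proof.
have h : ((- x * std_ratio d + remainder x d * inv_sqrt_mu d)
    / Num.sqrt ((floor_shifted x d)%:R / mu d) @[d --> \oo] --> (- x * 1 + 0) / Num.sqrt 1)%classic.
  apply: cvgM.
    by apply: cvgD; [apply: cvgMr; exact: cvg_std_ratio|exact: cvg_remainder].
  apply: cvgV; first by rewrite sqrtr1 oner_eq0.
  apply: (cvg_comp (fun d => (floor_shifted x d)%:R / mu d) (@Num.sqrt R) (cvg_floor_ratio x)).
  exact: sqrt_continuous.
rewrite sqrtr1 divr1 addr0 mulr1 in h; apply: cvg_trans h; apply: near_eq_cvg; near=> d.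
have [mu0 V0 VE sE] : [/\ 0 < mu d, 0 < Var d, Num.sqrt (Var d) = std_ratio d * Num.sqrt (mu d)
  & inv_sqrt_mu d = (Num.sqrt (mu d))^-1] by near: d; exact: sqrt_facts.
have r0 : 0 < Num.sqrt (mu d) by rewrite sqrtr_gt0.
have sm : Num.sqrt (mu d) ^+ 2 = mu d by rewrite sqr_sqrtr// ltW.
have N0 : 0 < (floor_shifted x d)%:R / mu d by near: d; apply: (cvgr_gt _ (cvg_floor_ratio x)).
have n0 : 0 < (floor_shifted x d)%:R :> R.
  by rewrite -(divfK (lt0r_neq0 mu0) (floor_shifted x d)%:R) mulr_gt0.
have -> : mu d - (floor_shifted x d)%:R = - x * Num.sqrt (Var d) + remainder x d.
  by rewrite /remainder /shifted; ring.
rewrite VE sE sqrtrM ?(ltW n0)// sqrtrV ?(ltW mu0)//; field.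
by rewrite !gt_eqF// sqrtr_gt0.
Unshelve. all: by end_near. Qed.

Lemma cvg_X_star :
  cvg_in_distribution (fun d => distribution_fun (@Qp R p d) (@X_star R p t d))
    (@std_normal_fun R).
Proof.
move=> x _.
have h := poisson_cdf_normal mu_gt0 (@cvg_floor x) (@cvg_scaled_deviation x).
apply/subr_cvg0.
have h0 : (poisson_cdf (mu d) (floor_shifted x d).+1 - std_normal_fun x @[d --> \oo]
    --> (0 : R))%classic.
  by apply/subr_cvg0.
have e0 : (distribution_fun (@Qp R p d) (@X_star R p t d) x
    - poisson_cdf (mu d) (floor_shifted x d).+1 @[d --> \oo] --> (0 : R))%classic.
  have e2 : (2 * error_bound p d t @[d --> \oo] --> 2 * (0 : R))%classic.
    by apply: cvgMr; exact: cvg_error_bound.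
  rewrite mulr0 in e2.
  apply: norm_cvg0.
  apply: (@squeeze_cvgr _ _ _ _ (fun=> 0) (fun d => 2 * error_bound p d t)) => //; last first.
    exact: cvg_cst.
  near=> d; rewrite normr_ge0 /=.
  have [mu0 V0 VE sE] : [/\ 0 < mu d, 0 < Var d, Num.sqrt (Var d) = std_ratio d * Num.sqrt (mu d)
    & inv_sqrt_mu d = (Num.sqrt (mu d))^-1] by near: d; exact: sqrt_facts.
  have td : (t <= d)%N by near: d; exact: nbhs_infty_ge.
  have s0 : 0 <= shifted x d.
    have : 0 < shifted x d / mu d by near: d; apply: (cvgr_gt _ (cvg_shifted x)).
    by rewrite pmulr_lgt0 ?invr_gt0// => /ltW.
  (* Large enough both for [law_vs_poisson] and to contain every [k <= floor_shifted x d]. *)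
  pose N := maxn #|{set vertex d}|.+1 (floor_shifted x d).+1.
  have := @law_vs_poisson R p t p_gt0 p_lt_half t_gt0 d N (fun k => (k <= floor_shifted x d)%N)
    (leqW td) mu0 (leq_maxl _ _).
  congr (`|_ - _| <= _).
    apply: eq_bigl => G; rewrite /= /X_star /X_ ler_pdivrMr ?sqrtr_gt0//.
    by rewrite lerBlDl -/(shifted x d) /floor_shifted truncn_ge_nat.
  rewrite /poisson_cdf (big_ord_widen N (poisson_pmf (mu d))) ?leq_maxr//.
have : (distribution_fun (@Qp R p d) (@X_star R p t d) x
    - poisson_cdf (mu d) (floor_shifted x d).+1
    + (poisson_cdf (mu d) (floor_shifted x d).+1 - std_normal_fun x) @[d --> \oo]
    --> 0 + (0 : R))%classic.
  by apply: cvgD.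
by rewrite addr0; under eq_fun do rewrite addrA subrK.
Unshelve. all: by end_near. Qed.

End normal_limit.

Local Open Scope classical_set_scope.
Local Open Scope ring_scope.

Theorem theorem4 (R : realType) (p : R) (p_gt0 : 0 < p) (p_lt_half : p < 2^-1)
    (t : nat) (t_ge1 : (1 <= t)%N) (t_le_m : t%:Z <= m_ p) :
  let q := 1 - p in
  let X := @X_ R t in
  let mu := mu_ p t in
  let Var := Var_ p t in
  let err := fun d : nat => d%:R ^+ t * q ^+ (t * d) in
  [/\ (* (a) *)
      one_plus_bigO mu
        (fun d => t%:R ^ (t%:Z - 2) / t`!%:R * (p / q ^+ 2) ^+ (t - 1)
                  * d%:R ^+ (t - 1) * (2 * q ^+ t) ^+ d)
        (fun d => d%:R^-1)
      /\ one_plus_bigO Var mu err,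
      (* (b) *)
      forall eps : R, 0 < eps ->
        very_high_prob (fun d =>
          prob (@Qp R p d) [pred G | `|X d G - mu d| < eps * Num.sqrt (d%:R * mu d)])
        /\ very_high_prob (fun d =>
          prob (@Qp R p d) [pred G | `|X d G - mu d| < eps * mu d])
    & (* (c) *)
      (fun d => dTV (nat_law (@Qp R p d) (@comp_count d t))
                    (poisson_pmf (mu d))) =O_\oo err
      /\ cvg_in_distribution
           (fun d => distribution_fun (@Qp R p d) (@X_star R p t d))
           (@std_normal_fun R)].
Proof.
move=> q X mu Var err; split.
- by split; [exact: mu_expansion|exact: Var_expansion].
- by move=> eps e0; split; [exact: concentration_sqrt|exact: concentration_linear].
- by split; [exact: dTV_expansion|exact: cvg_X_star].
Qed.
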